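(* For every $p \in (1,\infty)$ there is a constant $C_p$, depending only on $p$, with $C_p = O\left((p-1)^{-1}\right)$ as $p \downarrow 1$, such that the following holds. Let $(X,dx)$ be a $\sigma$-finite measure space, let $(T^t)_{t\ge 0}$ be a symmetric Markovian semigroup on $L^2(X,dx)$ (conditions 1–4 of the context), let $M$ be a bounded Borel function on $(0,\infty)$, and let $T_m$ be the associated spectral multiplier operator of Laplace transform type. Then $T_m$ is a bounded linear operator on $L^2\cap L^p(X,dx)$ with respect to the $L^p$ norm (in particular it maps $L^2\cap L^p(X,dx)$ into itself), and $$\|T_m\|_{p,p} \le C_p \|M\|_\infty,$$ that is, $\|T_m f\|_p \le C_p\|M\|_\infty\|f\|_p$ for every $f\in L^2\cap L^p(X,dx)$.
   Context: Functions are complex-valued. $(T^t)_{t\ge 0}$ is a strongly continuous semigroup of linear operators on $L^2(X,dx)$ (with $T^0=\mathrm{Id}$) satisfying: 1. (contraction) $\|T^t f\|_p \le \|f\|_p$ for all $1\le p\le\infty$, $t\ge 0$ and $f\in L^2\cap L^p(X,dx)$; 2. (symmetry) $T^t$ is self-adjoint on $L^2(X,dx)$ for every $t\ge 0$; 3. (positivity) $T^t f\ge 0$ if $f\ge 0$; 4. (conservation of mass) $T^t 1 = 1$, where $T^t 1 := \sup_n T^t I_{A_n}$ for a sequence of measurable sets $A_n\uparrow X$ with indicator functions $I_{A_n}\in L^2(X,dx)$. The generator is $Af = \lim_{t\downarrow 0} \frac{f - T^t f}{t}$, with domain $D(A)$ the set of $f\in L^2(X,dx)$ for which the limit exists in $L^2(X,dx)$.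 It is self-adjoint, non-negative and densely defined, $T^t=e^{-tA}$, and $(E(\lambda))_{\lambda\in\mathbb{R}}$ denotes the resolution of the identity associated to $A$. For a bounded Borel function $M$ on $(0,\infty)$, put $\|M\|_\infty=\sup_{t>0}|M(t)|$, and define $$m(\lambda) = -\lambda\int_0^\infty M(t)e^{-t\lambda}\,dt \quad (\lambda>0),\qquad m(0)=0.$$ One has $\sup_\lambda|m(\lambda)|\le\|M\|_\infty$. The operator $T_m = m(A)$ on $L^2(X,dx)$ is defined by spectral calculus: $T_m f = \int_{[0,\infty)} m(\lambda)\,dE(\lambda)f$. *)

(* Defs.v *)
From HB Require Import structures.
From mathcomp Require Export all_boot all_order all_algebra.
From mathcomp Require Export complex.
From mathcomp Require Export all_classical all_reals all_analysis.
Export Order.TTheory GRing.Theory Num.Theory.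
Export numFieldNormedType.Exports.
Export Normc.

Set Implicit Arguments.
Unset Strict Implicit.
Unset Printing Implicit Defensive.

Local Open Scope classical_set_scope.
Local Open Scope ring_scope.
Local Open Scope complex_scope.

Section ComplexFunctions.
Context {d : measure_display} {X : measurableType d} {R : realType}.
Implicit Types (mu : {measure set X -> \bar R}) (p : \bar R) (f g : X -> R[i]).

Definition cmeasurable_fun (D : set X) f : Prop :=
  measurable_fun D (fun x => complex.Re (f x)) /\ measurable_fun D (fun x => complex.Im (f x)).

Definition cintegral mu (D : set X) f : R[i] :=
  Rintegral mu D (fun x => complex.Re (f x)) +i* Rintegral mu D (fun x => complex.Im (f x)).

Definition cLnorm mu p f : \bar R :=
  Lnorm mu p (fun x => (normc (f x))%:E).

(* Elements of L^p are represented by functions; operators act on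
   representatives, and all identities between them hold almost everywhere. *)
Definition cLp mu p : set (X -> R[i]) :=
  [set f | cmeasurable_fun setT f /\ (cLnorm mu p f < +oo)%E].

Definition cdot mu f g : R[i] := cintegral mu setT (fun x => f x * (g x)^*).

Definition linear_operator_on mu (V : set (X -> R[i]))
    (T : (X -> R[i]) -> (X -> R[i])) : Prop :=
  [/\ forall f, V f -> V (T f),
      forall f g, V f -> V g ->
        {ae mu, forall x, f x = g x} -> {ae mu, forall x, T f x = T g x} &
      forall (a : R[i]) f g, V f -> V g ->
        {ae mu, forall x, T (fun y => a * f y + g y) x = a * T f x + T g x}].

Definition self_adjoint_on_L2 mu (T : (X -> R[i]) -> (X -> R[i])) : Prop :=
  forall f g, cLp mu 2%:E f -> cLp mu 2%:E g ->
    cdot mu (T f) g = cdot mu f (T g).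

Definition cindic (A : set X) : X -> R[i] := fun x => (\1_A x)%:C.

End ComplexFunctions.

Section Semigroup.
Context {d : measure_display} {X : measurableType d} {R : realType}.
Variable mu : {measure set X -> \bar R}.
Variable T : R -> (X -> R[i]) -> (X -> R[i]).
Implicit Types (s t : R) (f g : X -> R[i]).

(* The values [T t] for [t < 0] are irrelevant. *)
Record strongly_continuous_semigroup : Prop := {
  semigroup_linear : forall t, 0 <= t -> linear_operator_on mu (cLp mu 2%:E) (T t) ;
  semigroup0 : forall f, cLp mu 2%:E f -> {ae mu, forall x, T 0 f x = f x} ;
  semigroupD : forall s t f, 0 <= s -> 0 <= t -> cLp mu 2%:E f ->
    {ae mu, forall x, T (s + t) f x = T s (T t f) x} ;
  semigroup_continuous : forall f, cLp mu 2%:E f ->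
    cLnorm mu 2%:E (fun x => T t f x - f x) @[t --> 0^'+] --> 0%E }.

Record symmetric_markovian_semigroup : Prop := {
  markovian_semigroup : strongly_continuous_semigroup ;
  markovian_contraction : forall t (p : \bar R) f, 0 <= t -> (1 <= p)%E ->
    cLp mu 2%:E f -> cLp mu p f -> (cLnorm mu p (T t f) <= cLnorm mu p f)%E ;
  markovian_symmetry : forall t, 0 <= t -> self_adjoint_on_L2 mu (T t) ;
  (* In R[i], [0 <= z] means that z is real and nonnegative. *)
  markovian_positivity : forall t f, 0 <= t -> cLp mu 2%:E f ->
    {ae mu, forall x, 0 <= f x} -> {ae mu, forall x, 0 <= T t f x} ;
  (* By positivity, [T t (cindic (A n))] is real-valued. *)
  markovian_conservation : exists A : (set X)^nat,
    [/\ forall n, measurable (A n) /\ cLp mu 2%:E (cindic (A n)),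
        {homo A : m n / (m <= n)%N >-> m `<=` n},
        \bigcup_n A n = setT &
        forall t, 0 <= t -> {ae mu, forall x,
          ereal_sup (range (fun n => (complex.Re (T t (cindic (A n)) x))%:E)) = 1%E}] }.

(* The graph of the generator: f is in its domain, with image g. *)
Definition generator f g : Prop :=
  [/\ cLp mu 2%:E f, cLp mu 2%:E g &
      cLnorm mu 2%:E (fun x => (f x - T t f x) / t%:C - g x) @[t --> 0^'+] --> 0%E].

End Semigroup.

Section SpectralCalculus.
Context {d : measure_display} {X : measurableType d} {R : realType}.
Variable mu : {measure set X -> \bar R}.
Variable E : R -> (X -> R[i]) -> (X -> R[i]).
Implicit Types (f g u : X -> R[i]).

Record resolution_of_identity : Prop := {
  resolution_linear : forall a, linear_operator_on mu (cLp mu 2%:E) (E a) ;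
  resolution_self_adjoint : forall a, self_adjoint_on_L2 mu (E a) ;
  (* For [a = b] this is the idempotence of [E a]. *)
  resolution_min : forall a b f, cLp mu 2%:E f ->
    {ae mu, forall x, E a (E b f) x = E (Num.min a b) f x} ;
  resolution_right_continuous : forall a f, cLp mu 2%:E f ->
    cLnorm mu 2%:E (fun x => E b f x - E a f x) @[b --> a^'+] --> 0%E ;
  resolution_ninfty : forall f, cLp mu 2%:E f ->
    cLnorm mu 2%:E (E a f) @[a --> -oo] --> 0%E ;
  resolution_pinfty : forall f, cLp mu 2%:E f ->
    cLnorm mu 2%:E (fun x => E a f x - f x) @[a --> +oo] --> 0%E }.

(* The Lebesgue-Stieltjes measure of a |-> ||E(a) f||_2^2 = <E(a) f, f>. *)
Definition spectral_measure f
    (nu : {measure set (measurableTypeR R) -> \bar R}) : Prop :=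
  forall a, nu `]-oo, a]%classic = (cLnorm mu 2%:E (E a f) ^+ 2)%E.

(* A step function is a list of triples (c, (a, b)) with a <= b, standing for
   the sum of the c * 1_]a, b]; its integral with respect to dE f is the sum of
   the c * (E(b) f - E(a) f). *)
Definition step_datum : Type := seq (R[i] * (R * R)).

Definition step_wf (s : step_datum) : bool := all (fun i => i.2.1 <= i.2.2) s.

Definition step_fun (s : step_datum) (l : R) : R[i] :=
  \sum_(i <- s | i.2.1 < l <= i.2.2) i.1.

Definition step_integral (s : step_datum) f : X -> R[i] :=
  fun x => \sum_(i <- s) i.1 * (E i.2.2 f x - E i.2.1 f x).

(* u is the integral of phi with respect to dE f: step functions converge to
   phi in L^2 of the spectral measure of f, and their integrals converge to u
   in L^2(mu). Such a sequence of step functions exists iff phi is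
   square-integrable for the spectral measure, and u does not depend on it
   since the integral of step functions is isometric. *)
Definition spectral_integral (phi : R -> R[i]) f u : Prop :=
  [/\ cLp mu 2%:E f, cLp mu 2%:E u,
      cmeasurable_fun [set: measurableTypeR R] phi &
      exists (nu : {measure set (measurableTypeR R) -> \bar R})
             (s : nat -> step_datum),
        [/\ spectral_measure f nu,
            forall n, step_wf (s n),
            cLnorm nu 2%:E (fun l => phi l - step_fun (s n) l) @[n --> \oo] --> 0%E &
            cLnorm mu 2%:E (fun x => step_integral (s n) f x - u x) @[n --> \oo] --> 0%E]].

(* E is the resolution of the identity associated to the operator with graph A,
   that is, A is the integral of l dE(l), with equality of domains. *)
Definition resolution_of_operator (A : (X -> R[i]) -> (X -> R[i]) -> Prop) : Prop :=
  resolution_of_identity /\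
  forall f g, A f g <-> spectral_integral (fun l => l%:C) f g.

(* Tm = phi(A), up to null sets; meant for bounded phi, for which phi(A) is
   defined on all of L^2. *)
Definition spectral_operator (phi : R -> R[i])
    (Tm : (X -> R[i]) -> (X -> R[i])) : Prop :=
  forall f, cLp mu 2%:E f -> spectral_integral phi f (Tm f).

End SpectralCalculus.

Section LaplaceMultiplier.
Context {R : realType}.
Variable M : R -> R[i].

Definition bounded_borel_on_pos : Prop :=
  cmeasurable_fun (`]0, +oo[%classic : set (measurableTypeR R)) M /\
  has_ubound [set normc (M t) | t in `]0, +oo[%classic].

Definition sup_norm : R := sup [set normc (M t) | t in `]0, +oo[%classic].

(* The value at l < 0 is immaterial: the generator is non-negative, so its
   resolution of the identity vanishes there. *)
Definition laplace_multiplier (l : R) : R[i] :=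
  if 0 < l then
    - (l%:C * cintegral (@lebesgue_measure R) `]0, +oo[%classic
                        (fun t => M t * (expR (- (t * l)))%:C))
  else 0.

End LaplaceMultiplier.

(* Main.v *)
Require Import Defs.
From mathcomp Require Import all_boot all_order all_algebra complex.
From mathcomp Require Import all_classical all_reals all_analysis.
From mathcomp Require Import measurable_realfun ess_sup_inf.
From mathcomp Require Import ring lra.

(** By definition m(l) is the integral of M(t) against d exp(- t l), so
    T_m is formally the integral of M against dT^t. Indeed T_m f is the L^2 limit of
    the step operators  sum_j c_j (T^((j+1)h) f - T^(jh) f),  where c_j is the mean
    of M over ]jh, (j+1)h] (multiplier_step_limit). Since T is symmetric,
    <T^(2jh) f, g> = <T^(jh) f, T^(jh) g>, so the pairing of a step operator with g
    is at most sup |M| times the variation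
      sum_j |<T^(jh) f, T^(jh) g> - <T^((j+1)h) f, T^((j+1)h) g>|.
    Everything rests on a bound of this variation by  K int |f|^p + int |g|^q,
    with q the conjugate exponent and K = O(1 / (p - 1)), uniformly in h
    (variation_bound).

    This bound comes from a Bellman function. For 1 < p <= 2 Burkholder's function
      U(x, w) = 2 (|x| + |w|)^(p-1) (|w| - |x| / (p - 1))
    is concave along the lines (x, w0 + c x) with |c| = 1, since it is an infimum of
    explicit concave functions there (burkholder_support); it is nonpositive for
    |w| <= |x| and at least |w|^p - K |x|^p. Its partial Legendre transform
      B(x, y) = sup_w Re (w conj(y)) - U(x, w)
    therefore satisfies 0 <= B(x, y) <= K |x|^p + |y|^q, and B(x, y) - Re (c x conj(y))
    is convex and nonnegative for every unimodular c. It is the supremum of countably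
    many affine functions, so Jensen's inequality holds for the positive
    contractions T^t, and its integral along (T^t f, T^t g) decreases. Rotating by
    the best c shows that the energy int B(T^t f, T^t g) drops, at each step, by at
    least the modulus of the difference of the scalar products (energy_step), and
    the sum of the drops telescopes.

    The convergence of the step operators requires T^t to be the function exp(- t l)
    of the generator (exp_spectral_approx), while E is only known to be the
    resolution of the identity of the generator. On a spectral piece
    p = (E b - E a) f the generator is defined and equals b up to b - a
    (spectral_piece), so that T^t p equals exp(- t b) p up to t (b - a) |p|
    (generator_exp_bound), and E vanishes below 0 because the semigroup would
    expand pieces there. Summing over the cells of a fine grid gives the claim.

    Finally the bound  |<T_m f, g>| <= C (int |f|^p + int |g|^q)  becomes a bound of
    the L^p norm by testing with multiples of |v|^(p-2) v for truncations v of T_m f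
    (Lp_bound_by_duality). *)

Set Implicit Arguments.
Unset Strict Implicit.
Unset Printing Implicit Defensive.

Local Open Scope classical_set_scope.
Local Open Scope complex_scope.
Local Open Scope ring_scope.

(** * Complex numbers *)

Section ComplexNumbers.
Context {R : realType}.
Implicit Types (z w : R[i]) (x y : R).

Lemma ler_of_eq x y : x = y -> x <= y.
Proof. by move=> ->. Qed.

Lemma normc_ge0 z : 0 <= normc z.
Proof. by case: z => a b; exact: sqrtr_ge0. Qed.

Lemma sqr_normcE z : normc z ^+ 2 = complex.Re z ^+ 2 + complex.Im z ^+ 2.
Proof. by case: z => a b; rewrite sqr_sqrtr// addr_ge0 ?sqr_ge0. Qed.

Lemma conj_conjc z : z^* = conjc z.
Proof. by []. Qed.

Lemma normc_conj z : normc z^* = normc z.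
Proof. by rewrite conj_conjc; case: z => a b /=; rewrite sqrrN. Qed.

Lemma normc_real x : normc x%:C = `|x|.
Proof. by rewrite /= expr0n/= addr0 sqrtr_sqr. Qed.

Lemma normc_sub_real x y : normc (x%:C - y%:C) = `|x - y|.
Proof. by rewrite -rmorphB; exact: normc_real. Qed.

Lemma normc_eq0P z : (normc z == 0) = (z == 0).
Proof. by apply/eqP/eqP => [/eq0_normc//|->]; rewrite normc0. Qed.

Lemma le_Re_normc z : complex.Re z <= normc z.
Proof.
case: z => a b /=; rewrite (le_trans (ler_norm a))// -sqrtr_sqr ler_wsqrtr//.
by rewrite lerDl sqr_ge0.
Qed.

Lemma le_normRe_normc z : `|complex.Re z| <= normc z.
Proof.
case: z => a b /=; rewrite -sqrtr_sqr ler_wsqrtr//.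
by rewrite lerDl sqr_ge0.
Qed.

Lemma le_normIm_normc z : `|complex.Im z| <= normc z.
Proof.
case: z => a b /=; rewrite -sqrtr_sqr ler_wsqrtr//.
by rewrite lerDr sqr_ge0.
Qed.

Lemma le_normc_ReIm z : normc z <= `|complex.Re z| + `|complex.Im z|.
Proof.
rewrite -(@ler_pXn2r _ 2)// ?nnegrE ?normc_ge0 ?addr_ge0//.
rewrite sqr_normcE sqrrD !real_normK ?num_real//.
by rewrite addrAC lerDl mulrn_wge0// mulr_ge0.
Qed.

Lemma le_normc_add z w : normc (z + w) <= normc z + normc w.
Proof. exact: le_normcD. Qed.

Lemma normc_opp z : normc (- z) = normc z.
Proof. exact: normcN. Qed.

Lemma normc_distC z w : normc (z - w) = normc (w - z).
Proof. by rewrite -normc_opp opprB. Qed.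

Lemma Re_add z w : complex.Re (z + w) = complex.Re z + complex.Re w.
Proof. by case: z w => [a b] [c e]. Qed.

Lemma Re_opp z : complex.Re (- z) = - complex.Re z.
Proof. by case: z. Qed.

Lemma Re_sub z w : complex.Re (z - w) = complex.Re z - complex.Re w.
Proof. by rewrite Re_add Re_opp. Qed.

Lemma Im_add z w : complex.Im (z + w) = complex.Im z + complex.Im w.
Proof. by case: z w => [a b] [c e]. Qed.

Lemma Im_opp z : complex.Im (- z) = - complex.Im z.
Proof. by case: z. Qed.

Lemma Re_mul z w :
  complex.Re (z * w) = complex.Re z * complex.Re w - complex.Im z * complex.Im w.
Proof. by case: z w => [a b] [c e]. Qed.

Lemma Im_mul z w :
  complex.Im (z * w) = complex.Re z * complex.Im w + complex.Im z * complex.Re w.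
Proof. by case: z w => [a b] [c e] /=. Qed.

Lemma Re_conj z : complex.Re z^* = complex.Re z.
Proof. by rewrite conj_conjc; case: z. Qed.

Lemma Im_conj z : complex.Im z^* = - complex.Im z.
Proof. by rewrite conj_conjc; case: z. Qed.

Lemma complex_ext z w :
  complex.Re z = complex.Re w -> complex.Im z = complex.Im w -> z = w.
Proof. by case: z w => [a b] [c e] /= -> ->. Qed.

Lemma conjc_add z w : (z + w)^* = z^* + w^*.
Proof. by rewrite rmorphD. Qed.

Lemma conjc_sub z w : (z - w)^* = z^* - w^*.
Proof. by rewrite rmorphB. Qed.

Lemma conjc_mul z w : (z * w)^* = z^* * w^*.
Proof. by rewrite rmorphM. Qed.

Lemma conjc_conj z : z^*^* = z.
Proof. exact: conjcK. Qed.

Lemma Re_scale x z : complex.Re (x%:C * z) = x * complex.Re z.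
Proof. by rewrite Re_mul /= mul0r subr0. Qed.

Lemma normc_scale x z : normc (x%:C * z) = `|x| * normc z.
Proof. by rewrite normcM normc_real. Qed.

Lemma mulc_conj z : z * z^* = (normc z ^+ 2)%:C.
Proof.
apply: complex_ext.
  by rewrite Re_mul Re_conj Im_conj mulrN opprK -!expr2 -sqr_normcE.
by rewrite Im_mul Re_conj Im_conj /= mulrN mulrC addNr.
Qed.

(** Bounds of a modulus are derived from bounds of real parts by this
    rotation. *)
Lemma unimodular_rotation z :
  exists c : R[i], normc c = 1 /\ c * z = (normc z)%:C.
Proof.
have [->|z0] := eqVneq z 0.
  by exists 1; rewrite normc1 mulr0 normc0.
have nz0 : normc z != 0 by rewrite normc_eq0P.
exists (((normc z)^-1)%:C * z^*); split.
  by rewrite normc_scale normc_conj ger0_norm ?invr_ge0 ?normc_ge0// mulVf.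
rewrite -mulrA [_^* * z]mulrC mulc_conj -rmorphM/=; congr (_%:C).
by rewrite expr2 mulrA mulVf// mul1r.
Qed.

Lemma sqr_normcD z w :
  normc (z + w) ^+ 2 = normc z ^+ 2 + normc w ^+ 2 + 2 * complex.Re (z * w^*).
Proof.
rewrite !sqr_normcE Re_add Im_add Re_mul Re_conj Im_conj; ring.
Qed.

End ComplexNumbers.

(** * The power potential and its envelopes *)

Section PowerPotential.
Context {R : realType}.
Implicit Types (p q r v l s x y : R).

Lemma ler_powRl q x y : 0 <= q -> 0 <= x -> x <= y -> x `^ q <= y `^ q.
Proof.
move=> q0 x0 xy; apply: ge0_ler_powR => //; rewrite nnegrE//.
exact: le_trans xy.
Qed.

Lemma gt0_powRD x q s : 0 < x -> x `^ q * x `^ s = x `^ (q + s).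
Proof. by move=> x0; rewrite powRD// (lt0r_neq0 x0) implybT. Qed.

Lemma conjugate_exponent p q : 1 < p -> p^-1 + q^-1 = 1 -> q = p / (p - 1).
Proof.
move=> p1 pq; have -> : q = (1 - p^-1)^-1 by rewrite -pq addrC addKr invrK.
by field; rewrite subr_eq0 !gt_eqF// (lt_trans _ p1).
Qed.

Lemma conjugate_exponent_gt1 p q : 1 < p -> p^-1 + q^-1 = 1 -> 1 < q.
Proof.
move=> p1 pq; rewrite (conjugate_exponent p1 pq) ltr_pdivlMr ?subr_gt0// mul1r.
by rewrite ltrBlDr ltrDl.
Qed.

Lemma conjugate_exponent_exists p : p^-1 + ((1 - p^-1)^-1)^-1 = 1.
Proof. by rewrite invrK addrC subrK. Qed.

(** With r = |x| and l = |w + c x|^2 - |x|^2 for a unimodular c, this is a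
    concave function of x for each fixed s: l is affine in x, and |x| has a
    nonpositive coefficient when 1 < p <= 2. *)
Definition power_envelope p r l s : R :=
  (1 - p / 2) * s `^ p - (p * (2 - p) / (p - 1)) * r * s `^ (p - 1)
  + (p / 2) * l * s `^ (p - 2).

(** Up to a factor, the function of Burkholder's sharp martingale transform
    inequality, r and v being the moduli of its two arguments. *)
Definition power_potential p r v : R :=
  (r + v) `^ (p - 1) * (v - r / (p - 1)).

Lemma power_envelope_at_sum p r v : 1 < p -> 0 < r + v ->
  power_envelope p r (v ^+ 2 - r ^+ 2) (r + v) = power_potential p r v.
Proof.
move=> p1 a0; rewrite /power_envelope /power_potential.
have a_neq0 : r + v != 0 by rewrite gt_eqF.
have -> : (r + v) `^ p = (r + v) `^ (p - 1) * (r + v).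
  by rewrite mulrC mulr_powRB1 ?ltW// (lt_trans _ p1).
have -> : (r + v) `^ (p - 2) = (r + v) `^ (p - 1) / (r + v).
  by rewrite -[X in _ / X]powRr1 ?ltW// -powRB ?a_neq0 ?implybT//; congr (_ `^ _); ring.
have p10 : p - 1 != 0 by rewrite subr_eq0 gt_eqF.
by field; rewrite p10.
Qed.

Lemma is_derive_power_envelope p r l s : 1 < p -> 0 < s ->
  is_derive s 1 (power_envelope p r l)
    (p * (1 - p / 2) * s `^ (p - 3) * (s ^+ 2 - 2 * r * s - l)).
Proof.
move=> p1 s0; rewrite /power_envelope.
have d1 := is_derive1_powR p s0.
have d2 := is_derive1_powR (p - 1) s0.
have d3 := is_derive1_powR (p - 2) s0.
apply: is_derive_eq.
rewrite /GRing.scale /=.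
have s_neq0 : s != 0 by rewrite gt_eqF.
have E1 : s `^ (p - 1) = s `^ (p - 3) * s ^+ 2.
  rewrite -powR_mulrn ?ltW// -powRD ?s_neq0 ?implybT//; congr (_ `^ _); ring.
have E2 : s `^ (p - 1 - 1) = s `^ (p - 3) * s.
  rewrite -[X in _ * X]powRr1 ?ltW// -powRD ?s_neq0 ?implybT//; congr (_ `^ _); ring.
have E3 : s `^ (p - 2 - 1) = s `^ (p - 3) by congr (_ `^ _); ring.
rewrite E1 E2 E3.
have p10 : p - 1 != 0 by rewrite subr_eq0 gt_eqF.
by field; rewrite p10.
Qed.

(** The derivative of the envelope in s has the sign of
    (s - r)^2 - v^2, which vanishes at s = r + v. *)
Lemma power_envelope_min p r v s : 1 < p -> p <= 2 -> 0 <= r -> 0 <= v ->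
  0 < s -> r - v <= s ->
  power_potential p r v <= power_envelope p r (v ^+ 2 - r ^+ 2) s.
Proof.
move=> p1 p2 r0 v0 s0 rvs.
have [a0|a0] := ltrP 0 (r + v); last first.
  have [-> ->] : r = 0 /\ v = 0 by split; lra.
  rewrite /power_potential /power_envelope mul0r subr0 mulr0 expr0n/= subr0.
  rewrite !mulr0 !mul0r subr0 addr0 mulr_ge0 ?powR_ge0//; lra.
rewrite -power_envelope_at_sum//.
set l := v ^+ 2 - r ^+ 2; set f := power_envelope p r l.
pose df (x : R) := p * (1 - p / 2) * x `^ (p - 3) * ((x - r) ^+ 2 - v ^+ 2).
have fdf (x : R) : 0 < x -> is_derive x 1 f (df x).
  move=> x0; rewrite /df; have -> : (x - r) ^+ 2 - v ^+ 2 = x ^+ 2 - 2 * r * x - l.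
    by rewrite /l; ring.
  exact: is_derive_power_envelope.
have cf (x y : R) : 0 < x -> {within `[x, y], continuous f}.
  move=> x0; apply: derivable_within_continuous => z.
  rewrite in_itv/= => /andP[xz _].
  by have [] := fdf z (lt_le_trans x0 xz).
have c0 (x : R) : 0 <= p * (1 - p / 2) * x `^ (p - 3).
  by apply: mulr_ge0; [nra|exact: powR_ge0].
have [as_|sa] := lerP (r + v) s.
  have [x xin| |x] := @MVT_segment R f df (r + v) s as_.
  - by move: xin; rewrite in_itv/= => /andP[ax _]; apply: fdf; exact: lt_trans ax.
  - exact: cf.
  - rewrite in_itv/= => /andP[ax xs] E; rewrite -subr_ge0 E.
    by rewrite mulr_ge0 ?subr_ge0// mulr_ge0//; nra.
have [x xin| |x] := @MVT_segment R f df s (r + v) (ltW sa).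
- by move: xin; rewrite in_itv/= => /andP[ax _]; apply: fdf; exact: lt_trans ax.
- exact: cf.
- rewrite in_itv/= => /andP[ax xs] E; rewrite -subr_le0 E.
  have h : df x <= 0 by rewrite /df mulr_ge0_le0//; nra.
  by rewrite mulr_le0_ge0// subr_ge0 ltW.
Qed.

(** When v >= 2 r / (p - 1), the factor v - r / (p - 1) is at least v / 2.
    Otherwise r + v is at most (1 + 2 / (p - 1)) r, and the power p - 1 brings
    the constant down to e^2; so the loss at p = 1 is only the factor
    1 / (p - 1) in front of r. *)
Lemma power_potential_lower p r v : 1 < p -> p <= 2 -> 0 <= r -> 0 <= v ->
  v `^ p - 2 * expR 2 / (p - 1) * r `^ p <= 2 * power_potential p r v.
Proof.
move=> p1 p2 r0 v0; rewrite /power_potential.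
have p10 : 0 < p - 1 by rewrite subr_gt0.
have p0 : 0 < p by rewrite (lt_trans _ p1).
have vp : v `^ p <= (r + v) `^ (p - 1) * v.
  rewrite -(mulr_powRB1 v0 p0) mulrC ler_wpM2r//.
  by rewrite ler_powRl// ?lerDr// ltW.
have e2 : 0 <= 2 * expR 2 / (p - 1) * r `^ p.
  by rewrite !mulr_ge0 ?powR_ge0 ?invr_ge0 ?expR_ge0 ?(ltW p10).
have q0 := powR_ge0 (r + v) (p - 1).
have [vr|vr] := lerP (2 * (r / (p - 1))) v.
  rewrite lerBlDr; apply: (le_trans vp); rewrite -lerBlDr.
  apply: (@le_trans _ _ ((r + v) `^ (p - 1) * v)); first by rewrite gerBl.
  rewrite mulrCA ler_wpM2l//; lra.
have vp0 : 0 <= v `^ p by exact: powR_ge0.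
have K : (r + v) `^ (p - 1) <= expR 2 * r `^ (p - 1).
  have h : r + v <= expR (2 / (p - 1)) * r.
    apply: (@le_trans _ _ ((1 + 2 / (p - 1)) * r)); first lra.
    by rewrite ler_wpM2r// expR_ge1Dx.
  apply: (@le_trans _ _ ((expR (2 / (p - 1)) * r) `^ (p - 1))).
    by apply: ler_powRl (ltW p10) _ h; exact: addr_ge0.
  rewrite powRM ?expR_ge0// -expRM.
  have -> : 2 / (p - 1) * (p - 1) = 2 by field; rewrite gt_eqF.
  by [].
have K2 : (r + v) `^ (p - 1) * (r / (p - 1)) <= expR 2 / (p - 1) * r `^ p.
  rewrite -(mulr_powRB1 r0 p0).
  have := ler_wpM2r (divr_ge0 r0 (ltW p10)) K.
  by move/le_trans; apply; apply: ler_of_eq; ring.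
lra.
Qed.

End PowerPotential.

(** * Countable families of affine minorants *)

Section CountableMinorants.
Context {R : realType}.
Implicit Types (e M : R) (x y : R[i]) (F : R[i] -> R[i] -> R).

Definition affine2 (t : R[i] * R[i] * R) x y : R :=
  complex.Re (t.1.1 * x) + complex.Re (t.1.2 * y) + t.2.

Lemma affine2_lipschitz t x y x0 y0 :
  affine2 t x0 y0 - (normc t.1.1 * normc (x - x0) + normc t.1.2 * normc (y - y0))
  <= affine2 t x y.
Proof.
have h (a z z0 : R[i]) :
    complex.Re (a * z0) <= complex.Re (a * z) + normc a * normc (z - z0).
  rewrite -lerBlDl -Re_sub -mulrBr (le_trans (le_Re_normc _))//.
  by rewrite normcM normc_distC.
have := h t.1.1 x x0; have := h t.1.2 y y0; rewrite /affine2; lra.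
Qed.

(** A unit step in the direction that makes a linear part largest raises it by
    its slope. *)
Lemma affine2_slope (F : R[i] -> R[i] -> R) (t : R[i] * R[i] * R) x0 y0 M :
  (forall x y, affine2 t x y <= F x y) ->
  (forall x y, normc (x - x0) <= 1 -> normc (y - y0) <= 1 -> F x y <= M) ->
  normc t.1.1 <= M - affine2 t x0 y0 /\ normc t.1.2 <= M - affine2 t x0 y0.
Proof.
move=> tF FM.
have [u [nu uE]] := unimodular_rotation t.1.1.
have [v [nv vE]] := unimodular_rotation t.1.2.
have := tF (x0 + u) y0; have := tF x0 (y0 + v).
have := FM (x0 + u) y0; have := FM x0 (y0 + v).
rewrite !subrr normc0 ![_ + _ - _]addrAC !subrr !add0r nu nv.
move=> /(_ ler01 (lexx _)) h1 /(_ (lexx _) ler01) h2.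
rewrite /affine2 !mulrDr ![_ * u]mulrC ![_ * v]mulrC uE vE !Re_add /=; split; lra.
Qed.

Lemma rat_near (x : R) (e : R) : 0 < e -> exists q : rat, `|x - ratr q| <= e.
Proof.
move=> e0; have [|q] := @rat_in_itvoo R (x - e) (x + e); first by lra.
rewrite in_itv/= => /andP[h1 h2]; exists q; rewrite ler_norml; lra.
Qed.

Definition rat_complex (q : rat * rat) : R[i] := ratr q.1 +i* ratr q.2.

Lemma rat_complex_near x e : 0 < e -> exists q, normc (x - rat_complex q) <= e.
Proof.
move=> e0; have e2 : 0 < e / 2 by rewrite divr_gt0.
have [a ha] := rat_near (complex.Re x) e2.
have [b hb] := rat_near (complex.Im x) e2.
exists (a, b); rewrite (le_trans (le_normc_ReIm _))//.
by rewrite Re_sub Im_add Im_opp /=; lra.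
Qed.

(** Almost everywhere statements survive only countably many inequalities.
    Minorants chosen at rational points suffice: local boundedness of F bounds
    their slopes, so that they cannot drop much between a point and a nearby
    rational one. *)
Lemma countable_minorants F :
  (forall x y, 0 <= F x y) ->
  (forall x y, exists M, forall x' y',
     normc (x' - x) <= 2 -> normc (y' - y) <= 2 -> F x' y' <= M) ->
  (forall x y e, 0 < e -> exists t, (forall x' y', affine2 t x' y' <= F x' y') /\
     F x y - e <= affine2 t x y) ->
  exists t : nat -> R[i] * R[i] * R,
    (forall n x y, affine2 (t n) x y <= F x y) /\
    (forall x y e, 0 < e -> exists n, F x y - e <= affine2 (t n) x y).
Proof.
move=> F0 Fb Fm.
pose I : countType := ((rat * rat) * (rat * rat) * nat)%type.
have /choice[t tP] : forall i : I, exists t, (forall x' y', affine2 t x' y' <= F x' y') /\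
     F (rat_complex i.1.1) (rat_complex i.1.2) - i.2.+1%:R^-1 <=
     affine2 t (rat_complex i.1.1) (rat_complex i.1.2).
  by move=> i; apply: Fm.
exists (fun n => if unpickle n is Some i then t i else (0, 0, 0)); split.
  move=> n x y; case: (unpickle n) => [i|]; first by have [] := tP i.
  by rewrite /affine2 /= !mul0r !addr0.
move=> x y e e0; have [M MP] := Fb x y.
have M0 : 0 <= M by apply: le_trans (F0 x y) (MP _ _ _ _); rewrite subrr normc0.
set d := Num.min 1 (e / (8 * (M + 2))).
have d0 : 0 < d by rewrite lt_min ltr01 divr_gt0// mulr_gt0//; lra.
have d1 : d <= 1 by rewrite ge_min lexx.
have dM : (M + 2) * d <= e / 8.
  have : d <= e / (8 * (M + 2)) by rewrite ge_min lexx orbT.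
  rewrite invfM mulrA ler_pdivlMr; last by lra.
  by rewrite mulrC.
have [q1 hq1] := rat_complex_near x d0.
have [q2 hq2] := rat_complex_near y d0.
have [n ne] : exists n, n.+1%:R^-1 < Num.min 1 (e / 4) :> R.
  have e4 : 0 < Num.min 1 (e / 4) by rewrite lt_min ltr01 divr_gt0.
  have [n _ hn] := near_infty_natSinv_lt (PosNum e4).
  by exists n; apply: hn => /=.
move: ne; rewrite lt_min => /andP[n1 n4].
exists (pickle ((q1, q2), n) : nat); rewrite pickleK.
have [tF tq] := tP (((q1, q2), n) : I); move: tq => /= tq.
set x0 := rat_complex q1 in hq1 tq *; set y0 := rat_complex q2 in hq2 tq *.
set T := t _ in tF tq *.
have near_ball (z z0 : R[i]) : normc (z - z0) <= d ->
    forall z', normc (z' - z0) <= 1 -> normc (z' - z) <= 2.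
  move=> h z' h'; rewrite (_ : z' - z = (z' - z0) - (z - z0)); last by ring.
  by rewrite (le_trans (le_normc_add _ _))// normc_opp; lra.
have e4 : 0 < Num.min 1 (e / 4) by rewrite lt_min ltr01 divr_gt0.
have [s [sF sx]] := Fm x y _ e4.
have m1 : Num.min 1 (e / 4) <= 1 by rewrite ge_min lexx.
have m4 : Num.min 1 (e / 4) <= e / 4 by rewrite ge_min lexx orbT.
have [Ts1 Ts2] := affine2_slope tF
  (fun x' y' h1 h2 => MP _ _ (near_ball _ _ hq1 _ h1) (near_ball _ _ hq2 _ h2)).
have [|Ss1 Ss2] := @affine2_slope F s x y M sF.
  by move=> x' y' h1 h2; apply: MP; lra.
have L1 := affine2_lipschitz T x y x0 y0.
have L2 := affine2_lipschitz s x0 y0 x y.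
have s0F := sF x0 y0.
have Fx0 := F0 x0 y0.
have Fx := F0 x y.
have slope (a : R[i]) (z : R) : normc a <= M + 2 -> 0 <= z -> z <= d -> normc a * z <= e / 8.
  move=> h1 h2 h3; apply: le_trans dM; apply: ler_pM => //; exact: normc_ge0.
have T1 : M - affine2 T x0 y0 <= M + 2.
  move: tq n1; set i := _^-1; lra.
have bt1 : normc T.1.1 * normc (x - x0) <= e / 8.
  by apply: slope; rewrite ?normc_ge0// (le_trans Ts1).
have bt2 : normc T.1.2 * normc (y - y0) <= e / 8.
  by apply: slope; rewrite ?normc_ge0// (le_trans Ts2).
have S1 : M - affine2 s x y <= M + 2 by lra.
have bs1 : normc s.1.1 * normc (x0 - x) <= e / 8.
  by rewrite normc_distC; apply: slope; rewrite ?normc_ge0// (le_trans Ss1).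
have bs2 : normc s.1.2 * normc (y0 - y) <= e / 8.
  by rewrite normc_distC; apply: slope; rewrite ?normc_ge0// (le_trans Ss2).
move: tq n4; set i := _^-1; lra.
Qed.

End CountableMinorants.

(** * Burkholder and Bellman functions *)

Section BellmanFunction.
Context {R : realType}.
Implicit Types (p q e : R) (x y w c : R[i]).

Definition burkholder p x w : R := 2 * power_potential p (normc x) (normc w).

(** On the line w = w0 + c x the potential is the infimum of the envelopes with
    s at least |w0|, each of which is concave in x; the one with
    s = |x0| + |w0 + c x0| touches at x0. *)
Lemma burkholder_support p c w0 x0 : 1 < p -> p <= 2 -> normc c = 1 ->
  exists (a : R[i]) (k : R),
    (forall x, burkholder p x (w0 + c * x) <= complex.Re (a * x) + k) /\
    burkholder p x0 (w0 + c * x0) = complex.Re (a * x0) + k.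
Proof.
move=> p1 p2 nc.
have ncx x : normc (c * x) = normc x by rewrite normcM nc mul1r.
have p10 : 0 < p - 1 by rewrite subr_gt0.
set s := normc x0 + normc (w0 + c * x0).
have w0s x1 : normc w0 <= normc x1 + normc (w0 + c * x1).
  rewrite -{1}(addrK (c * x1) w0) (le_trans (le_normc_add _ _))// normc_opp.
  by rewrite ncx addrC.
have [s0|s0] := ltrP 0 s; last first.
  have x00 : x0 = 0.
    by apply: eq0_normc; have := normc_ge0 x0; have := normc_ge0 (w0 + c * x0); rewrite -/s; move: s0; rewrite /s; lra.
  have w00 : w0 = 0.
    apply: eq0_normc; have := normc_ge0 w0.
    have := w0s x0; rewrite -/s; lra.
  exists 0, 0; rewrite x00 w00; split => [x|].
    rewrite mul0r addr0 add0r /burkholder /power_potential ncx.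
    rewrite pmulr_rle0// mulr_ge0_le0 ?powR_ge0// subr_le0.
    by rewrite ler_pdivlMr// ler_piMr ?normc_ge0//; lra.
  rewrite !mulr0 !addr0 /burkholder /power_potential normc0 addr0.
  by rewrite mul0r subr0 !mulr0.
have [e [ne ex0]] := unimodular_rotation x0.
pose C2 := p * (2 - p) / (p - 1) * s `^ (p - 1).
have C20 : 0 <= C2 by rewrite !mulr_ge0 ?powR_ge0 ?invr_ge0//; lra.
have E x : normc (w0 + c * x) ^+ 2 - normc x ^+ 2 =
    normc w0 ^+ 2 + 2 * complex.Re (w0^* * c * x).
  have -> : complex.Re (w0^* * c * x) = complex.Re (w0 * (c * x)^*).
    by rewrite !(Re_mul, Im_mul, Re_conj, Im_conj); ring.
  by rewrite sqr_normcD ncx; ring.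
pose a := (- (2 * C2))%:C * e + (2 * p * s `^ (p - 2))%:C * (w0^* * c).
exists a, (2 * ((1 - p / 2) * s `^ p + (p / 2) * normc w0 ^+ 2 * s `^ (p - 2))).
have aE x : complex.Re (a * x) +
      2 * ((1 - p / 2) * s `^ p + (p / 2) * normc w0 ^+ 2 * s `^ (p - 2)) =
    2 * (power_envelope p (normc x) (normc (w0 + c * x) ^+ 2 - normc x ^+ 2) s
         + C2 * (normc x - complex.Re (e * x))).
  rewrite E /a mulrDl Re_add -![_%:C * _ * _]mulrA !Re_scale /power_envelope /C2.
  by rewrite mulrA; field; rewrite gt_eqF.
split => [x|]; rewrite aE /burkholder; last first.
  by rewrite ex0 /= subrr mulr0 addr0 -/s power_envelope_at_sum.
rewrite ler_pM2l//.
apply: (le_trans (power_envelope_min p1 p2 (normc_ge0 _) (normc_ge0 _) s0 _)).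
  rewrite (le_trans _ (w0s x0))// lerBlDr.
  by rewrite -(ncx x) addrC -{1}(addKr w0 (c * x)) (le_trans (le_normc_add _ _))// normc_opp addrC.
by rewrite lerDl mulr_ge0// subr_ge0 (le_trans (le_Re_normc _))// normcM ne mul1r.
Qed.

Lemma burkholder_lower p x w : 1 < p -> p <= 2 ->
  normc w `^ p - 2 * expR 2 / (p - 1) * normc x `^ p <= burkholder p x w.
Proof. by move=> p1 p2; exact: power_potential_lower (normc_ge0 _) (normc_ge0 _). Qed.

Lemma burkholder_diag_le0 p x w : 1 < p -> p <= 2 -> normc w <= normc x ->
  burkholder p x w <= 0.
Proof.
move=> p1 p2 wx; rewrite /burkholder /power_potential pmulr_rle0//.
rewrite mulr_ge0_le0 ?powR_ge0// subr_le0 (le_trans wx)//.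
by rewrite ler_pdivlMr ?subr_gt0// ler_piMr ?normc_ge0//; lra.
Qed.

(** The partial Legendre transform in w turns the concavity of the Burkholder
    function along the lines (x, w + c x) into joint convexity of
    bellman x y - Re (c x conj(y)), for every unimodular c. *)
Definition bellman p x y : R :=
  sup [set complex.Re (w * y^*) - burkholder p x w | w in [set: R[i]]].

Lemma le_bellman_pre p q x y w : 1 < p -> p <= 2 -> p^-1 + q^-1 = 1 ->
  complex.Re (w * y^*) - burkholder p x w <=
  2 * expR 2 / (p - 1) * normc x `^ p + normc y `^ q.
Proof.
move=> p1 p2 pq.
have p0 : 0 < p by rewrite (lt_trans _ p1).
have q1 := conjugate_exponent_gt1 p1 pq; have q0 : 0 < q by rewrite (lt_trans _ q1).
have := conjugate_powR (normc_ge0 w) (normc_ge0 y) p0 q0 pq.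
have := burkholder_lower x w p1 p2.
have := le_Re_normc (w * y^*); rewrite normcM normc_conj.
have wp : normc w `^ p / p <= normc w `^ p by rewrite ler_piMr ?powR_ge0// invf_le1// ltW.
have yq : normc y `^ q / q <= normc y `^ q by rewrite ler_piMr ?powR_ge0// invf_le1// ltW.
lra.
Qed.

Lemma bellman_ge p x y w : 1 < p -> p <= 2 ->
  complex.Re (w * y^*) - burkholder p x w <= bellman p x y.
Proof.
move=> p1 p2; apply: ub_le_sup; last by exists w.
exists (2 * expR 2 / (p - 1) * normc x `^ p + normc y `^ (1 - p^-1)^-1).
by move=> _ [v _ <-]; exact: (le_bellman_pre _ _ _ p1 p2 (conjugate_exponent_exists p)).
Qed.

Lemma bellman_le p q x y : 1 < p -> p <= 2 -> p^-1 + q^-1 = 1 ->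
  bellman p x y <= 2 * expR 2 / (p - 1) * normc x `^ p + normc y `^ q.
Proof.
move=> p1 p2 pq; apply: ge_sup; first by exists (complex.Re (0 * y^*) - burkholder p x 0); exists 0.
by move=> _ [v _ <-]; exact: le_bellman_pre.
Qed.

Lemma bellman_adherent p x y e : 0 < e -> 1 < p -> p <= 2 ->
  exists w, bellman p x y - e < complex.Re (w * y^*) - burkholder p x w.
Proof.
move=> e0 p1 p2.
have [] := @sup_adherent R [set complex.Re (w * y^*) - burkholder p x w | w in [set: R[i]]] e e0.
  split; first by exists (complex.Re (0 * y^*) - burkholder p x 0); exists 0.
  exists (bellman p x y) => _ [v _ <-]; exact: bellman_ge.
by move=> _ [w _ <-] h; exists w.
Qed.

Lemma bellman_ge0 p x y : 1 < p -> p <= 2 -> 0 <= bellman p x y.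
Proof.
move=> p1 p2; apply: le_trans (@bellman_ge p x y 0 p1 p2).
rewrite mul0r sub0r oppr_ge0 burkholder_diag_le0// normc0; exact: normc_ge0.
Qed.

Definition tilted_bellman p c x y : R := bellman p x y - complex.Re (c * x * y^*).

Lemma tilted_bellman_ge0 p c x y : 1 < p -> p <= 2 -> normc c = 1 ->
  0 <= tilted_bellman p c x y.
Proof.
move=> p1 p2 c1; rewrite subr_ge0; apply: le_trans (@bellman_ge p x y (c * x) p1 p2).
by rewrite lerDl oppr_ge0 burkholder_diag_le0// normcM c1 mul1r.
Qed.

Lemma tilted_bellman_le p q c x y : 1 < p -> p <= 2 -> p^-1 + q^-1 = 1 ->
  normc c = 1 -> tilted_bellman p c x y <=
  2 * expR 2 / (p - 1) * normc x `^ p + normc y `^ q + normc x * normc y.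
Proof.
move=> p1 p2 pq c1; apply: lerD; first exact: bellman_le.
rewrite -Re_opp (le_trans (le_Re_normc _))// normc_opp !normcM normc_conj.
by rewrite c1 mul1r.
Qed.

Lemma tilted_bellman00 p c : 1 < p -> p <= 2 -> tilted_bellman p c 0 0 <= 0.
Proof.
move=> p1 p2; rewrite /tilted_bellman mulr0 mul0r subr0.
have pq := conjugate_exponent_exists p; have q1 := conjugate_exponent_gt1 p1 pq.
apply: (le_trans (bellman_le _ _ p1 p2 pq)).
have p0 : p != 0 by rewrite gt_eqF// (lt_trans _ p1).
have q0 : (1 - p^-1)^-1 != 0 by rewrite gt_eqF// (lt_trans _ q1).
by rewrite normc0 !powR0// mulr0 addr0.
Qed.

(** If w nearly attains the supremum at (x0, y0), then w + c (x - x0) is a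
    competitor at (x, y); the concavity of the Burkholder function along this
    line bounds the value there below by an affine function of x and y. *)
Lemma tilted_bellman_minorant p c x0 y0 e : 1 < p -> p <= 2 -> normc c = 1 -> 0 < e ->
  exists t, (forall x y, affine2 t x y <= tilted_bellman p c x y) /\
    tilted_bellman p c x0 y0 - e <= affine2 t x0 y0.
Proof.
move=> p1 p2 c1 e0; have [w wE] := bellman_adherent x0 y0 e0 p1 p2.
have [a [k [ak ak0]]] := burkholder_support (w - c * x0) x0 p1 p2 c1.
have J (z y : R[i]) : complex.Re (z^* * y) = complex.Re (z * y^*).
  by rewrite !(Re_mul, Re_conj, Im_conj); ring.
exists (- a, (w - c * x0)^*, - k); rewrite /affine2 /=; split => [x y|].
  have := @bellman_ge p x y (w - c * x0 + c * x) p1 p2.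
  rewrite mulrDl Re_add -mulrA J /tilted_bellman mulNr Re_opp.
  have := ak x; rewrite mulrA; lra.
rewrite /tilted_bellman J mulNr Re_opp mulrBl Re_sub.
by move: ak0 wE; rewrite subrK; lra.
Qed.

Lemma tilted_bellman_countable p c : 1 < p -> p <= 2 -> normc c = 1 ->
  exists t : nat -> R[i] * R[i] * R,
    (forall n x y, affine2 (t n) x y <= tilted_bellman p c x y) /\
    (forall x y e, 0 < e -> exists n, tilted_bellman p c x y - e <= affine2 (t n) x y).
Proof.
move=> p1 p2 c1; apply: countable_minorants => [x y|x y|x y e e0]; last 1 first.
- exact: tilted_bellman_minorant.
- exact: tilted_bellman_ge0.
have p0 : 0 < p by rewrite (lt_trans _ p1).
pose q := (1 - p^-1)^-1; have pq : p^-1 + q^-1 = 1 := conjugate_exponent_exists p.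
have q0 : 0 < q by rewrite (lt_trans _ (conjugate_exponent_gt1 p1 pq)).
have K0 : 0 <= 2 * expR 2 / (p - 1) by rewrite !mulr_ge0 ?expR_ge0// invr_ge0 subr_ge0 ltW.
exists (2 * expR 2 / (p - 1) * (normc x + 2) `^ p + (normc y + 2) `^ q
        + (normc x + 2) * (normc y + 2)) => x' y' xx yy.
have shift (z z' : R[i]) : normc (z' - z) <= 2 -> normc z' <= normc z + 2.
  by move=> h; rewrite -(subrK z z') addrC (le_trans (le_normc_add _ _))// lerD2l.
apply: (le_trans (tilted_bellman_le _ _ p1 p2 pq c1)).
apply: lerD; first apply: lerD.
- by rewrite ler_wpM2l// ler_powRl ?normc_ge0 ?shift// ltW.
- by rewrite ler_powRl ?normc_ge0 ?shift// ltW.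
- by apply: ler_pM; rewrite ?normc_ge0 ?shift.
Qed.

End BellmanFunction.

(** * Measurability and integrals of complex functions *)

Section ComplexMeasurable.
Context {d : measure_display} {X : measurableType d} {R : realType}.
Implicit Types (D : set X) (f g : X -> R[i]) (h : X -> R).

Lemma cmeasurable_real D h : measurable_fun D h -> cmeasurable_fun D (fun x => (h x)%:C).
Proof. by move=> mh; split => //=; exact: measurable_cst. Qed.

Lemma cmeasurable_cst D (a : R[i]) : cmeasurable_fun D (fun _ => a).
Proof. by split; exact: measurable_cst. Qed.

Lemma cmeasurable_add D f g : cmeasurable_fun D f -> cmeasurable_fun D g ->
  cmeasurable_fun D (fun x => f x + g x).
Proof.
move=> [f1 f2] [g1 g2]; split.
  by under eq_fun do rewrite Re_add; exact: measurable_funD.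
by under eq_fun do rewrite Im_add; exact: measurable_funD.
Qed.

Lemma cmeasurable_mul D f g : cmeasurable_fun D f -> cmeasurable_fun D g ->
  cmeasurable_fun D (fun x => f x * g x).
Proof.
move=> [f1 f2] [g1 g2]; split.
  by under eq_fun do rewrite Re_mul; apply: measurable_funB; exact: measurable_funM.
by under eq_fun do rewrite Im_mul; apply: measurable_funD; exact: measurable_funM.
Qed.

Lemma cmeasurable_opp D f : cmeasurable_fun D f -> cmeasurable_fun D (fun x => - f x).
Proof.
move=> [f1 f2]; split.
  by under eq_fun do rewrite Re_opp; exact: measurableT_comp.
by under eq_fun do rewrite Im_opp; exact: measurableT_comp.
Qed.

Lemma cmeasurable_sub D f g : cmeasurable_fun D f -> cmeasurable_fun D g ->
  cmeasurable_fun D (fun x => f x - g x).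
Proof. by move=> mf mg; apply: cmeasurable_add => //; exact: cmeasurable_opp. Qed.

Lemma cmeasurable_conj D f : cmeasurable_fun D f -> cmeasurable_fun D (fun x => (f x)^*).
Proof.
move=> [f1 f2]; split; first by under eq_fun do rewrite Re_conj.
by under eq_fun do rewrite Im_conj; exact: measurableT_comp.
Qed.

Lemma cmeasurable_scale D (a : R[i]) f : cmeasurable_fun D f ->
  cmeasurable_fun D (fun x => a * f x).
Proof. by apply: cmeasurable_mul; exact: cmeasurable_cst. Qed.

Lemma measurable_normc D f : cmeasurable_fun D f ->
  measurable_fun D (fun x => normc (f x)).
Proof.
move=> [f1 f2].
rewrite (_ : (fun x => _) = (fun x => Num.sqrt (complex.Re (f x) ^+ 2 + complex.Im (f x) ^+ 2))).
  apply: (@measurableT_comp _ _ _ _ _ _ (@Num.sqrt R)) => /=.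
    by apply: continuous_measurable_fun; exact: sqrt_continuous.
  by apply: measurable_funD; exact: measurable_funX.
by apply/funext => x; case: (f x).
Qed.

Lemma cmeasurable_restrict (A : set X) f : measurable A -> cmeasurable_fun setT f ->
  cmeasurable_fun setT (fun x => if x \in A then f x else 0).
Proof.
move=> mA [m1 m2]; split.
  rewrite (_ : (fun x => _) = (fun x => complex.Re (f x)) \_ A).
    by apply/(measurable_restrictT _ mA); exact: measurable_funTS.
  by apply/funext => x; rewrite patchE; case: ifPn.
rewrite (_ : (fun x => _) = (fun x => complex.Im (f x)) \_ A).
  by apply/(measurable_restrictT _ mA); exact: measurable_funTS.
by apply/funext => x; rewrite patchE; case: ifPn.
Qed.

Lemma cmeasurable_sum D (I : Type) (r : seq I) (P : pred I) (F : I -> X -> R[i]) :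
  (forall i, P i -> cmeasurable_fun D (F i)) ->
  cmeasurable_fun D (fun x => \sum_(i <- r | P i) F i x).
Proof.
move=> mF; rewrite (_ : (fun x => _) = \sum_(i <- r | P i) F i); last first.
  by apply/funext => x; rewrite fct_sumE.
elim/big_ind : _ => [|f g|//]; [exact: cmeasurable_cst|exact: cmeasurable_add].
Qed.

End ComplexMeasurable.

Section ComplexIntegral.
Context {d : measure_display} {X : measurableType d} {R : realType}.
Variable mu : {measure set X -> \bar R}.
Implicit Types (D : set X) (f g : X -> R[i]) (h : X -> R).

Definition cintegrable D f : Prop :=
  cmeasurable_fun D f /\ mu.-integrable D (fun x => (normc (f x))%:E).

Lemma integrable_cst D (c : R) : measurable D -> (mu D < +oo)%E ->
  mu.-integrable D (EFin \o cst c).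
Proof.
move=> mD Dfin; apply/integrableP; split.
  by apply/measurable_EFinP; exact: measurable_cst.
rewrite (eq_integral (cst `|c|%:E))//.
by rewrite integral_cst// lte_mul_pinfty// lee_fin.
Qed.

Lemma cintegrable_Re D f : measurable D -> cintegrable D f ->
  mu.-integrable D (fun x => (complex.Re (f x))%:E).
Proof.
move=> mD [[mf _] If]; apply: le_integrable If => //; first exact/measurable_EFinP.
by move=> x _; rewrite /= lee_fin (ger0_norm (normc_ge0 _)) le_normRe_normc.
Qed.

Lemma cintegrable_Im D f : measurable D -> cintegrable D f ->
  mu.-integrable D (fun x => (complex.Im (f x))%:E).
Proof.
move=> mD [[_ mf] If]; apply: le_integrable If => //; first exact/measurable_EFinP.
by move=> x _; rewrite /= lee_fin (ger0_norm (normc_ge0 _)) le_normIm_normc.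
Qed.

Lemma cintegrable_le D f h : measurable D -> cmeasurable_fun D f ->
  mu.-integrable D (EFin \o h) -> (forall x, D x -> normc (f x) <= h x) ->
  cintegrable D f.
Proof.
move=> mD mf Ih fh; split => //; apply: le_integrable Ih => //.
  by apply/measurable_EFinP; exact: measurable_normc.
move=> x Dx; rewrite /= lee_fin ger0_norm ?normc_ge0// (le_trans (fh _ Dx))//.
exact: ler_norm.
Qed.

Lemma cintegrable_scale D (a : R[i]) f : measurable D -> cintegrable D f ->
  cintegrable D (fun x => a * f x).
Proof.
move=> mD [mf If]; split; first exact: cmeasurable_scale.
have := integrableZl mD (normc a) If; apply: eq_integrable => // x _.
by rewrite /= normcM EFinM.
Qed.

Lemma cintegral_add D f g : measurable D -> cintegrable D f -> cintegrable D g ->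
  cintegral mu D (fun x => f x + g x) = cintegral mu D f + cintegral mu D g.
Proof.
move=> mD If Ig; rewrite /cintegral; apply: complex_ext => /=.
  under eq_Rintegral do rewrite Re_add.
  by rewrite RintegralD//; exact: cintegrable_Re.
under eq_Rintegral do rewrite Im_add.
by rewrite RintegralD//; exact: cintegrable_Im.
Qed.

Lemma cintegral_scale D (a : R[i]) f : measurable D -> cintegrable D f ->
  cintegral mu D (fun x => a * f x) = a * cintegral mu D f.
Proof.
move=> mD If; have I1 := cintegrable_Re mD If; have I2 := cintegrable_Im mD If.
have Z (b : R) (u : X -> R) : mu.-integrable D (EFin \o u) ->
    mu.-integrable D (EFin \o (fun x => b * u x)).
  by move=> Iu; have := integrableZl mD b Iu; exact: eq_integrable.
rewrite /cintegral; apply: complex_ext => /=.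
  under eq_Rintegral do rewrite Re_mul.
  by rewrite RintegralB ?RintegralZl ?Re_mul//; exact: Z.
under eq_Rintegral do rewrite Im_mul.
by rewrite RintegralD ?RintegralZl ?Im_mul//; exact: Z.
Qed.

Lemma cintegral_conj D f :  measurable D -> cintegrable D f ->
  cintegral mu D (fun x => (f x)^*) = (cintegral mu D f)^*.
Proof.
move=> mD If; have I2 := cintegrable_Im mD If.
rewrite /cintegral; apply: complex_ext => /=.
  by under eq_Rintegral do rewrite Re_conj.
under eq_Rintegral do rewrite Im_conj -mulN1r.
by rewrite RintegralZl// mulN1r.
Qed.

Lemma cintegral_real D h : cintegral mu D (fun x => (h x)%:C) = (\int[mu]_(x in D) h x)%:C.
Proof.
rewrite /cintegral; apply: complex_ext => //=.
by rewrite /Rintegral integral0.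
Qed.

(** Rotating the value of the integral to the positive half-line reduces the
    complex inequality to the real one. *)
Lemma le_normc_cintegral D f : measurable D -> cintegrable D f ->
  normc (cintegral mu D f) <= \int[mu]_(x in D) normc (f x).
Proof.
move=> mD If; have [c [c1 cE]] := unimodular_rotation (cintegral mu D f).
rewrite -[leLHS]/(complex.Re (normc (cintegral mu D f))%:C) -cE -cintegral_scale//=.
have Icf := cintegrable_scale c mD If.
apply: le_Rintegral => //; first exact: cintegrable_Re.
  by case: If.
by move=> x _; rewrite (le_trans (le_Re_normc _))// normcM c1 mul1r.
Qed.

Lemma ae_eq_cintegral D f g : measurable D -> cmeasurable_fun D f -> cmeasurable_fun D g ->
  {ae mu, forall x, D x -> f x = g x} -> cintegral mu D f = cintegral mu D g.
Proof.
move=> mD [f1 f2] [g1 g2] fg; rewrite /cintegral /Rintegral; congr (fine _ +i* fine _).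
  apply: ae_eq_integral => //; try exact/measurable_EFinP.
  by apply: filterS fg => x /[apply] ->.
apply: ae_eq_integral => //; try exact/measurable_EFinP.
by apply: filterS fg => x /[apply] ->.
Qed.

End ComplexIntegral.

(** * Square-integrable functions *)

Section RealQuadratic.
Context {R : realFieldType}.
Implicit Types a b s : R.

Lemma mul_le_sqrD a b : a * b <= a ^+ 2 + b ^+ 2.
Proof. by have := sqr_ge0 (a - b); have := sqr_ge0 a; have := sqr_ge0 b; lra. Qed.

Lemma sqrD_le2 a b : (a + b) ^+ 2 <= 2 * (a ^+ 2 + b ^+ 2).
Proof. by have := sqr_ge0 (a - b); lra. Qed.

Lemma quadratic_discriminant a b s : 0 <= a -> 0 <= b ->
  (forall t, 0 <= t -> 0 <= t ^+ 2 * a ^+ 2 + b ^+ 2 - 2 * t * s) -> s <= a * b.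
Proof.
move=> a0 b0 key; have [s0|s0] := lerP s 0; first by rewrite (le_trans s0)// mulr_ge0.
move: a0; rewrite le_eqVlt => /orP[/eqP a0|a0].
  have b1 : 0 <= b ^+ 2 + 1 by rewrite addr_ge0 ?sqr_ge0.
  have s2 : 0 <= 2 * s by rewrite mulr_ge0 ?ltW.
  have := key _ (divr_ge0 b1 s2).
  rewrite -a0 expr0n/= mulr0 add0r (_ : 2 * _ * s = b ^+ 2 + 1); first lra.
  by field; rewrite gt_eqF.
have sa : 0 <= s / a ^+ 2 by rewrite divr_ge0 ?sqr_ge0// ltW.
have := key _ sa.
have -> : (s / a ^+ 2) ^+ 2 * a ^+ 2 + b ^+ 2 - 2 * (s / a ^+ 2) * s
    = (a ^+ 2 * b ^+ 2 - s ^+ 2) / a ^+ 2 by field; rewrite gt_eqF.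
rewrite pmulr_lge0 ?invr_gt0 ?exprn_gt0// subr_ge0 -exprMn.
by rewrite ler_pXn2r// ?nnegrE ?mulr_ge0// ltW.
Qed.

End RealQuadratic.

Section SquareIntegrable.
Context {d : measure_display} {X : measurableType d} {R : realType}.
Variable mu : {measure set X -> \bar R}.
Implicit Types (f g u v : X -> R[i]) (p : R) (a : R[i]).

Local Notation L2 := (cLp mu 2%:E).

(** A real-valued version of the L^2 seminorm, meaningful on L2 only. *)
Definition n2 f : R := Num.sqrt (\int[mu]_x (normc (f x) ^+ 2)).

Lemma cLnorm_powE p f : 0 < p ->
  (cLnorm mu p%:E f = (\int[mu]_x ((normc (f x)) `^ p)%:E) `^ p^-1)%E.
Proof.
move=> p0; rewrite /cLnorm unlock; congr (_ `^ _)%E.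
by apply: eq_integral => x _; rewrite /= ger0_norm ?normc_ge0// poweR_EFin.
Qed.

Lemma cLpP p f : 0 < p -> cLp mu p%:E f <-> cmeasurable_fun setT f /\
  mu.-integrable setT (fun x => (normc (f x) `^ p)%:E).
Proof.
move=> p0; rewrite /cLp /= cLnorm_powE//.
have absE : (\int[mu]_x `|(normc (f x) `^ p)%:E| = \int[mu]_x (normc (f x) `^ p)%:E)%E.
  by apply: eq_integral => x _; rewrite gee0_abs// lee_fin powR_ge0.
split => -[mf If]; split => //.
  apply/integrableP; split.
    apply/measurable_EFinP; apply: (@measurableT_comp _ _ _ _ _ _ (@powR R ^~ p)) => //.
    exact: measurable_normc.
  by rewrite absE; apply: lty_poweRy If; rewrite invr_eq0 gt_eqF.
by rewrite poweR_lty// -absE; case/integrableP : If.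
Qed.

Lemma L2P f : L2 f <-> cmeasurable_fun setT f /\
  mu.-integrable setT (fun x => (normc (f x) ^+ 2)%:E).
Proof.
have -> : (fun x => (normc (f x) ^+ 2)%:E) = (fun x => (normc (f x) `^ 2)%:E).
  by apply/funext => x; rewrite -[2]/(2%:R) powR_mulrn ?normc_ge0.
exact: cLpP.
Qed.

Lemma n2_ge0 f : 0 <= n2 f. Proof. exact: sqrtr_ge0. Qed.

Lemma sqr_n2 f : n2 f ^+ 2 = \int[mu]_x (normc (f x) ^+ 2).
Proof. by rewrite sqr_sqrtr// Rintegral_ge0// => x _; exact: sqr_ge0. Qed.

Lemma cLnorm2E f : L2 f -> cLnorm mu 2%:E f = (n2 f)%:E.
Proof.
move=> /L2P [mf If]; rewrite cLnorm_powE// /n2 -powR12_sqrt; last first.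
  by apply: Rintegral_ge0 => x _; exact: sqr_ge0.
rewrite -poweR_EFin /Rintegral fineK ?integrable_fin_num//.
congr (_ `^ _)%E; apply: eq_integral => x _.
by rewrite -[X in _ `^ X]/(2%:R) powR_mulrn ?normc_ge0.
Qed.

Lemma L2_measurable f : L2 f -> cmeasurable_fun setT f.
Proof. by case. Qed.

Lemma L2_mul_integrable f g : L2 f -> L2 g -> cintegrable mu setT (fun x => f x * (g x)^*).
Proof.
move=> /L2P[mf If] /L2P[mg Ig].
apply: (cintegrable_le (h := fun x => normc (f x) ^+ 2 + normc (g x) ^+ 2)) => //.
- by apply: cmeasurable_mul => //; exact: cmeasurable_conj.
- by have := integrableD measurableT If Ig; apply: eq_integrable.
- move=> x _; rewrite normcM normc_conj.
  exact: mul_le_sqrD.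
Qed.

Lemma L2_scale a f : L2 f -> L2 (fun x => a * f x).
Proof.
move=> /L2P[mf If]; apply/L2P; split; first exact: cmeasurable_scale.
have := integrableZl measurableT (normc a ^+ 2) If; apply: eq_integrable => // x _.
by rewrite /= normcM exprMn EFinM.
Qed.

Lemma L2_add f g : L2 f -> L2 g -> L2 (fun x => f x + g x).
Proof.
move=> /L2P[mf If] /L2P[mg Ig].
apply/L2P; split; first exact: cmeasurable_add.
have mfg := cmeasurable_add mf mg.
have I2 : mu.-integrable setT (EFin \o (fun x => 2 * (normc (f x) ^+ 2 + normc (g x) ^+ 2))).
  have := integrableZl measurableT 2 (integrableD measurableT If Ig).
  by apply: eq_integrable.
apply: le_integrable I2 => //.
  by apply/measurable_EFinP/measurable_funX/measurable_normc.
move=> x _ /=; rewrite lee_fin !ger0_norm ?sqr_ge0 ?mulr_ge0 ?addr_ge0 ?sqr_ge0//.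
apply: (le_trans _ (sqrD_le2 _ _)).
by rewrite ler_pXn2r ?nnegrE ?addr_ge0 ?normc_ge0 ?le_normc_add.
Qed.

Lemma L2_opp f : L2 f -> L2 (fun x => - f x).
Proof. by move=> /(L2_scale (-1)); under eq_fun do rewrite mulN1r. Qed.

Lemma L2_sub f g : L2 f -> L2 g -> L2 (fun x => f x - g x).
Proof. by move=> f2 g2; apply: L2_add => //; exact: L2_opp. Qed.

Lemma L2_0 : L2 (fun=> 0).
Proof.
apply/L2P; split; first exact: cmeasurable_cst.
by under eq_fun do rewrite normc0 expr0n; exact: integrable0.
Qed.

Lemma L2_sum (I : Type) (r : seq I) (P : pred I) (F : I -> X -> R[i]) :
  (forall i, P i -> L2 (F i)) -> L2 (fun x => \sum_(i <- r | P i) F i x).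
Proof.
move=> F2; rewrite (_ : (fun x => _) = \sum_(i <- r | P i) F i); last first.
  by apply/funext => x; rewrite fct_sumE.
by elim/big_ind : _ => [|f g|//]; [exact: L2_0|exact: L2_add].
Qed.

Lemma cdotDl f g u : L2 f -> L2 g -> L2 u ->
  cdot mu (fun x => f x + g x) u = cdot mu f u + cdot mu g u.
Proof.
move=> f2 g2 u2; rewrite /cdot -cintegral_add//; try exact: L2_mul_integrable.
by congr cintegral; apply/funext => x; rewrite mulrDl.
Qed.

Lemma cdotZl a f u : L2 f -> L2 u -> cdot mu (fun x => a * f x) u = a * cdot mu f u.
Proof.
move=> f2 u2; rewrite /cdot -cintegral_scale//; last exact: L2_mul_integrable.
by congr cintegral; apply/funext => x; rewrite mulrA.
Qed.

Lemma cdotC f g : L2 f -> L2 g -> cdot mu f g = (cdot mu g f)^*.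
Proof.
move=> f2 g2; rewrite /cdot -cintegral_conj//; last exact: L2_mul_integrable.
by congr cintegral; apply/funext => x; rewrite conjc_mul conjc_conj mulrC.
Qed.

Lemma cdotNl f u : L2 f -> L2 u -> cdot mu (fun x => - f x) u = - cdot mu f u.
Proof.
by move=> f2 u2; rewrite -mulN1r -cdotZl//; congr cdot; apply/funext => x; rewrite mulN1r.
Qed.

Lemma cdotBl f g u : L2 f -> L2 g -> L2 u ->
  cdot mu (fun x => f x - g x) u = cdot mu f u - cdot mu g u.
Proof. by move=> f2 g2 u2; rewrite cdotDl// ?cdotNl//; exact: L2_opp. Qed.

Lemma cdotDr f g u : L2 f -> L2 g -> L2 u ->
  cdot mu u (fun x => f x + g x) = cdot mu u f + cdot mu u g.
Proof.
move=> f2 g2 u2; rewrite cdotC//; last exact: L2_add.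
by rewrite cdotDl// conjc_add -!cdotC.
Qed.

Lemma cdotZr a f u : L2 f -> L2 u -> cdot mu u (fun x => a * f x) = a^* * cdot mu u f.
Proof.
move=> f2 u2; rewrite cdotC//; last exact: L2_scale.
by rewrite cdotZl// conjc_mul -cdotC.
Qed.

Lemma cdot_suml (I : Type) (r : seq I) (P : pred I) (F : I -> X -> R[i]) u :
  (forall i, P i -> L2 (F i)) -> L2 u ->
  cdot mu (fun x => \sum_(i <- r | P i) F i x) u = \sum_(i <- r | P i) cdot mu (F i) u.
Proof.
move=> F2 u2; elim: r => [|i r IH].
  rewrite big_nil; under eq_fun do rewrite big_nil.
  transitivity (cdot mu (fun x => 0 * (fun=> 0 : R[i]) x) u).
    by congr cdot; apply/funext => x; rewrite mul0r.
  by rewrite cdotZl ?mul0r//; exact: L2_0.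
rewrite big_cons; under eq_fun do rewrite big_cons.
by case: ifPn => // Pi; rewrite cdotDl ?IH//; [exact: F2|exact: L2_sum].
Qed.

Lemma cdot_self f : cdot mu f f = (n2 f ^+ 2)%:C.
Proof.
rewrite sqr_n2 -cintegral_real /cdot; congr cintegral; apply/funext => x.
exact: mulc_conj.
Qed.

Lemma n2D_sqr f g : L2 f -> L2 g ->
  n2 (fun x => f x + g x) ^+ 2 = n2 f ^+ 2 + n2 g ^+ 2 + 2 * complex.Re (cdot mu f g).
Proof.
move=> f2 g2; have fg2 := L2_add f2 g2.
have E : (n2 (fun x => f x + g x) ^+ 2)%:C =
   (n2 f ^+ 2)%:C + (n2 g ^+ 2)%:C + (cdot mu f g + (cdot mu f g)^*) :> R[i].
  by rewrite -!cdot_self cdotDl// !cdotDr// -(cdotC g2 f2); ring.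
have := congr1 (@complex.Re R) E; rewrite !Re_add Re_conj /= => ->; ring.
Qed.

Lemma n2_scale a f : L2 f -> n2 (fun x => a * f x) = normc a * n2 f.
Proof.
move=> /L2P[mf If]; rewrite /n2.
under eq_Rintegral do rewrite normcM exprMn.
by rewrite RintegralZl// sqrtrM ?sqr_ge0// sqrtr_sqr ger0_norm ?normc_ge0.
Qed.

Lemma n2_opp f : n2 (fun x => - f x) = n2 f.
Proof. by rewrite /n2; under eq_Rintegral do rewrite normc_opp. Qed.

Lemma n2_distC f g : n2 (fun x => f x - g x) = n2 (fun x => g x - f x).
Proof. by rewrite /n2; under eq_Rintegral do rewrite normc_distC. Qed.

(** After a rotation that makes the scalar product nonnegative, the classical
    discriminant argument needs real coefficients only. *)
Lemma cauchy_schwarz f g : L2 f -> L2 g -> normc (cdot mu f g) <= n2 f * n2 g.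
Proof.
move=> f2 g2; have [c [c1 cE]] := unimodular_rotation (cdot mu f g).
apply: quadratic_discriminant; rewrite ?n2_ge0// => t t0.
have a2 := L2_scale (- (t%:C * c)) f2.
have cdE : cdot mu (fun x => - (t%:C * c) * f x) g = (- (t * normc (cdot mu f g)))%:C.
  by rewrite cdotZl// -mulNr -mulrA cE mulNr -rmorphM -rmorphN.
have := n2D_sqr a2 g2; rewrite n2_scale// cdE /=.
rewrite normc_opp normc_scale c1 mulr1 exprMn real_normK ?num_real// => E.
by have := sqr_ge0 (n2 (fun x => - (t%:C * c) * f x + g x)); rewrite E; lra.
Qed.

Lemma n2D f g : L2 f -> L2 g -> n2 (fun x => f x + g x) <= n2 f + n2 g.
Proof.
move=> f2 g2; rewrite -(@ler_pXn2r _ 2)// ?nnegrE ?addr_ge0 ?n2_ge0//.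
rewrite n2D_sqr// sqrrD -[leRHS]addrAC lerD2l -[leRHS]mulr_natl ler_pM2l//.
exact: le_trans (le_Re_normc _) (cauchy_schwarz f2 g2).
Qed.

Lemma n2B f g : L2 f -> L2 g -> n2 (fun x => f x - g x) <= n2 f + n2 g.
Proof. by move=> f2 g2; rewrite -(n2_opp g) n2D//; exact: L2_opp. Qed.

Lemma n2_triangle u f g : L2 f -> L2 g -> L2 u ->
  n2 (fun x => f x - g x) <= n2 (fun x => f x - u x) + n2 (fun x => u x - g x).
Proof.
move=> f2 g2 u2; apply: le_trans (n2D (L2_sub f2 u2) (L2_sub u2 g2)).
by apply: ler_of_eq; congr n2; apply/funext => x; ring.
Qed.

Lemma n2_0 : n2 (fun=> 0) = 0.
Proof.
rewrite /n2; under eq_Rintegral do rewrite normc0 expr0n/=.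
by rewrite /Rintegral integral0/= sqrtr0.
Qed.

Lemma n2_ae f g : L2 f -> L2 g -> {ae mu, forall x, f x = g x} -> n2 f = n2 g.
Proof.
move=> /L2P[mf _] /L2P[mg _] fg; rewrite /n2 /Rintegral; congr (Num.sqrt (fine _)).
apply: ae_eq_integral => //.
- by apply/measurable_EFinP/measurable_funX/measurable_normc.
- by apply/measurable_EFinP/measurable_funX/measurable_normc.
- by apply: filterS fg => x -> _.
Qed.

Lemma n2_sub_ae f g : L2 f -> L2 g -> {ae mu, forall x, f x = g x} ->
  n2 (fun x => f x - g x) = 0.
Proof.
move=> f2 g2 fg; rewrite (@n2_ae _ (fun=> 0)).
- exact: n2_0.
- exact: L2_sub.
- exact: L2_0.
- by apply: filterS fg => x ->; rewrite subrr.
Qed.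

Lemma n2_eq0_ae f : L2 f -> n2 f = 0 -> {ae mu, forall x, f x = 0}.
Proof.
move=> /L2P[mf If] f0.
have I0 : \int[mu]_x (normc (f x) ^+ 2) = 0 by rewrite -sqr_n2 f0 expr0n.
have mn : measurable_fun setT (fun x => (normc (f x) ^+ 2)%:E).
  by apply/measurable_EFinP/measurable_funX/measurable_normc.
have : (\int[mu]_x `|(normc (f x) ^+ 2)%:E| = 0)%E.
  under eq_integral do rewrite gee0_abs ?lee_fin ?sqr_ge0//.
  by rewrite -[LHS]fineK ?integrable_fin_num//; congr (_%:E).
move=> /(ae_eq_integral_abs mu measurableT mn); apply: filterS => x /(_ I) [].
by move=> /eqP; rewrite sqrf_eq0 normc_eq0P => /eqP.
Qed.

Lemma n2_sub_eq0_ae f g : L2 f -> L2 g -> n2 (fun x => f x - g x) = 0 ->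
  {ae mu, forall x, f x = g x}.
Proof.
move=> f2 g2 /(n2_eq0_ae (L2_sub f2 g2)); apply: filterS => x /eqP.
by rewrite subr_eq0 => /eqP.
Qed.

Lemma cdot_ae f f' g g' : L2 f -> L2 f' -> L2 g -> L2 g' ->
  {ae mu, forall x, f x = f' x} -> {ae mu, forall x, g x = g' x} ->
  cdot mu f g = cdot mu f' g'.
Proof.
move=> [mf _] [mf' _] [mg _] [mg' _] ff gg; apply: ae_eq_cintegral => //.
- by apply: cmeasurable_mul => //; exact: cmeasurable_conj.
- by apply: cmeasurable_mul => //; exact: cmeasurable_conj.
- by apply: filterS2 ff gg => x -> ->.
Qed.

End SquareIntegrable.

(** * Completeness *)

Section Completeness.
Context {d : measure_display} {X : measurableType d} {R : realType}.
Variable mu : {measure set X -> \bar R}.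
Implicit Types (f g : X -> R[i]).

Local Notation L2 := (cLp mu 2%:E).
Local Notation n2 := (n2 mu).

Lemma integral_sqr_normc f : L2 f ->
  (\int[mu]_x (normc (f x) ^+ 2)%:E)%E = (n2 f ^+ 2)%:E.
Proof. by move=> /L2P[_ If]; rewrite sqr_n2 /Rintegral fineK ?integrable_fin_num. Qed.

Lemma cvg_geometric_steps (a : nat -> R) (C : R) :
  (forall k, `|a k.+1 - a k| <= C * (1 / 2) ^+ k) -> cvgn a.
Proof.
move=> aC; have C0 : 0 <= C by have := le_trans (normr_ge0 _) (aC 0%N); rewrite expr0 mulr1.
have /normed_cvg : cvgn [normed series (telescope a)].
  apply: (@series_le_cvg _ _ (geometric C (1 / 2))) => [n|n|n|].
  - exact: normr_ge0.
  - by rewrite /geometric /= mulr_ge0// exprn_ge0.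
  - exact: aC.
  - by apply: is_cvg_geometric_series; rewrite ger0_norm//; lra.
rewrite telescopeK => h; rewrite (_ : a = (fun n => (a n - a 0%N) + a 0%N)).
  by apply: is_cvgD => //; exact: is_cvg_cst.
by apply/funext => n; rewrite subrK.
Qed.

(** Completeness of L^2 for geometrically fast Cauchy sequences. With weights
    4^k the squared steps still have a finite integral, so almost everywhere
    the steps are O(2^-k) and the sequence converges; Fatou's lemma bounds the
    distance to the limit. *)
Lemma L2_geometric_limit (v : nat -> X -> R[i]) (C : R) :
  (forall k, L2 (v k)) ->
  (forall k m, (k <= m)%N -> n2 (fun x => v m x - v k x) <= C * (1 / 4) ^+ k) ->
  exists g, L2 g /\ forall k, n2 (fun x => v k x - g x) <= C * (1 / 4) ^+ k.
Proof.
move=> v2 vC.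
have q0 k : 0 <= (1 / 4) ^+ k :> R by rewrite exprn_ge0.
have C0 : 0 <= C by have := le_trans (n2_ge0 _ _) (vC 0%N 0%N (leqnn _)); rewrite expr0 mulr1.
pose w k x : \bar R := (4 ^+ k * normc (v k.+1 x - v k x) ^+ 2)%:E.
have mw k : measurable_fun setT (w k).
  apply/measurable_EFinP; apply: measurable_funM; first exact: measurable_cst.
  by apply/measurable_funX/measurable_normc/cmeasurable_sub; exact: L2_measurable (v2 _).
have w0 k x : (0 <= w k x)%E by rewrite lee_fin mulr_ge0 ?sqr_ge0// exprn_ge0.
have Iw k : (\int[mu]_x w k x <= (C ^+ 2 * (1 / 4) ^+ k)%:E)%E.
  have d2 := L2_sub (v2 k.+1) (v2 k).
  rewrite [leLHS](_ : _ = ((4 ^+ k) * n2 (fun x => v k.+1 x - v k x) ^+ 2)%:E).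
    rewrite lee_fin; apply: (@le_trans _ _ (4 ^+ k * (C * (1 / 4) ^+ k) ^+ 2)).
      rewrite ler_wpM2l ?exprn_ge0// ler_pXn2r ?nnegrE ?n2_ge0 ?mulr_ge0//.
      exact: vC.
    rewrite exprMn mulrCA ler_wpM2l ?sqr_ge0// expr2 mulrA -exprMn.
    by rewrite (_ : 4 * (1 / 4) = 1 :> R) ?expr1n ?mul1r//; field.
  rewrite EFinM -integral_sqr_normc// -ge0_integralZl_EFin ?exprn_ge0//.
  - by move=> x _; rewrite lee_fin sqr_ge0.
  - by apply/measurable_EFinP/measurable_funX/measurable_normc; exact: L2_measurable d2.
pose G x := (\sum_(k <oo) w k x)%E.
have IG : (\int[mu]_x G x < +oo)%E.
  rewrite integral_nneseries//.
  apply: (@le_lt_trans _ _ (\sum_(k <oo) (C ^+ 2 * (1 / 4) ^+ k)%:E)%E).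
    by apply: lee_nneseries => // k _ _; exact: integral_ge0.
  have geo n : \sum_(0 <= k < n) (1 / 4 : R) ^+ k = 4 / 3 * (1 - (1 / 4) ^+ n).
    elim: n => [|n IH]; first by rewrite big_geq// expr0 subrr mulr0.
    by rewrite big_nat_recr//= IH exprS; field.
  apply: (@le_lt_trans _ _ (C ^+ 2 * (4 / 3))%:E); last exact: ltry.
  apply: lime_le.
    by apply: is_cvg_nneseries => n _ _; rewrite lee_fin mulr_ge0 ?sqr_ge0.
  apply: nearW => n; rewrite sumEFin lee_fin -big_distrr/= ler_wpM2l ?sqr_ge0//.
  by rewrite geo ler_piMr// gerBl.
have mG : measurable_fun setT G by apply: ge0_emeasurable_sum => // k x _ _.
have G0 x : (0 <= G x)%E by apply: nneseries_ge0.
have aeG : {ae mu, forall x, G x \is a fin_num}.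
  have IG' : mu.-integrable setT G.
    apply/integrableP; split => //; rewrite (eq_integral G)// => x _.
    by rewrite gee0_abs.
  by have := integrable_ae measurableT IG'; apply: filterS => x /(_ I).
(* Outside of D the sequence is replaced by 0 to make it converge everywhere. *)
pose D := [set x | G x \is a fin_num].
have mD : measurable D.
  by rewrite -(setTI D); exact: emeasurable_fin_num.
pose w' k x := if x \in D then v k x else 0.
have step k x : x \in D -> normc (v k.+1 x - v k x) <= (1 + fine (G x)) * (1 / 2) ^+ k.
  rewrite inE => Dx; have wG : (w k x <= G x)%E.
    have := @nneseries_lim_ge R (w ^~ x) xpredT 0 k.+1 (fun _ _ _ => w0 _ _).
    move=> /(le_trans _); apply.
    by rewrite big_nat_recr//= leeDr//; apply: sume_ge0 => i _; exact: w0.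
  have g0 : 0 <= fine (G x) by rewrite fine_ge0.
  rewrite -(@ler_pXn2r _ 2)// ?nnegrE ?normc_ge0 ?mulr_ge0 ?addr_ge0 ?exprn_ge0//.
  rewrite -(@ler_pM2l _ (4 ^+ k)) ?exprn_gt0//.
  apply: (@le_trans _ _ (fine (G x))).
    by rewrite -lee_fin fineK.
  rewrite exprMn mulrCA exprAC -exprMn (_ : 4 * (1 / 2) ^+ 2 = 1 :> R); last by field.
  by rewrite expr1n mulr1; nra.
have cvgRe x : cvgn (fun k => complex.Re (w' k x)).
  apply: (@cvg_geometric_steps _ (1 + fine (G x))) => k.
  rewrite -Re_sub (le_trans (le_normRe_normc _))// /w'; case: ifPn => [/step//|_].
  by rewrite subrr normc0 mulr_ge0 ?exprn_ge0// addr_ge0// fine_ge0.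
have cvgIm x : cvgn (fun k => complex.Im (w' k x)).
  apply: (@cvg_geometric_steps _ (1 + fine (G x))) => k.
  rewrite -Im_opp -Im_add (le_trans (le_normIm_normc _))// /w'; case: ifPn => [/step//|_].
  by rewrite subrr normc0 mulr_ge0 ?exprn_ge0// addr_ge0// fine_ge0.
pose g x : R[i] := limn (fun k => complex.Re (w' k x)) +i* limn (fun k => complex.Im (w' k x)).
have mw' k : cmeasurable_fun setT (w' k).
  exact: (cmeasurable_restrict mD (L2_measurable (v2 k))).
have mg : cmeasurable_fun setT g.
  split => /=.
    by apply: (measurable_fun_cvg (fun k => (mw' k).1)) => x _; exact: cvgRe.
  by apply: (measurable_fun_cvg (fun k => (mw' k).2)) => x _; exact: cvgIm.
have aew k : {ae mu, forall x, w' k x = v k x}.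
  by apply: filterS aeG => x Dx; rewrite /w' ifT// inE.
have w2 k : L2 (w' k).
  have [mv Iv] := (L2P mu (v k)).1 (v2 k).
  apply/L2P; split; first exact: mw'.
  apply: le_integrable Iv => //.
    by apply/measurable_EFinP/measurable_funX/measurable_normc.
  move=> x _; rewrite /= lee_fin /w'; case: ifPn => // _.
  by rewrite normc0 expr0n/= normr0.
have fat k : (\int[mu]_x (normc (w' k x - g x) ^+ 2)%:E <= ((C * (1 / 4) ^+ k) ^+ 2)%:E)%E.
  pose F j x := (normc (w' k x - w' j x) ^+ 2)%:E.
  have mF j : measurable_fun setT (F j).
    by apply/measurable_EFinP/measurable_funX/measurable_normc/cmeasurable_sub.
  have F0 j x : setT x -> (0 <= F j x)%E by move=> _; rewrite lee_fin sqr_ge0.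
  have Fg x : F ^~ x @ \oo --> (normc (w' k x - g x) ^+ 2)%:E.
    apply: cvg_EFin; first exact: nearW.
    rewrite (_ : fine \o _ = (fun j => (complex.Re (w' k x) - complex.Re (w' j x)) ^+ 2
       + (complex.Im (w' k x) - complex.Im (w' j x)) ^+ 2)); last first.
      by apply/funext => j; rewrite /F /= sqr_normcE Re_sub Im_add Im_opp.
    rewrite sqr_normcE Re_sub Im_add Im_opp /=.
    by apply: cvgD; apply: cvgM; apply: cvgB; [exact: cvg_cst|exact: cvgRe|exact: cvg_cst
      |exact: cvgRe|exact: cvg_cst|exact: cvgIm|exact: cvg_cst|exact: cvgIm].
  have -> : (\int[mu]_x (normc (w' k x - g x) ^+ 2)%:E = \int[mu]_x limn_einf (F ^~ x))%E.
    by apply: eq_integral => x _; have [-> _] := cvg_limn_einf_sup (Fg x).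
  apply: (le_trans (fatou mu measurableT mF F0)).
  rewrite limn_einf_lim; apply: lime_le; first exact: is_cvg_einfs.
  exists k => // j /= kj; apply: ge_ereal_inf; exists (\int[mu]_x F j x)%E; first by exists j => /=.
  rewrite integral_sqr_normc; last exact: L2_sub.
  rewrite lee_fin ler_pXn2r ?nnegrE ?n2_ge0 ?mulr_ge0//.
  rewrite n2_distC; apply: le_trans (vC k j kj).
  apply: ler_of_eq; apply: n2_ae; try exact: L2_sub.
  by apply: filterS2 (aew k) (aew j) => x -> ->.
have g2 : L2 g.
  have wg2 : L2 (fun x => w' 0%N x - g x).
    apply/L2P; split; first exact: cmeasurable_sub.
    apply/integrableP; split.
      by apply/measurable_EFinP/measurable_funX/measurable_normc/cmeasurable_sub.
    under eq_integral do rewrite gee0_abs ?lee_fin ?sqr_ge0//.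
    by apply: le_lt_trans (fat 0%N) _; exact: ltry.
  have := L2_sub (w2 0%N) wg2.
  by under eq_fun do rewrite opprB addrC subrK.
exists g; split => // k.
have -> : n2 (fun x => v k x - g x) = n2 (fun x => w' k x - g x).
  by apply: n2_ae; try exact: L2_sub; apply: filterS (aew k) => x ->.
rewrite -(@ler_pXn2r _ 2)// ?nnegrE ?n2_ge0 ?mulr_ge0//.
by rewrite -lee_fin -integral_sqr_normc; [exact: fat|exact: L2_sub].
Qed.

End Completeness.

(** * Limits and step functions *)

Section RealLimits.
Context {R : realType}.
Implicit Types u v : nat -> R.

Lemma squeeze_cvg0 u v : (forall n, 0 <= u n) -> (forall n, u n <= v n) ->
  v n @[n --> \oo] --> (0 : R) -> u n @[n --> \oo] --> (0 : R).
Proof.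
move=> u0 uv v0; apply: (@squeeze_cvgr _ _ _ _ (cst 0) v) => //.
  by apply: nearW => n; rewrite u0 uv.
exact: cvg_cst.
Qed.

Lemma cvg0_comb (c : R) u v : u n @[n --> \oo] --> (0 : R) ->
  v n @[n --> \oo] --> (0 : R) -> c * u n + v n @[n --> \oo] --> (0 : R).
Proof.
move=> u0 v0; rewrite -[X in _ --> X](addr0 0) -[X in _ --> X + _](mulr0 c).
by apply: cvgD => //; apply: cvgM => //; exact: cvg_cst.
Qed.

End RealLimits.

Section SeminormLimits.
Context {d : measure_display} {X : measurableType d} {R : realType}.
Variable mu : {measure set X -> \bar R}.
Implicit Types (f g u v : X -> R[i]).

Local Notation L2 := (cLp mu 2%:E).
Local Notation n2 := (n2 mu).

Lemma cvg_n2 {I : Type} {F : set_system I} {FF : Filter F} (G : I -> X -> R[i]) :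
  (\forall i \near F, L2 (G i)) ->
  cLnorm mu 2%:E (G i) @[i --> F] --> 0%E -> n2 (G i) @[i --> F] --> (0 : R).
Proof.
move=> G2 /fine_cvg; apply: cvg_trans.
apply: near_eq_cvg; apply: filterS G2 => i Gi.
by rewrite /= cLnorm2E.
Qed.

Lemma cvg_cLnorm (G : nat -> X -> R[i]) :
  (forall n, L2 (G n)) -> n2 (G n) @[n --> \oo] --> (0 : R) ->
  cLnorm mu 2%:E (G n) @[n --> \oo] --> 0%E.
Proof.
move=> G2 G0; rewrite (_ : (fun n => _) = (fun n => (n2 (G n))%:E)); last first.
  by apply/funext => n; rewrite cLnorm2E.
by apply: cvg_EFin; [exact: nearW|exact: G0].
Qed.

Lemma L2_near (G : nat -> X -> R[i]) :
  (forall n, cmeasurable_fun setT (G n)) ->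
  cLnorm mu 2%:E (G n) @[n --> \oo] --> 0%E -> \forall n \near \oo, L2 (G n).
Proof.
move=> mG /fine_cvgP[+ _]; apply: filterS => n /fin_numPlt/andP[_ ?].
by split.
Qed.

Lemma dominated_cvg_n2 (G : nat -> X -> R[i]) (h : X -> R) :
  (forall n, L2 (G n)) -> mu.-integrable setT (EFin \o h) ->
  (forall n x, normc (G n x) ^+ 2 <= h x) ->
  (forall x, normc (G n x) @[n --> \oo] --> (0 : R)) ->
  n2 (G n) @[n --> \oo] --> (0 : R).
Proof.
move=> G2 Ih Gh G0.
have I0 : (\int[mu]_x (normc (G n x) ^+ 2)%:E)%E @[n --> \oo] --> (\int[mu]_x (cst 0 x))%E.
  have [] := @dominated_convergence _ _ _ mu setT measurableT
    (fun n x => (normc (G n x) ^+ 2)%:E) (cst 0%E) (EFin \o h) _ _ _ Ih.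
  - move=> n; apply/measurable_EFinP/measurable_funX/measurable_normc.
    exact: L2_measurable (G2 n).
  - exact: measurable_cst.
  - apply: nearW => x _; apply: cvg_EFin; first exact: nearW.
    rewrite -[X in _ --> X](mulr0 0).
    exact: (cvgM (G0 x) (G0 x)).
  - by apply: nearW => x n _; rewrite /= lee_fin ger0_norm ?sqr_ge0.
  - by [].
have sq0 : n2 (G n) ^+ 2 @[n --> \oo] --> (0 : R).
  move: I0; rewrite integral0 => /fine_cvg; apply: cvg_trans.
  by apply: near_eq_cvg; apply: nearW => n; rewrite /= integral_sqr_normc.
have : Num.sqrt (n2 (G n) ^+ 2) @[n --> \oo] --> Num.sqrt (0 : R).
  by apply: continuous_cvg => //; exact: sqrt_continuous.
by rewrite sqrtr0; under eq_fun do rewrite sqrtr_sqr ger0_norm ?n2_ge0//.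
Qed.

Lemma gram_expansion (J : Type) (s : seq (R[i] * J)) (u : J -> X -> R[i]) :
  (forall j, L2 (u j)) ->
  cdot mu (fun x => \sum_(i <- s) i.1 * u i.2 x) (fun x => \sum_(i <- s) i.1 * u i.2 x) =
  \sum_(i <- s) \sum_(j <- s) i.1 * (j.1)^* * cdot mu (u i.2) (u j.2).
Proof.
move=> u2; have s2 : L2 (fun x => \sum_(i <- s) i.1 * u i.2 x).
  by apply: L2_sum => i _; exact: L2_scale.
rewrite cdot_suml//; last by move=> i _; exact: L2_scale.
apply: eq_bigr => i _; rewrite cdotZl// cdotC//.
rewrite cdot_suml//; last by move=> j _; exact: L2_scale.
rewrite rmorph_sum/= big_distrr/=; apply: eq_bigr => j _.
by rewrite cdotZl// conjc_mul -cdotC// mulrA.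
Qed.

End SeminormLimits.

Lemma big_iotaS (V : nmodType) (F : nat -> V) (N : nat) :
  \sum_(j <- iota 0 N.+1) F j = \sum_(j <- iota 0 N) F j + F N.
Proof. by rewrite -addn1 iotaD big_cat/= add0n big_cons big_nil addr0. Qed.

Section StepFunctions.
Context {R : realType}.
Implicit Types (a l : R) (s : seq (R[i] * R)).

Definition halfline a l : R[i] := ((l <= a)%R%:R : R)%:C.

Lemma halfline1 a l : l <= a -> halfline a l = 1.
Proof. by rewrite /halfline => ->; exact: rmorph1. Qed.

Lemma halfline0 a l : a < l -> halfline a l = 0.
Proof. by rewrite /halfline ltNge => /negbTE ->; exact: rmorph0. Qed.

Definition halfline_fun s l : R[i] := \sum_(i <- s) i.1 * halfline i.2 l.

(** Half-lines are easier to multiply than intervals: their intersection is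
    given by a minimum. *)
Definition halflines (s : @step_datum R) : seq (R[i] * R) :=
  flatten [seq [:: (i.1, i.2.2); (- i.1, i.2.1)] | i <- s].

Lemma halflines_fun (s : @step_datum R) l : step_wf s ->
  halfline_fun (halflines s) l = step_fun s l.
Proof.
rewrite /halfline_fun /step_fun; elim: s => [|[c [a b]] s IH] /=.
  by rewrite !big_nil.
move=> /andP[ab ws]; rewrite /halflines /= !big_cons /= IH//.
rewrite addrA mulNr /halfline.
have [al|la] := ltrP a l => /=.
  case: (lerP l b) => lb /=; first by rewrite mulr1 mulr0 subr0.
  by rewrite !mulr0 subr0 add0r.
by rewrite (le_trans la ab) subrr add0r.
Qed.

Lemma grid_beyond (V : nmodType) (F : nat -> V) (x : nat -> R) (N : nat) l :
  (forall k, x k <= x k.+1) -> x N < l ->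
  \sum_(j <- iota 0 N | x j < l <= x j.+1) F j = 0.
Proof.
move=> x_nd xNl; rewrite big_seq_cond big_pred0// => j; apply/negbTE.
rewrite mem_iota add0n /= !negb_and -leqNgt -!ltNge.
have [jN|//] := ltnP j N; rewrite /= orbC; apply/orP; left.
apply: le_lt_trans xNl; exact: (homo_leq lexx le_trans x_nd).
Qed.

(** Evaluates at l the step functions carried by a grid. *)
Lemma grid_cell (x : nat -> R) (N : nat) l :
  (forall k, x k <= x k.+1) -> x 0%N < l -> l <= x N ->
  exists2 k, (k < N)%N & x k < l <= x k.+1 /\
    forall (V : nmodType) (F : nat -> V),
      \sum_(j <- iota 0 N | x j < l <= x j.+1) F j = F k.
Proof.
move=> x_nd x0l; elim: N => [|N IH] lN.
  by move: (lt_le_trans x0l lN); rewrite ltxx.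
have [lxN|xNl] := lerP l (x N).
  have [k kN [kl kF]] := IH lxN; exists k; first exact: ltnW.
  split => // V F; rewrite -addn1 iotaD big_cat/= kF add0n big_cons big_nil.
  by rewrite ltNge lxN /= addr0.
exists N => //; split; first by rewrite xNl lN.
move=> V F; rewrite -addn1 iotaD big_cat/= add0n big_cons big_nil addr0 xNl lN.
by rewrite grid_beyond ?add0r.
Qed.

End StepFunctions.

(** * The spectral isometry *)

Section BoundedFunctions.
Context {d : measure_display} {X : measurableType d} {R : realType}.
Variable mu : {measure set X -> \bar R}.
Implicit Types (f g u v : X -> R[i]).
Local Notation L2 := (cLp mu 2%:E).
Local Notation n2 := (n2 mu).

Lemma n2_dist_le f g : L2 f -> L2 g -> `|n2 f - n2 g| <= n2 (fun x => f x - g x).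
Proof.
move=> f2 g2; have h u v : L2 u -> L2 v -> n2 u - n2 v <= n2 (fun x => u x - v x).
  move=> u2 v2; rewrite lerBlDr; apply: le_trans (n2D (L2_sub u2 v2) v2).
  by apply: ler_of_eq; congr n2; apply/funext => x; rewrite subrK.
rewrite ler_norml h// andbT lerNl opprB n2_distC; exact: h.
Qed.

Lemma ae_bounded_L2 f (C : R) : (mu setT < +oo)%E -> cmeasurable_fun setT f ->
  0 <= C -> {ae mu, forall x, normc (f x) <= C} -> L2 f.
Proof.
move=> mu_fin mf C0 fC; apply/L2P; split => //.
have mf2 : measurable_fun setT (fun x => (normc (f x) ^+ 2)%:E).
  by apply/measurable_EFinP/measurable_funX/measurable_normc.
apply/integrableP; split => //.
under eq_integral do rewrite gee0_abs ?lee_fin ?sqr_ge0//.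
apply: (@le_lt_trans _ _ (\int[mu]_x (cst (C ^+ 2)%:E x))%E); last first.
  by rewrite integral_cst// lte_mul_pinfty// lee_fin sqr_ge0.
apply: ae_ge0_le_integral => //.
- by move=> x _; rewrite lee_fin sqr_ge0.
- by move=> x _; rewrite lee_fin sqr_ge0.
- by apply: filterS fC => x fx _; rewrite lee_fin ler_pXn2r ?nnegrE ?normc_ge0.
Qed.

Lemma n2_le f g : L2 f -> L2 g -> (forall x, normc (f x) <= normc (g x)) -> n2 f <= n2 g.
Proof.
move=> /L2P[mf If] /L2P[mg Ig] fg; rewrite /n2 ler_wsqrtr//.
by apply: le_Rintegral => // x _; rewrite ler_pXn2r ?nnegrE ?normc_ge0.
Qed.

Lemma n2_le_ae f (C : R) : (mu setT < +oo)%E -> L2 f -> 0 <= C ->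
  {ae mu, forall x, normc (f x) <= C} -> n2 f <= C * Num.sqrt (fine (mu setT)).
Proof.
move=> mu_fin f2 C0 fC.
have m0 : 0 <= fine (mu setT) by apply: fine_ge0.
rewrite -(@ler_pXn2r _ 2)// ?nnegrE ?n2_ge0 ?mulr_ge0 ?sqrtr_ge0//.
rewrite exprMn (sqr_sqrtr m0) -lee_fin -integral_sqr_normc// EFinM fineK ?ge0_fin_numE//.
rewrite -integral_cst//; apply: ae_ge0_le_integral => //.
- by move=> x _; rewrite lee_fin sqr_ge0.
- by apply/measurable_EFinP/measurable_funX/measurable_normc/(L2_measurable f2).
- by move=> x _; rewrite lee_fin sqr_ge0.
- apply: filterS fC => x fx _; rewrite lee_fin ler_pXn2r ?nnegrE ?normc_ge0//.
Qed.

End BoundedFunctions.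

Section SpectralIsometry.
Context {d : measure_display} {X : measurableType d} {R : realType}.
Variable mu : {measure set X -> \bar R}.
Variable E : R -> (X -> R[i]) -> (X -> R[i]).
Hypothesis HE : resolution_of_identity mu E.
Implicit Types (f g u v : X -> R[i]) (a b : R).
Local Notation L2 := (cLp mu 2%:E).
Local Notation n2m := (n2 mu).

Lemma E_L2 a f : L2 f -> L2 (E a f).
Proof. by have [h _ _] := resolution_linear HE a; exact: h. Qed.

Lemma E_sub a f g : L2 f -> L2 g ->
  {ae mu, forall x, E a (fun y => f y - g y) x = E a f x - E a g x}.
Proof.
move=> f2 g2; have [_ _ h] := resolution_linear HE a.
have := h (-1) g f g2 f2; rewrite (_ : (fun y => _) = (fun y => f y - g y)); last first.
  by apply/funext => y; rewrite mulN1r addrC.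
by apply: filterS => x ->; rewrite mulN1r addrC.
Qed.

Lemma cdot_EE a b f : L2 f ->
  cdot mu (E a f) (E b f) = (n2m (E (Num.min a b) f) ^+ 2)%:C.
Proof.
move=> f2; set m := Num.min a b.
have Ef c := E_L2 c f2.
rewrite (resolution_self_adjoint HE)// -cdot_self (resolution_self_adjoint HE)//.
apply: cdot_ae => //; try exact: E_L2.
- exact: nearW.
- apply: filterS2 (resolution_min HE a b f2) (resolution_min HE m m f2) => x -> ->.
  by rewrite minxx.
Qed.

Lemma n2_E_le a f : L2 f -> n2m (E a f) <= n2m f.
Proof.
move=> f2; have Ef := E_L2 a f2.
have h : n2m (E a f) ^+ 2 <= n2m (E a f) * n2m f.
  apply: le_trans (cauchy_schwarz Ef f2).
  rewrite (resolution_self_adjoint HE)//.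
  have -> : cdot mu f (E a f) = (n2m (E a f) ^+ 2)%:C.
    rewrite -{2}(minxx a) -cdot_EE// (resolution_self_adjoint HE)//.
    apply: cdot_ae => //; [exact: E_L2|exact: nearW|].
    by apply: filterS (resolution_min HE a a f2) => x ->; rewrite minxx.
  by rewrite normc_real ler_norm.
have := n2_ge0 mu (E a f); rewrite le_eqVlt => /orP[/eqP <-|n0]; first exact: n2_ge0.
by move: h; rewrite expr2 ler_pM2l.
Qed.

Variables (f : X -> R[i]) (nu : {measure set (measurableTypeR R) -> \bar R}).
Hypotheses (f2 : L2 f) (Hnu : spectral_measure mu E f nu).
Local Notation n2n := (n2 nu).
Local Notation L2n := (cLp nu 2%:E).

Lemma spectral_measure_halfline a : nu `]-oo, a]%classic = (n2m (E a f) ^+ 2)%:E.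
Proof. by rewrite Hnu cLnorm2E//; exact: E_L2. Qed.

Lemma spectral_measure_total : nu setT = (n2m f ^+ 2)%:E.
Proof.
pose F n := `]-oo, (n%:R : R)]%classic : set (measurableTypeR R).
have FT : \bigcup_n F n = setT.
  apply/seteqP; split => // x _; exists (Num.truncn `|x|).+1 => //=.
  rewrite /F /= in_itv/=; apply: (le_trans (ler_norm x)); apply: ltW.
  by have /andP[_] := truncn_itv (normr_ge0 x).
have h1 : nu \o F @ \oo --> nu setT.
  rewrite -FT; apply: nondecreasing_cvg_mu.
  - by move=> n; exact: measurable_itv.
  - by rewrite FT; exact: measurableT.
  - move=> m n mn; apply/subsetPset => x; rewrite /F /= !in_itv/= => /le_trans; apply.
  by rewrite ler_nat.
have h2 : nu \o F @ \oo --> (n2m f ^+ 2)%:E.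
  rewrite (_ : _ \o _ = (fun n => (n2m (E n%:R f) ^+ 2)%:E)); last first.
    by apply/funext => n; rewrite /F /= spectral_measure_halfline.
  apply: cvg_EFin; first exact: nearW.
  have h : n2m (E a f) @[a --> +oo%R] --> n2m f.
    apply/cvgrPdist_le => e e0.
    have Ef2 : \forall a \near +oo%R, L2 (fun x => E a f x - f x).
      by apply: nearW => a; apply: L2_sub => //; exact: E_L2.
    have /cvgrPdist_le/(_ e e0) : n2m (fun x => E a f x - f x) @[a --> +oo%R] --> (0 : R).
      exact: (cvg_n2 Ef2 (resolution_pinfty HE f2)).
    apply: filterS => a; rewrite sub0r normrN ger0_norm ?n2_ge0// => /(le_trans _); apply.
    by rewrite n2_distC; apply: n2_dist_le => //; exact: E_L2.
  have h' : n2m (E n%:R f) @[n --> \oo] --> n2m f.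
    by apply: (@cvg_comp _ _ _ (fun n : nat => n%:R : R) (fun a => n2m (E a f))) h; exact: cvgr_idn.
  by under eq_fun do rewrite expr2; rewrite expr2; exact: cvgM.
by rewrite -(cvg_lim _ h1)// (cvg_lim _ h2).
Qed.

Lemma spectral_measure_fin : (nu setT < +oo)%E.
Proof. by rewrite spectral_measure_total ltry. Qed.

Lemma cmeasurable_halfline_fun s : cmeasurable_fun [set: measurableTypeR R] (halfline_fun s).
Proof.
apply: cmeasurable_sum => i _; apply: cmeasurable_scale; apply: cmeasurable_real.
rewrite (_ : (fun x => _) = \1_(`]-oo, i.2]%classic)).
  exact: measurable_indic.
by apply/funext => l; rewrite indicE mem_setE in_itv/=.
Qed.

Lemma halfline_fun_L2 s : L2n (halfline_fun s).
Proof.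
apply: (ae_bounded_L2 (C := \sum_(i <- s) normc i.1) spectral_measure_fin).
- exact: cmeasurable_halfline_fun.
- by apply: sumr_ge0 => i _; exact: normc_ge0.
apply: nearW => l; rewrite /halfline_fun; elim: s => [|i s IH]; first by rewrite !big_nil normc0.
rewrite !big_cons (le_trans (le_normc_add _ _))// lerD// normcM ler_piMr ?normc_ge0//.
by rewrite normc_real ger0_norm// lern1 leq_b1.
Qed.

Definition halfline_int (s : seq (R[i] * R)) (x : X) : R[i] := \sum_(i <- s) i.1 * E i.2 f x.

Lemma halfline_int_L2 s : L2 (halfline_int s).
Proof. by apply: L2_sum => i _; apply: L2_scale; exact: E_L2. Qed.

(** Both squared norms expand into the same Gram sum: scalar products of the
    E a f, and of the half-lines in the spectral measure, are given by the
    minimum of the two end points. *)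
Lemma halfline_isometry s : n2m (halfline_int s) = n2n (halfline_fun s).
Proof.
apply/eqP; rewrite -(@eqrXn2 _ 2)// ?n2_ge0//; apply/eqP; apply: complexI.
have h1 a : L2n (halfline a).
  have := halfline_fun_L2 [:: (1, a)]; congr cLp; apply/funext => l.
  by rewrite /halfline_fun big_cons big_nil addr0 mul1r.
rewrite -!cdot_self /halfline_int /halfline_fun.
rewrite (gram_expansion s (u := fun a => E a f)); last by move=> a; exact: E_L2.
rewrite (gram_expansion s h1); apply: eq_bigr => i _; apply: eq_bigr => j _.
congr (_ * _); rewrite cdot_EE//.
have -> : cdot nu (halfline i.2) (halfline j.2) =
    (\int[nu]_l (\1_(`]-oo, Num.min i.2 j.2]%classic) l))%:C.
  rewrite /cdot -cintegral_real; congr cintegral; apply/funext => l.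
  rewrite /halfline indicE mem_setE in_itv/= le_min conj_conjc conjc_real -rmorphM/=.
  by rewrite -natrM mulnb.
by rewrite /Rintegral integral_indic// setIT spectral_measure_halfline.
Qed.

Lemma halfline_fun_comb (a : R[i]) s r l :
  halfline_fun ([seq (a * i.1, i.2) | i <- s] ++ r) l = a * halfline_fun s l + halfline_fun r l.
Proof.
rewrite /halfline_fun big_cat big_map big_distrr/=; congr (_ + _).
by apply: eq_bigr => i _; rewrite mulrA.
Qed.

Lemma halfline_int_comb (a : R[i]) s r x :
  halfline_int ([seq (a * i.1, i.2) | i <- s] ++ r) x = a * halfline_int s x + halfline_int r x.
Proof.
rewrite /halfline_int big_cat big_map big_distrr/=; congr (_ + _).
by apply: eq_bigr => i _; rewrite mulrA.
Qed.

Lemma halfline_diff_isometry s r :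
  n2m (fun x => halfline_int s x - halfline_int r x) =
  n2n (fun l => halfline_fun s l - halfline_fun r l).
Proof.
have := halfline_isometry ([seq (-1 * i.1, i.2) | i <- r] ++ s).
have -> : halfline_int ([seq (-1 * i.1, i.2) | i <- r] ++ s) =
    (fun x => halfline_int s x - halfline_int r x).
  by apply/funext => x; rewrite halfline_int_comb mulN1r addrC.
move=> ->; congr n2; apply/funext => l.
by rewrite halfline_fun_comb mulN1r addrC.
Qed.

(** The limit procedure of spectral_integral for one given spectral measure and
    with half-lines instead of intervals. *)
Definition spectral_approx (phi : R -> R[i]) u : Prop :=
  exists s : nat -> seq (R[i] * R),
    n2n (fun l => phi l - halfline_fun (s n) l) @[n --> \oo] --> (0 : R) /\
    n2m (fun x => halfline_int (s n) x - u x) @[n --> \oo] --> (0 : R).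

Lemma spectral_approx_comb (a : R[i]) phi psi u v :
  L2n phi -> L2n psi -> L2 u -> L2 v ->
  spectral_approx phi u -> spectral_approx psi v ->
  spectral_approx (fun l => a * phi l + psi l) (fun x => a * u x + v x).
Proof.
move=> phi2 psi2 u2 v2 [s [s1 s2]] [r [r1 r2]].
exists (fun n => [seq (a * i.1, i.2) | i <- s n] ++ r n); split.
  apply: squeeze_cvg0 (cvg0_comb (normc a) s1 r1) => n; first exact: n2_ge0.
  have A := L2_sub phi2 (halfline_fun_L2 (s n)).
  have B := L2_sub psi2 (halfline_fun_L2 (r n)).
  rewrite -n2_scale//; apply: le_trans (n2D (L2_scale a A) B).
  apply: ler_of_eq; congr n2; apply/funext => l.
  by rewrite halfline_fun_comb; ring.
apply: squeeze_cvg0 (cvg0_comb (normc a) s2 r2) => n; first exact: n2_ge0.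
have A := L2_sub (halfline_int_L2 (s n)) u2.
have B := L2_sub (halfline_int_L2 (r n)) v2.
rewrite -n2_scale//; apply: le_trans (n2D (L2_scale a A) B).
apply: ler_of_eq; congr n2; apply/funext => l.
by rewrite halfline_int_comb; ring.
Qed.

Lemma spectral_approx_sub phi psi u v :
  L2n phi -> L2n psi -> L2 u -> L2 v ->
  spectral_approx phi u -> spectral_approx psi v ->
  spectral_approx (fun l => phi l - psi l) (fun x => u x - v x).
Proof.
move=> phi2 psi2 u2 v2 hu hv.
have comb (Y : Type) (a b : Y -> R[i]) : (fun y => -1 * b y + a y) = (fun y => a y - b y).
  by apply/funext => y; rewrite mulN1r addrC.
by have := spectral_approx_comb (-1) psi2 phi2 v2 u2 hv hu; rewrite !comb.
Qed.

(** Through this identity, distances in L^2 between functions of the operator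
    are computed on their symbols. *)
Lemma spectral_approx_isometry phi u : L2n phi -> L2 u ->
  spectral_approx phi u -> n2m u = n2n phi.
Proof.
move=> phi2 u2 [s [s1 s2]].
have h1 : n2m (halfline_int (s n)) @[n --> \oo] --> n2m u.
  apply/cvgrPdist_le => e e0; move/cvgrPdist_le : s2 => /(_ e e0).
  apply: filterS => n; rewrite sub0r normrN ger0_norm ?n2_ge0// => /(le_trans _); apply.
  by rewrite n2_distC; apply: n2_dist_le => //; exact: halfline_int_L2.
have h2 : n2n (halfline_fun (s n)) @[n --> \oo] --> n2n phi.
  apply/cvgrPdist_le => e e0; move/cvgrPdist_le : s1 => /(_ e e0).
  apply: filterS => n; rewrite sub0r normrN ger0_norm ?n2_ge0// => /(le_trans _); apply.
  by apply: n2_dist_le => //; exact: halfline_fun_L2.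
move: h1; under eq_fun do rewrite halfline_isometry.
by move=> h1; rewrite -(cvg_lim _ h1)// (cvg_lim _ h2).
Qed.

Lemma step_integral_halflines (s : @step_datum R) x :
  step_integral E s f x = halfline_int (halflines s) x.
Proof.
rewrite /step_integral /halfline_int /halflines; elim: s => [|[c [a b]] s IH] /=.
  by rewrite !big_nil.
by rewrite !big_cons IH /= addrA mulNr mulrBr.
Qed.

End SpectralIsometry.

(** * Spectral localization *)

Section SpectralPieces.
Context {d : measure_display} {X : measurableType d} {R : realType}.
Variable mu : {measure set X -> \bar R}.
Variable E : R -> (X -> R[i]) -> (X -> R[i]).
Hypothesis HE : resolution_of_identity mu E.
Implicit Types (f g p : X -> R[i]) (a b : R).
Local Notation L2 := (cLp mu 2%:E).
Local Notation n2m := (n2 mu).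

Lemma le_add_geometric (x y C : R) : (forall n, x <= y + C * (1 / 4) ^+ n) -> x <= y.
Proof.
move=> h; have q1 : `|1 / 4 : R| < 1 by rewrite ger0_norm; lra.
have c : y + C * (1 / 4) ^+ n @[n --> \oo] --> y.
  rewrite -[X in _ --> X]addr0; apply: cvgD; first exact: cvg_cst.
  exact: (cvg_geometric C q1).
rewrite -(cvg_lim _ c)//; apply: limr_ge; first exact: cvgP c.
exact: nearW.
Qed.

Lemma geometric_cvg0 (C : R) : C * (1 / 4) ^+ n @[n --> \oo] --> (0 : R).
Proof. by apply: cvg_geometric; rewrite ger0_norm; lra. Qed.

(** The spectral measure of p = (E b - E a) p lives on ]a, b], where the step
    functions of finer and finer grids converge to l uniformly. Their integrals
    converge by completeness, and stay close to b p because l stays close to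
    b. *)
Lemma spectral_piece p a b (nu : {measure set (measurableTypeR R) -> \bar R}) :
  L2 p -> spectral_measure mu E p nu -> a < b ->
  {ae mu, forall x, E a p x = 0} -> {ae mu, forall x, E b p x = p x} ->
  exists g, spectral_integral mu E (fun l => l%:C) p g /\
    n2m (fun x => g x - b%:C * p x) <= (b - a) * n2m p.
Proof.
move=> p2 Hnu ab Ea Eb.
have nuT := spectral_measure_total HE p2 Hnu.
have nufin := spectral_measure_fin HE p2 Hnu.
have sqrtT : Num.sqrt (fine (nu setT)) = n2m p.
  by rewrite nuT /= sqrtr_sqr ger0_norm// n2_ge0.
have Ef c := E_L2 HE c p2.
have aea : {ae nu, forall l, a < l}.
  exists `]-oo, a]%classic; split => //.
    rewrite (spectral_measure_halfline HE p2 Hnu).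
    rewrite (@n2_ae _ _ _ mu _ (fun=> 0))//; last exact: L2_0.
    by rewrite n2_0 expr0n.
  by move=> l /= /negP; rewrite -leNgt in_itv.
have aeb : {ae nu, forall l, l <= b}.
  exists `]b, +oo[%classic; split => //; last first.
    by move=> l /= /negP; rewrite -ltNge in_itv/= andbT.
  have U : nu setT = (nu `]-oo, b]%classic + nu `]b, +oo[%classic)%E.
    rewrite -measureU//.
    - by congr (nu _); apply/seteqP; split => // l _ /=; rewrite !in_itv/= andbT; case: lerP; [left|right].
    - apply/seteqP; split => // l /=; rewrite !in_itv/= andbT => -[lb bl].
      by move: (le_lt_trans lb bl); rewrite ltxx.
  move: U; rewrite nuT (spectral_measure_halfline HE p2 Hnu) (n2_ae (Ef b) p2 Eb).
  have zfin : nu `]b, +oo[%classic \is a fin_num.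
    rewrite ge0_fin_numE//; apply: le_lt_trans nufin.
    by apply: le_measure => //; rewrite ?inE//; exact: measurable_itv.
  rewrite -(fineK zfin) -EFinD => -[] z0.
  by congr (_%:E); lra.
(* 4^n cells, to meet the speed of convergence of L2_geometric_limit. *)
pose N n := (4 ^ n)%N.
pose h n := (b - a) / (N n)%:R.
have hE n : h n = (b - a) * (1 / 4) ^+ n.
  by rewrite /h /N natrX expr_div_n expr1n div1r.
have h0 n : 0 < h n by rewrite hE mulr_gt0 ?subr_gt0// exprn_gt0.
have h_le n m : (n <= m)%N -> h m <= h n.
  move=> nm; rewrite !hE; apply: ler_wpM2l; first by rewrite subr_ge0 ltW.
  by apply: ler_wiXn2l => //; lra.
pose x n k := a + k%:R * h n.
have xN n : x n (N n) = b.
  rewrite /x /h; field; rewrite pnatr_eq0 expn_eq0//.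
pose s n : @step_datum R := [seq ((x n k.+1)%:C, (x n k, x n k.+1)) | k <- iota 0 (N n)].
have x_nd n k : x n k <= x n k.+1.
  by rewrite /x lerD2l ler_wpM2r ?ler_nat// ltW.
have ws n : step_wf (s n).
  by apply/allP => i /mapP[k _ ->] /=; exact: x_nd.
pose H n := halflines (s n).
have Hl n l : a < l -> l <= b -> exists y : R, [/\ halfline_fun (H n) l = y%:C, l <= y, y <= l + h n & y <= b].
  move=> al lb; rewrite halflines_fun//.
  have [||k kN [/andP[kl lk] kF]] := @grid_cell R (x n) (N n) l (x_nd n).
  - by rewrite /x mul0r addr0.
  - by rewrite xN.
  exists (x n k.+1); split => //.
  - by rewrite /step_fun big_map /= (kF _ (fun j => (x n j.+1)%:C)).
  - by move: kl; rewrite /x -[k.+1%:R]natr1; lra.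
  - by rewrite -(xN n); apply: (homo_leq lexx le_trans (x_nd n)).
have ae_filter := ae_filter_ringOfSetsType nu.
have ae_bound (phi : R -> R[i]) (C : R) : cmeasurable_fun [set: measurableTypeR R] phi -> 0 <= C ->
    (forall l, a < l -> l <= b -> normc (phi l) <= C) ->
    cLp nu 2%:E phi /\ n2 nu phi <= C * n2m p.
  move=> mphi C0 phiC.
  have ae_phi : {ae nu, forall l, normc (phi l) <= C}.
    by apply: filterS2 aea aeb => l al lb; exact: phiC.
  have phi2 := ae_bounded_L2 nufin mphi C0 ae_phi.
  by split => //; rewrite -sqrtT; exact: n2_le_ae.
have mH n := @cmeasurable_halfline_fun R (H n).
have mid : cmeasurable_fun [set: measurableTypeR R] (fun l : R => l%:C).
  by apply: cmeasurable_real; exact: measurable_id.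
have cauchy k m : (k <= m)%N ->
    n2m (fun y => halfline_int E p (H m) y - halfline_int E p (H k) y) <= (2 * (b - a) * n2m p) * (1 / 4) ^+ k.
  move=> km; rewrite (halfline_diff_isometry HE p2 Hnu).
  have [] := @ae_bound (fun l => halfline_fun (H m) l - halfline_fun (H k) l) (2 * h k).
  - exact: cmeasurable_sub.
  - by rewrite mulr_ge0// ltW.
  - move=> l al lb; have [y1 [-> l1 l2 _]] := Hl m l al lb.
    have [y2 [-> l3 l4 _]] := Hl k l al lb.
    rewrite normc_sub_real ler_norml; have := h_le k m km; have := h0 k; lra.
  - by move=> _ /le_trans; apply; rewrite hE; apply: ler_of_eq; ring.
have [g [g2 gC]] := L2_geometric_limit (fun k => halfline_int_L2 HE p2 (H k)) cauchy.
exists g; split; last first.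
  apply: (@le_add_geometric _ _ (2 * (b - a) * n2m p)) => n.
  have bp2 := L2_scale b%:C p2.
  have Hn2 := halfline_int_L2 HE p2 (H n).
  apply: (le_trans (n2_triangle g2 bp2 Hn2)).
  rewrite addrC; apply: lerD; last by rewrite n2_distC; exact: gC.
  pose t : seq (R[i] * R) := [:: (b%:C, b); (- b%:C, a)].
  have -> : n2m (fun x => halfline_int E p (H n) x - b%:C * p x) =
      n2m (fun x => halfline_int E p (H n) x - halfline_int E p t x).
    apply: n2_ae; try exact: L2_sub.
      by apply: L2_sub => //; exact: halfline_int_L2.
    apply: filterS2 Ea Eb => z Ea Eb.
    by rewrite /t {3}/halfline_int !big_cons big_nil /= Ea Eb mulr0 !addr0.
  rewrite (halfline_diff_isometry HE p2 Hnu).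
  have [] := @ae_bound (fun l => halfline_fun (H n) l - halfline_fun t l) (b - a).
  - apply: cmeasurable_sub => //; exact: cmeasurable_halfline_fun.
  - by rewrite subr_ge0 ltW.
  - move=> l al lb; have [y [-> l1 l2 l3]] := Hl n l al lb.
    have -> : halfline_fun t l = b%:C * halfline b l + (- b%:C * halfline a l + 0).
      by rewrite /halfline_fun !big_cons big_nil.
    rewrite (halfline1 lb) (halfline0 al) mulr0 mulr1 !addr0.
    by rewrite normc_sub_real ler_norml; lra.
  - by move=> _.
split => //; exists nu, s; split => //.
  have stepH n : (fun l => l%:C - step_fun (s n) l) = (fun l => l%:C - halfline_fun (H n) l).
    by apply/funext => l; rewrite halflines_fun.
  have bnd n : cLp nu 2%:E (fun l => l%:C - step_fun (s n) l) /\
      n2 nu (fun l => l%:C - step_fun (s n) l) <= h n * n2m p.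
    rewrite stepH; apply: ae_bound; [exact: cmeasurable_sub|exact: ltW|].
    move=> l al lb; have [y [-> l1 l2 l3]] := Hl n l al lb.
    by rewrite normc_sub_real ler_norml; lra.
  apply: cvg_cLnorm => [n|]; first by have [] := bnd n.
  apply: squeeze_cvg0 (geometric_cvg0 ((b - a) * n2m p)) => n; first exact: n2_ge0.
  by have [_ /le_trans] := bnd n; apply; rewrite hE; apply: ler_of_eq; ring.
have stepI n : (fun y => step_integral E (s n) p y - g y) = (fun y => halfline_int E p (H n) y - g y).
  by apply/funext => y; rewrite step_integral_halflines.
apply: cvg_cLnorm => [n|].
  by rewrite stepI; apply: L2_sub => //; exact: halfline_int_L2.
apply: squeeze_cvg0 (geometric_cvg0 (2 * (b - a) * n2m p)) => n; first exact: n2_ge0.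
by rewrite stepI; exact: gC.
Qed.

End SpectralPieces.

(** * Semigroup and generator *)

Section SemigroupEstimates.
Context {d : measure_display} {X : measurableType d} {R : realType}.
Variable mu : {measure set X -> \bar R}.
Variable T : R -> (X -> R[i]) -> (X -> R[i]).
Hypothesis HT : symmetric_markovian_semigroup mu T.
Implicit Types (f g p : X -> R[i]) (a b t h : R).
Local Notation L2 := (cLp mu 2%:E).
Local Notation n2m := (n2 mu).

Let HS := markovian_semigroup HT.

Lemma T_L2 t f : 0 <= t -> L2 f -> L2 (T t f).
Proof. by move=> t0; have [h _ _] := semigroup_linear HS t0; exact: h. Qed.

Lemma T_ae t f g : 0 <= t -> L2 f -> L2 g -> {ae mu, forall x, f x = g x} ->
  {ae mu, forall x, T t f x = T t g x}.
Proof. by move=> t0; have [_ h _] := semigroup_linear HS t0; exact: h. Qed.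

Lemma T_comb t (c : R[i]) f g : 0 <= t -> L2 f -> L2 g ->
  {ae mu, forall x, T t (fun y => c * f y + g y) x = c * T t f x + T t g x}.
Proof. by move=> t0; have [_ _ h] := semigroup_linear HS t0; exact: h. Qed.

Lemma T_add t f g : 0 <= t -> L2 f -> L2 g ->
  {ae mu, forall x, T t (fun y => f y + g y) x = T t f x + T t g x}.
Proof.
move=> t0 f2 g2; have := T_comb 1 t0 f2 g2.
rewrite (_ : (fun y => 1 * f y + g y) = (fun y => f y + g y)).
  by apply: filterS => x ->; rewrite mul1r.
by apply/funext => y; rewrite mul1r.
Qed.

Lemma T_sub_scale t (c : R[i]) f g : 0 <= t -> L2 f -> L2 g ->
  {ae mu, forall x, T t (fun y => g y - c * f y) x = T t g x - c * T t f x}.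
Proof.
move=> t0 f2 g2; have := T_comb (- c) t0 f2 g2.
rewrite (_ : (fun y => - c * f y + g y) = (fun y => g y - c * f y)).
  by apply: filterS => x ->; rewrite mulNr addrC.
by apply/funext => y; rewrite mulNr addrC.
Qed.

Lemma T_scale t (c : R[i]) f : 0 <= t -> L2 f ->
  {ae mu, forall x, T t (fun y => c * f y) x = c * T t f x}.
Proof.
move=> t0 f2; have h0 := T_sub_scale 1 t0 f2 f2.
have := T_comb c t0 f2 (L2_sub f2 (L2_scale 1 f2)).
rewrite (_ : (fun y => c * f y + (f y - 1 * f y)) = (fun y => c * f y)).
  by apply: filterS2 h0 => x -> ->; rewrite mul1r subrr addr0.
by apply/funext => y; rewrite mul1r subrr addr0.
Qed.

Lemma T_n2_le t f : 0 <= t -> L2 f -> n2m (T t f) <= n2m f.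
Proof.
move=> t0 f2; rewrite -lee_fin -!cLnorm2E//; last exact: T_L2.
by apply: (markovian_contraction HT) => //; rewrite lee_fin ler1n.
Qed.

Lemma exp_quadratic_bound (x : R) : 0 <= x -> `|1 - x - expR (- x)| <= x ^+ 2.
Proof.
move=> x0; have h1 := expR_ge1Dx (- x).
have h2 : expR (- x) * (1 + x) <= 1.
  have := ler_wpM2l (expR_ge0 (- x)) (expR_ge1Dx x).
  by rewrite -expRD addNr expR0.
have h3 : expR (- x) <= 1 - x + x ^+ 2.
  rewrite -(@ler_pM2r _ (1 + x)); last by lra.
  apply: (le_trans h2); have := exprn_ge0 3 x0; nra.
rewrite ler_norml; apply/andP; split; lra.
Qed.

(** Each step of size t / n moves T away from multiplication by exp(- a t / n)
    by little more than (t / n) |g - a f|, and contractivity lets these errors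
    just add up. *)
Lemma generator_exp_bound f g a t : generator mu T f g -> 0 <= a -> 0 <= t ->
  n2m (fun x => T t f x - (expR (- (t * a)))%:C * f x) <= t * n2m (fun x => g x - a%:C * f x).
Proof.
move=> [f2 g2 fg] a0; rewrite le_eqVlt => /orP[/eqP <-|t0].
  rewrite !mul0r oppr0 expR0; have Tf2 := T_L2 (lexx 0) f2.
  rewrite n2_sub_ae//; first exact: L2_scale.
  by apply: filterS (semigroup0 HS f2) => x ->; rewrite mul1r.
have afg2 := L2_sub g2 (L2_scale a%:C f2).
pose q h x := (f x - T h f x) / h%:C - g x.
pose v h x := T h f x - (expR (- (h * a)))%:C * f x.
have Tf2 h : 0 < h -> L2 (T h f) by move=> /ltW h0; exact: T_L2.
have q2 h : 0 < h -> L2 (q h).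
  move=> h0; apply: L2_sub => //; have := L2_scale (h%:C)^-1 (L2_sub f2 (Tf2 h h0)).
  by under eq_fun do rewrite mulrC.
have v2 h : 0 < h -> L2 (v h).
  by move=> h0; apply: L2_sub; [exact: Tf2|exact: L2_scale].
have vq h : 0 < h -> n2m (v h) <= h * (n2m (q h) + n2m (fun x => g x - a%:C * f x) + h * a ^+ 2 * n2m f).
  move=> h0; have qh2 := q2 _ h0.
  pose A := fun x => (- h%:C) * (q h x + (g x - a%:C * f x)).
  pose B := fun x => (1 - h * a - expR (- (h * a)))%:C * f x.
  have A2 : L2 A by apply: L2_scale; exact: L2_add.
  have B2 : L2 B by exact: L2_scale.
  have -> : v h = (fun x => A x + B x).
    apply/funext => x; rewrite /v /A /B /q !rmorphB rmorphM/= rmorph1.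
    have h0' : h%:C != 0 :> R[i] by rewrite eq_complex /= gt_eqF.
    by field.
  apply: (le_trans (n2D A2 B2)); rewrite [leRHS]mulrDr; apply: lerD.
    rewrite n2_scale; last exact: L2_add.
    rewrite normc_opp normc_real gtr0_norm// ler_pM2l//; exact: n2D.
  rewrite n2_scale// normc_real mulrA ler_wpM2r ?n2_ge0//.
  have := exp_quadratic_bound (mulr_ge0 (ltW h0) a0); rewrite exprMn expr2.
  by rewrite mulrA.
have iter h k : 0 < h ->
    n2m (fun x => T (k%:R * h) f x - (expR (- (k%:R * h * a)))%:C * f x) <= k%:R * n2m (v h).
  move=> h0; elim: k => [|k IH].
    rewrite !mul0r oppr0 expR0; have T02 := T_L2 (lexx 0) f2.
    rewrite n2_sub_ae//; first exact: L2_scale.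
    by apply: filterS (semigroup0 HS f2) => x ->; rewrite mul1r.
  have kh0 : 0 <= k%:R * h by rewrite mulr_ge0// ltW.
  have kh1 : 0 <= k.+1%:R * h by rewrite mulr_ge0// ltW.
  set e := (expR (- (k%:R * h * a)))%:C.
  pose w := fun x => T (k%:R * h) f x - e * f x.
  have Tk2 := T_L2 kh0 f2.
  have w2 : L2 w by apply: L2_sub => //; exact: L2_scale.
  have hh := ltW h0.
  have Tw2 := T_L2 hh w2.
  have vh2 := v2 _ h0.
  have -> : n2m (fun x => T (k.+1%:R * h) f x - (expR (- (k.+1%:R * h * a)))%:C * f x) =
      n2m (fun x => T h w x + e * v h x).
    apply: n2_ae.
    - by apply: L2_sub; [exact: T_L2|exact: L2_scale].
    - by apply: L2_add => //; exact: L2_scale.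
    have D := semigroupD HS hh kh0 f2.
    have L := T_sub_scale e hh f2 Tk2.
    have -> : k.+1%:R * h = h + k%:R * h by rewrite -natr1; ring.
    apply: filterS2 D L => x -> ->.
    rewrite mulrDl opprD expRD rmorphM /v /= -/e; ring.
  apply: (le_trans (n2D Tw2 (L2_scale e vh2))).
  rewrite -natr1 mulrDl mul1r; apply: lerD; first exact: le_trans (T_n2_le hh w2) IH.
  rewrite n2_scale// normc_real ger0_norm ?expR_ge0// ler_piMl ?n2_ge0//.
  by rewrite -[leRHS]expR0 ler_expR oppr_le0 mulr_ge0.
have q0 : n2m (q h) @[h --> 0^'+] --> (0 : R).
  apply: cvg_n2 fg; near=> h; exact: q2.
apply/ler_addgt0Pr => e e0.
have e1 : 0 < e / (2 * t) by rewrite divr_gt0// mulr_gt0.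
have [h1 /= h10 h1P] : exists2 h1, 0 < h1 & forall h, 0 < h -> h < h1 -> n2m (q h) <= e / (2 * t).
  move/cvgrPdist_le : q0 => /(_ _ e1) [r /= r0 rP]; exists r => // h hp hr.
  have := rP h; rewrite /ball /= sub0r normrN gtr0_norm// => /(_ hr hp).
  by rewrite sub0r normrN ger0_norm ?n2_ge0.
pose K := t * a ^+ 2 * n2m f.
have K0 : 0 <= K by rewrite !mulr_ge0 ?n2_ge0 ?sqr_ge0// ltW.
have t2 : 0 <= 2 * t by rewrite mulr_ge0// ltW.
have tK : 0 <= (2 * t * K) / e by apply: divr_ge0; [exact: mulr_ge0|exact: ltW].
have t1 : 0 <= t / h1 by apply: divr_ge0; exact: ltW.
(* Enough steps to bring t / n below h1 and the quadratic error below e / 2. *)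
pose n := (Num.truncn (t / h1 + (2 * t * K) / e)).+1.
have nP : t / h1 + (2 * t * K) / e < n%:R.
  have h : 0 <= t / h1 + (2 * t * K) / e.
    exact: addr_ge0.
  by have /andP[_] := truncn_itv h.
have n0 : 0 < n%:R :> R by rewrite ltr0n.
have th : 0 < t / n%:R by rewrite divr_gt0.
have th1 : t / n%:R < h1.
  rewrite ltr_pdivrMr// -ltr_pdivrMl// mulrC.
  by apply: le_lt_trans nP; rewrite lerDl.
have nK : K * t / n%:R <= e / 2.
  rewrite ler_pdivrMr// -ler_pdivrMl ?divr_gt0//.
  rewrite [leLHS](_ : _ = 2 * t * K / e); last by field; rewrite gt_eqF.
  by apply: ltW; apply: le_lt_trans nP; rewrite lerDr.
have := iter _ n th; rewrite mulrC divfK ?gt_eqF// => /le_trans; apply.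
apply: (le_trans (ler_wpM2l (ltW n0) (vq _ th))).
rewrite mulrA [n%:R * _]mulrC divfK ?gt_eqF//.
have qe := ler_wpM2l (ltW t0) (h1P _ th th1).
have E1 : t * (e / (2 * t)) = e / 2 by field; rewrite gt_eqF.
have E2 : t * (t / n%:R * a ^+ 2 * n2m f) = K * t / n%:R.
  by rewrite /K; field; rewrite gt_eqF.
rewrite !mulrDr E2; rewrite E1 in qe; lra.
Unshelve. all: by end_near. Qed.

End SemigroupEstimates.

(** * Spectral pieces of the generator *)

Section SemigroupIsExponential.
Context {d : measure_display} {X : measurableType d} {R : realType}.
Variable mu : {measure set X -> \bar R}.
Variable T : R -> (X -> R[i]) -> (X -> R[i]).
Hypothesis HT : symmetric_markovian_semigroup mu T.
Variable E : R -> (X -> R[i]) -> (X -> R[i]).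
Hypothesis HA : resolution_of_operator mu E (generator mu T).
Hypothesis Hnu : forall f, cLp mu 2%:E f ->
  exists nu : {measure set (measurableTypeR R) -> \bar R}, spectral_measure mu E f nu.
Implicit Types (f g p : X -> R[i]) (a b t h : R).
Local Notation L2 := (cLp mu 2%:E).
Local Notation n2m := (n2 mu).

Let HE := HA.1.

Lemma E_piece_lower f a b : L2 f -> a <= b ->
  {ae mu, forall x, E a (fun y => E b f y - E a f y) x = 0}.
Proof.
move=> f2 ab; have Ea := E_L2 HE a f2; have Eb := E_L2 HE b f2.
have M1 := resolution_min HE a b f2; have M2 := resolution_min HE a a f2.
apply: filterS3 (E_sub HE a Eb Ea) M1 M2 => x -> -> ->.
by rewrite minxx (min_idPl ab) subrr.
Qed.

Lemma E_piece_upper f a b : L2 f -> a <= b ->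
  {ae mu, forall x, E b (fun y => E b f y - E a f y) x = E b f x - E a f x}.
Proof.
move=> f2 ab; have Ea := E_L2 HE a f2; have Eb := E_L2 HE b f2.
have M1 := resolution_min HE b b f2; have M2 := resolution_min HE b a f2.
apply: filterS3 (E_sub HE b Eb Ea) M1 M2 => x -> -> ->.
by rewrite minxx (min_idPr ab).
Qed.

Lemma piece_generator f a b : L2 f -> a < b ->
  exists g, generator mu T (fun y => E b f y - E a f y) g /\
    n2m (fun x => g x - b%:C * (E b f x - E a f x)) <=
      (b - a) * n2m (fun y => E b f y - E a f y).
Proof.
move=> f2 ab.
have p2 := L2_sub (E_L2 HE b f2) (E_L2 HE a f2).
have [nu Hp] := Hnu p2.
have [g [gI gb]] := spectral_piece HE p2 Hp ab (E_piece_lower f2 (ltW ab)) (E_piece_upper f2 (ltW ab)).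
by exists g; split => //; apply/HA.2.
Qed.

(** On such a piece the generator would be close to multiplication by a
    negative number, so the semigroup would expand it. *)
Lemma negative_piece_eq0 f a b : L2 f -> a < b -> b < 0 -> b - a <= - b / 2 ->
  n2m (fun y => E b f y - E a f y) = 0.
Proof.
move=> f2 ab b0 bab; set p := fun y => _.
have p2 : L2 p by apply: L2_sub; exact: E_L2.
have [g [[_ g2 gen] gb]] := piece_generator f2 ab; rewrite -/p in gen gb.
pose q h x := (p x - T h p x) / h%:C - g x.
have q2 h : 0 < h -> L2 (q h).
  move=> h0; apply: L2_sub => //; have := L2_scale (h%:C)^-1 (L2_sub p2 (T_L2 HT (ltW h0) p2)).
  by under eq_fun do rewrite mulrC.
have q0 : n2m (q h) @[h --> 0^'+] --> (0 : R).
  apply: cvg_n2 gen; near=> h; exact: q2.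
have lb h : 0 < h -> - b / 2 * n2m p <= n2m (q h).
  move=> h0; have q2h := q2 _ h0.
  have Tp2 := T_L2 HT (ltW h0) p2.
  have gb2 : L2 (fun x => g x - b%:C * p x) by apply: L2_sub => //; exact: L2_scale.
  have hq2 := L2_scale h%:C q2h.
  have hgb2 := L2_scale h%:C gb2.
  have E1 : (fun x => (1 - h * b)%:C * p x) =
      (fun x => T h p x + (h%:C * (g x - b%:C * p x) + h%:C * q h x)).
    apply/funext => x; rewrite /q rmorphB rmorphM rmorph1.
    have h0' : h%:C != 0 :> R[i] by rewrite eq_complex /= gt_eqF.
    by field.
  have := n2D Tp2 (L2_add hgb2 hq2); rewrite -E1 n2_scale// normc_real.
  have hb : h * b < 0 by rewrite pmulr_rlt0.
  rewrite gtr0_norm; last by lra.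
  have := n2D hgb2 hq2; rewrite !n2_scale// normc_real gtr0_norm//.
  have := T_n2_le HT (ltW h0) p2.
  have hgb := ler_wpM2l (ltW h0) gb.
  have hp := ler_wpM2r (n2_ge0 mu p) bab.
  have hhp := ler_wpM2l (ltW h0) hp.
  move=> A1 A2 A3; rewrite -(@ler_pM2l _ h)//; lra.
apply/eqP; rewrite eq_le n2_ge0 andbT.
have : - b / 2 * n2m p <= 0.
  have c0 := cvg_lim (@Rhausdorff R) q0; rewrite -c0.
  apply: limr_ge; first exact: cvgP q0.
  near=> h; exact: lb.
by rewrite pmulr_rle0//; lra.
Unshelve. all: by end_near. Qed.

(** The half-line below a is exhausted by consecutive intervals of length - a / 2,
    none of which carries any mass. *)
Lemma E_negative f a : L2 f -> a < 0 -> n2m (E a f) = 0.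
Proof.
move=> f2 a0; pose ak (k : nat) := a + k%:R * (a / 2).
have Ef c := E_L2 HE c f2.
have akE k : ak k.+1 = ak k + a / 2 by rewrite /ak -natr1; ring.
have ak0 k : ak k <= a.
  by rewrite /ak gerDl mulr_ge0_le0//; lra.
have step k : n2m (fun x => E a f x - E (ak k) f x) = 0.
  elim: k => [|k IH].
    by rewrite /ak mul0r addr0 (_ : (fun x => _) = fun=> 0) ?n2_0//; apply/funext => x; rewrite subrr.
  apply/eqP; rewrite eq_le n2_ge0 andbT.
  apply: (le_trans (n2_triangle (Ef a) (Ef (ak k.+1)) (Ef (ak k)))).
  rewrite IH add0r negative_piece_eq0//; first by rewrite akE; lra.
    by have := ak0 k; lra.
  by rewrite akE; have := ak0 k; lra.
have lim0 : n2m (E (ak k) f) @[k --> \oo] --> (0 : R).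
  have h : n2m (E c f) @[c --> -oo%R] --> (0 : R).
    by apply: cvg_n2 (resolution_ninfty HE f2); exact: nearW.
  apply: (@cvg_comp _ _ _ ak (fun c => n2m (E c f)) _ -oo%R) h.
  apply/cvgrNyPle => M.
  near=> k; rewrite /ak.
  have kM : (a - M) / (- (a / 2)) <= k%:R by near: k; exact: nbhs_infty_ger.
  move: kM; rewrite ler_pdivrMr; last by lra.
  lra.
apply/eqP; rewrite eq_le n2_ge0 andbT -(cvg_lim (@Rhausdorff R) lim0).
apply: limr_ge; first exact: cvgP lim0.
apply: nearW => k; have := n2_dist_le (Ef a) (Ef (ak k)); rewrite step.
by rewrite ler_norml => /andP[]; lra.
Unshelve. all: by end_near. Qed.

Lemma sqr_n2_piece f a b : L2 f -> a <= b ->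
  n2m (fun y => E b f y - E a f y) ^+ 2 = n2m (E b f) ^+ 2 - n2m (E a f) ^+ 2.
Proof.
move=> f2 ab; have Ea := E_L2 HE a f2; have Eb := E_L2 HE b f2.
have := n2D_sqr Eb (L2_opp Ea); rewrite n2_opp => ->.
have -> : cdot mu (E b f) (fun x => - E a f x) = - cdot mu (E b f) (E a f).
  rewrite cdotC//; last exact: L2_opp.
  rewrite cdotNl// (cdotC Eb Ea) !conj_conjc.
  exact: rmorphN.
by rewrite cdot_EE// (min_idPr ab) Re_opp /=; ring.
Qed.

(** Truncating l at 0 makes the symbol bounded by 1 everywhere; the spectral
    measures have no mass on the negative half-line. *)
Definition exp_symbol t (l : R) : R[i] := (expR (- (t * Num.max l 0)))%:C.

Lemma exp_symbol_le1 t l : 0 <= t -> normc (exp_symbol t l) <= 1.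
Proof.
move=> t0; rewrite normc_real ger0_norm ?expR_ge0// -[leRHS]expR0 ler_expR.
by rewrite oppr_le0 mulr_ge0// le_max lexx orbT.
Qed.

Lemma cmeasurable_exp_symbol t : cmeasurable_fun [set: measurableTypeR R] (exp_symbol t).
Proof.
apply: cmeasurable_real; apply: measurableT_comp => //.
apply: measurableT_comp => //; apply: measurable_funM; first exact: measurable_cst.
by apply: measurable_maxr => //; exact: measurable_id.
Qed.

Lemma expRN_lipschitz (x y : R) : 0 <= x -> 0 <= y -> `|expR (- x) - expR (- y)| <= `|x - y|.
Proof.
have h (u v : R) : 0 <= u -> u <= v -> expR (- u) - expR (- v) <= v - u.
  move=> u0 uv; have := expR_ge1Dx (u - v).
  have -> : expR (- v) = expR (- u) * expR (u - v) by rewrite -expRD; congr expR; ring.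
  have : expR (- u) <= 1 by rewrite -[leRHS]expR0 ler_expR oppr_le0.
  have := expR_gt0 (- u); have : expR (u - v) <= 1 by rewrite -[leRHS]expR0 ler_expR subr_le0.
  nra.
move=> x0 y0; have [xy|yx] := lerP x y.
  rewrite ger0_norm ?subr_ge0 ?ler_expR ?lerN2//; exact: h.
have {}yx := ltW yx.
rewrite distrC ger0_norm ?subr_ge0 ?ler_expR ?lerN2//; exact: h.
Qed.

End SemigroupIsExponential.

(** * The semigroup is the exponential of its generator *)

Section ExponentialApproximation.
Context {d : measure_display} {X : measurableType d} {R : realType}.
Variable mu : {measure set X -> \bar R}.
Variable T : R -> (X -> R[i]) -> (X -> R[i]).
Hypothesis HT : symmetric_markovian_semigroup mu T.
Variable E : R -> (X -> R[i]) -> (X -> R[i]).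
Hypothesis HA : resolution_of_operator mu E (generator mu T).
Hypothesis Hnu : forall f, cLp mu 2%:E f ->
  exists nu : {measure set (measurableTypeR R) -> \bar R}, spectral_measure mu E f nu.
Local Notation L2 := (cLp mu 2%:E).
Local Notation n2m := (n2 mu).
Let HE := HA.1.

Variables (f : X -> R[i]) (nu : {measure set (measurableTypeR R) -> \bar R}) (t : R).
Hypotheses (f2 : L2 f) (Hf : spectral_measure mu E f nu) (t0 : 0 <= t).
Local Notation n2n := (n2 nu).
Local Notation L2n := (cLp nu 2%:E).

Lemma piece_exp a b : a < b -> 0 <= b ->
  n2m (fun y => T t (fun y => E b f y - E a f y) y - (expR (- (t * b)))%:C * (E b f y - E a f y))
  <= t * (b - a) * n2m (fun y => E b f y - E a f y).
Proof.
move=> ab b0; have [g [gen gb]] := piece_generator HA Hnu f2 ab.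
apply: (le_trans (generator_exp_bound HT gen b0 t0)).
by rewrite -mulrA ler_wpM2l.
Qed.

(** The errors on the cells are summed with |p| <= e + |p|^2 / e, because only
    the squares |p|^2 of the orthogonal pieces have a bounded sum. *)
Lemma grid_exp (x : nat -> R) (h e : R) (k : nat) :
  0 < h -> 0 < e -> (forall j, x j.+1 = x j + h) -> (forall j, 0 <= x j.+1) ->
  n2m (fun y => T t (fun y => E (x k) f y - E (x 0%N) f y) y -
    \sum_(j <- iota 0 k) (expR (- (t * x j.+1)))%:C * (E (x j.+1) f y - E (x j) f y))
  <= t * h * (k%:R * e + (n2m (E (x k) f) ^+ 2 - n2m (E (x 0%N) f) ^+ 2) / e).
Proof.
move=> h0 e0 xS x_ge0; have Ef c := E_L2 HE c f2.
elim: k => [|k IH].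
  rewrite mul0r subrr mul0r addr0 mulr0.
  have E02 : L2 (fun y => E (x 0%N) f y - E (x 0%N) f y) by exact: L2_sub.
  have -> : (fun y => T t (fun y => E (x 0%N) f y - E (x 0%N) f y) y -
      \sum_(j <- iota 0 0) (expR (- (t * x j.+1)))%:C * (E (x j.+1) f y - E (x j) f y))
      = T t (fun y => E (x 0%N) f y - E (x 0%N) f y).
    by apply/funext => y; rewrite big_nil subr0.
  apply: (le_trans (T_n2_le HT t0 E02)).
  by rewrite (_ : (fun y => _) = fun=> 0) ?n2_0//; apply/funext => y; rewrite subrr.
set S := fun k y => \sum_(j <- iota 0 k) (expR (- (t * x j.+1)))%:C * (E (x j.+1) f y - E (x j) f y) in IH *.
pose p y := E (x k.+1) f y - E (x k) f y.
pose r y := E (x k) f y - E (x 0%N) f y.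
have p2 : L2 p by exact: L2_sub.
have r2 : L2 r by exact: L2_sub.
have S2 j : L2 (S j).
  by apply: L2_sum => i _; apply: L2_scale; exact: L2_sub.
have Tr2 := T_L2 HT t0 r2; have Tp2 := T_L2 HT t0 p2.
have xk : x k < x k.+1 by rewrite xS ltrDl.
set c := (expR (- (t * x k.+1)))%:C.
have cp2 := L2_scale c p2.
have SE y : S k.+1 y = S k y + c * p y.
  by rewrite /S big_iotaS.
have -> : n2m (fun y => T t (fun y => E (x k.+1) f y - E (x 0%N) f y) y - S k.+1 y) =
    n2m (fun y => (T t r y - S k y) + (T t p y - c * p y)).
  apply: n2_ae.
  - by apply: L2_sub => //; apply: T_L2 => //; exact: L2_sub.
  - by apply: L2_add; exact: L2_sub.
  have := T_add HT t0 r2 p2.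
  rewrite (_ : (fun y => r y + p y) = (fun y => E (x k.+1) f y - E (x 0%N) f y)); last first.
    by apply/funext => y; rewrite /r /p; ring.
  by apply: filterS => y ->; rewrite SE; ring.
apply: (le_trans (n2D (L2_sub Tr2 (S2 k)) (L2_sub Tp2 cp2))).
have pe := piece_exp xk (x_ge0 k); rewrite -/p -/c in pe.
have sq := sqr_n2_piece HA f2 (ltW xk); rewrite -/p in sq.
have amgm : n2m p <= e + n2m p ^+ 2 / e.
  rewrite -(@ler_pM2r _ e)// mulrDl divfK ?gt_eqF// -expr2 [leRHS]addrC.
  by apply: mul_le_sqrD.
have hE : x k.+1 - x k = h by rewrite xS; ring.
rewrite hE in pe.
have th : 0 <= t * h by rewrite mulr_ge0// ltW.
have := ler_wpM2l th amgm; rewrite sq.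
move=> hp; have h1 := lerD IH (le_trans pe hp).
rewrite [leRHS](_ : _ = t * h * (k%:R * e + (n2m (E (x k) f) ^+ 2 - n2m (E (x 0%N) f) ^+ 2) / e)
  + t * h * (e + (n2m (E (x k.+1) f) ^+ 2 - n2m (E (x k) f) ^+ 2) / e)) //.
by rewrite -natr1; ring.
Qed.

(** By orthogonality the mass of the spectral measure beyond b is
    |f|^2 - |E b f|^2. *)
Lemma spectral_tail_cvg0 (b : nat -> R) : b n @[n --> \oo] --> +oo%R ->
  n2m (fun x => E (b n) f x - f x) @[n --> \oo] --> (0 : R) /\
  n2n (fun l => 1 - halfline (b n) l) @[n --> \oo] --> (0 : R).
Proof.
move=> bn; have Ef c := E_L2 HE c f2.
have r0 : n2m (fun x => E (b n) f x - f x) @[n --> \oo] --> (0 : R).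
  have h : n2m (fun x => E c f x - f x) @[c --> +oo%R] --> (0 : R).
    by apply: cvg_n2 (resolution_pinfty HE f2); apply: nearW => c; exact: L2_sub.
  exact: (@cvg_comp _ _ _ b (fun c => n2m (fun x => E c f x - f x)) _ _ _ bn h).
split => //.
have nuT := spectral_measure_total HE f2 Hf.
have nufin := spectral_measure_fin HE f2 Hf.
have bound n : n2n (fun l => 1 - halfline (b n) l) <=
    Num.sqrt (2 * n2m f * n2m (fun x => E (b n) f x - f x)).
  rewrite [leLHS]/n2 ler_wsqrtr//.
  have -> : \int[nu]_l (normc (1 - halfline (b n) l) ^+ 2) =
      \int[nu]_l (1 - \1_(`]-oo, b n]%classic) l).
    congr Rintegral; apply/funext => l.
    have -> : \1_(`]-oo, b n]%classic) l = (l <= b n)%R%:R :> R.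
      by rewrite indicE mem_setE in_itv.
    have [lb|bl] := lerP l (b n).
      by rewrite halfline1// !subrr normc0 expr0n.
    by rewrite halfline0// !subr0 normc1 expr1n.
  have I1 : nu.-integrable setT (EFin \o cst (1 : R)).
    exact: integrable_cst.
  have I2 : nu.-integrable setT (EFin \o \1_(`]-oo, b n]%classic)).
    apply: (le_integrable _ _ _ I1) => //.
    - apply/measurable_EFinP; exact: measurable_indic.
    - by move=> l _; rewrite /= lee_fin normr1 indicE ger0_norm// lern1 leq_b1.
  rewrite RintegralB// Rintegral_cst// mul1r /Rintegral integral_indic// setIT.
  rewrite nuT (spectral_measure_halfline HE f2 Hf) /=.
  have D := n2_dist_le (Ef (b n)) f2.
  have L := n2_E_le HE (b n) f2.
  move: D; rewrite ler_norml => /andP[D _].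
  have K1 := mulr_ge0 (n2_ge0 mu f) (_ : 0 <= n2m (fun x => E (b n) f x - f x) - (n2m f - n2m (E (b n) f))).
  have {}K1 := K1 ltac:(lra).
  by have := sqr_ge0 (n2m f - n2m (E (b n) f)); lra.
apply: squeeze_cvg0 bound _ => [n|]; first exact: n2_ge0.
rewrite -[X in _ --> X](@sqrtr0 R).
apply: continuous_cvg; first exact: sqrt_continuous.
rewrite -[X in _ --> X](mulr0 (2 * n2m f)); apply: cvgM => //; exact: cvg_cst.
Qed.

(** The grid has mesh M^-4 and reaches from - M^-4, where E vanishes, up to M^2;
    the first cell catches the mass at 0. With the weight e = M^-3 the error
    h (N e + |f|^2 / e) of the operators, where h = M^-4 and N = M^6 + 1, is
    O(1 / M). Beyond M^2 the symbol is at most 1 and the semigroup contracts,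
    so that the tail of f bounds the remaining error. *)
Lemma exp_spectral_approx : spectral_approx mu E f nu (exp_symbol t) (T t f).
Proof.
have Ef c := E_L2 HE c f2.
have Tf2 := T_L2 HT t0 f2.
pose M n : R := n.+1%:R.
have M0 n : 0 < M n by rewrite ltr0n.
have M1 n : 1 <= M n by rewrite ler1n.
pose h n := (M n) ^- 4; pose N n := (n.+1 ^ 6)%N.
have h0 n : 0 < h n by rewrite invr_gt0 exprn_gt0.
pose x n (j : nat) := j%:R * h n - h n.
have xS n j : x n j.+1 = x n j + h n by rewrite /x -natr1; ring.
have x_ge0 n j : 0 <= x n j.+1.
  by rewrite xS /x subrK mulr_ge0// ltW.
have x_nd n j : x n j <= x n j.+1 by rewrite xS lerDl ltW.
have xN n : x n (N n).+1 = M n ^+ 2.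
  rewrite xS /x subrK /N /h natrX -/(M n); field.
  by rewrite gt_eqF// M0.
have x0E n : n2m (E (x n 0%N) f) = 0.
  by apply: (E_negative HT HA Hnu) => //; rewrite /x mul0r sub0r oppr_lt0.
pose s n : @step_datum R :=
  [seq ((expR (- (t * x n j.+1)))%:C, (x n j, x n j.+1)) | j <- iota 0 (N n).+1].
have ws n : step_wf (s n) by apply/allP => i /mapP[k _ ->] /=.
have bn : M n ^+ 2 @[n --> \oo] --> +oo%R.
  apply/cvgryPge => A; near=> n; apply: (@le_trans _ _ (M n)).
    apply: (@le_trans _ _ n%:R); last by rewrite /M ler_nat.
    by near: n; exact: nbhs_infty_ger.
  by rewrite expr2 ler_peMr// ltW.
have [tail1 tail2] := spectral_tail_cvg0 bn.
have Minv : (M n)^-1 @[n --> \oo] --> (0 : R) by exact: cvg_harmonic.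
exists (fun n => halflines (s n)); split.
  have bound n : n2n (fun l => exp_symbol t l - halfline_fun (halflines (s n)) l) <=
      t * n2m f * (M n)^-1 + n2n (fun l => 1 - halfline (M n ^+ 2) l).
    pose hf := halfline_fun (halflines (s n)).
    pose A l := (exp_symbol t l - hf l) * halfline (M n ^+ 2) l.
    pose B l := (exp_symbol t l - hf l) * (1 - halfline (M n ^+ 2) l).
    have mhl : cmeasurable_fun [set: measurableTypeR R] (halfline (M n ^+ 2)).
      have := @cmeasurable_halfline_fun R [:: (1, M n ^+ 2)]; congr cmeasurable_fun.
      by apply/funext => l; rewrite /halfline_fun big_cons big_nil addr0 mul1r.
    have mW : cmeasurable_fun [set: measurableTypeR R] (fun l => 1 - halfline (M n ^+ 2) l).
      by apply: cmeasurable_sub => //; exact: cmeasurable_cst.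
    have mphi : cmeasurable_fun [set: measurableTypeR R] (fun l => exp_symbol t l - hf l).
      by apply: cmeasurable_sub; [exact: cmeasurable_exp_symbol|exact: cmeasurable_halfline_fun].
    have ae_filter := ae_filter_ringOfSetsType nu.
    have ae_lower : {ae nu, forall l, x n 0%N < l}.
      exists `]-oo, x n 0%N]%classic; split => //.
        by rewrite (spectral_measure_halfline HE f2 Hf) x0E expr0n.
      by move=> l /= /negP; rewrite -leNgt in_itv.
    have th : 0 <= t * h n by rewrite mulr_ge0// ltW.
    have Abound : {ae nu, forall l, normc (A l) <= t * h n}.
      apply: filterS ae_lower => l xl; rewrite /A.
      have [lb|bl] := lerP l (M n ^+ 2); last by rewrite halfline0// mulr0 normc0.
      rewrite halfline1// mulr1 /hf halflines_fun//.
      have [|k kN [/andP[kl lk] kF]] := @grid_cell R (x n) (N n).+1 l (x_nd n) xl.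
        by rewrite xN.
      rewrite /step_fun big_map /= (kF _ (fun j => (expR (- (t * x n j.+1)))%:C)).
      rewrite /exp_symbol normc_sub_real.
      have m0 : 0 <= Num.max l 0 by rewrite le_max lexx orbT.
      apply: (le_trans (expRN_lipschitz (mulr_ge0 t0 m0) (mulr_ge0 t0 (x_ge0 n k)))).
      rewrite -mulrBr normrM (ger0_norm t0) ler_wpM2l//.
      have mk : Num.max l 0 <= x n k.+1 by rewrite ge_max lk x_ge0.
      rewrite distrC ger0_norm ?subr_ge0//.
      have lm : l <= Num.max l 0 by rewrite le_max lexx.
      by move: kl; rewrite xS; lra.
    have A2 : L2n A.
      apply: (ae_bounded_L2 (spectral_measure_fin HE f2 Hf) _ th Abound).
      exact: cmeasurable_mul.
    have W1 l : normc (1 - halfline (M n ^+ 2) l) <= 1.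
      have [lb|bl] := lerP l (M n ^+ 2); first by rewrite halfline1// subrr normc0.
      by rewrite halfline0// subr0 normc1.
    have W2 : L2n (fun l => 1 - halfline (M n ^+ 2) l).
      by apply: (ae_bounded_L2 (spectral_measure_fin HE f2 Hf) mW ler01); exact: nearW.
    have BW l : normc (B l) <= normc (1 - halfline (M n ^+ 2) l).
      rewrite /B normcM; have [lb|bl] := lerP l (M n ^+ 2).
        by rewrite halfline1// subrr normc0 mulr0.
      have S0 : step_fun (s n) l = 0.
        rewrite /step_fun big_map.
        apply: (@grid_beyond R _ (fun j => (expR (- (t * x n j.+1)))%:C) (x n) (N n).+1 l) => //.
        by rewrite xN.
      by rewrite halfline0// subr0 normc1 mulr1 /hf halflines_fun// S0 subr0 exp_symbol_le1.
    have B2 : L2n B.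
      apply: (ae_bounded_L2 (spectral_measure_fin HE f2 Hf) _ ler01).
        exact: cmeasurable_mul.
      by apply: nearW => l; exact: le_trans (BW l) (W1 l).
    have -> : (fun l => exp_symbol t l - halfline_fun (halflines (s n)) l) = (fun l => A l + B l).
      by apply/funext => l; rewrite /A /B -mulrDr addrCA subrr addr0 mulr1.
    apply: (le_trans (n2D A2 B2)); apply: lerD; last exact: n2_le.
    apply: (le_trans (n2_le_ae (spectral_measure_fin HE f2 Hf) A2 th Abound)).
    rewrite (spectral_measure_total HE f2 Hf) /= sqrtr_sqr ger0_norm ?n2_ge0//.
    rewrite mulrAC ler_wpM2l// ?mulr_ge0 ?n2_ge0//.
    rewrite lef_pV2 ?posrE ?exprn_gt0//.
    by rewrite -[leLHS]expr1 ler_weXn2l.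
  by apply: squeeze_cvg0 bound (cvg0_comb (t * n2m f) Minv tail2) => n; exact: n2_ge0.
have bound n : n2m (fun y => halfline_int E f (halflines (s n)) y - T t f y) <=
    t * (2 + n2m f ^+ 2) * (M n)^-1 + n2m (fun y => E (M n ^+ 2) f y - f y).
  pose S y := \sum_(j <- iota 0 (N n).+1)
    (expR (- (t * x n j.+1)))%:C * (E (x n j.+1) f y - E (x n j) f y).
  have -> : (fun y => halfline_int E f (halflines (s n)) y - T t f y) = (fun y => S y - T t f y).
    by apply/funext => y; rewrite -step_integral_halflines /step_integral big_map.
  pose r y := E (x n (N n).+1) f y - E (x n 0%N) f y.
  have r2 : L2 r by exact: L2_sub.
  have fr2 := L2_sub f2 r2.
  have S2 : L2 S by apply: L2_sum => i _; apply: L2_scale; exact: L2_sub.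
  have Tr2 := T_L2 HT t0 r2; have Tfr2 := T_L2 HT t0 fr2.
  have e0 : 0 < (M n) ^- 3 by rewrite invr_gt0 exprn_gt0.
  have grid := grid_exp (N n).+1 (h0 n) e0 (xS n) (x_ge0 n).
  have -> : n2m (fun y => S y - T t f y) = n2m (fun y => (S y - T t r y) - T t (fun y => f y - r y) y).
    apply: n2_ae.
    - exact: L2_sub.
    - by apply: L2_sub => //; exact: L2_sub.
    have := T_add HT t0 r2 fr2.
    rewrite (_ : (fun y => r y + (f y - r y)) = f); last by apply/funext => y; ring.
    by apply: filterS => y ->; ring.
  apply: (le_trans (n2B (L2_sub S2 Tr2) Tfr2)); apply: lerD.
    rewrite n2_distC; apply: (le_trans grid).
    have F1 : n2m (E (x n (N n).+1) f) ^+ 2 <= n2m f ^+ 2.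
      by rewrite ler_pXn2r ?nnegrE ?n2_ge0// n2_E_le.
    rewrite x0E expr0n subr0; move: F1; set G := _ ^+ 2; set F := _ ^+ 2 => F1.
    have Mn := M0 n; have M1n := M1 n.
    rewrite -[leLHS]mulrA -[leRHS]mulrA ler_wpM2l// mulrDr [leRHS]mulrDl; apply: lerD.
      have -> : h n * ((N n).+1%:R * M n ^- 3) = (M n)^-1 + M n ^- 7.
        by rewrite /h /N -natr1 natrX -/(M n); field; rewrite gt_eqF.
      rewrite [2 * _]mulr_natl mulr2n lerD2l.
      rewrite lef_pV2 ?posrE ?exprn_gt0//.
      by rewrite -[leLHS]expr1 ler_weXn2l.
    have -> : h n * (G / M n ^- 3) = G / M n.
      by rewrite /h; field; rewrite gt_eqF.
    by rewrite ler_wpM2r// invr_ge0 ltW.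
  apply: (le_trans (T_n2_le HT t0 fr2)).
  have -> : (fun y => f y - r y) = (fun y => E (x n 0%N) f y - (E (M n ^+ 2) f y - f y)).
    by apply/funext => y; rewrite /r xN; ring.
  apply: (le_trans (n2B (Ef _) (L2_sub (Ef _) f2))).
  by rewrite x0E add0r.
by apply: squeeze_cvg0 bound (cvg0_comb _ Minv tail1) => n; exact: n2_ge0.
Unshelve. all: by end_near. Qed.

End ExponentialApproximation.

(** * Laplace transforms and step symbols *)

Section LaplaceTransform.
Context {R : realType}.
Local Notation leb := (@lebesgue_measure R).
Implicit Types (a b l h t : R).

(** The derivative in t of - exp(- t l); it has integral 1 over the positive
    half-line. *)
Definition decay l t : R := l * expR (- (t * l)).

Lemma decay_ge0 l t : 0 < l -> 0 <= decay l t.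
Proof. by move=> l0; rewrite mulr_ge0 ?expR_ge0// ltW. Qed.

Lemma measurable_decay (D : set (measurableTypeR R)) l : measurable_fun D (decay l).
Proof.
apply: measurable_funM; first exact: measurable_cst.
apply: measurableT_comp => //; apply: measurableT_comp => //.
by apply: measurable_funM; [exact: measurable_id|exact: measurable_cst].
Qed.

Lemma integral_decay_ray l a : 0 < l ->
  (\int[leb]_(t in `]a, +oo[) (decay l t)%:E = (expR (- (a * l)))%:E)%E.
Proof.
move=> l0.
have dF (x : R) : is_derive x 1 (fun t => - expR (- (t * l))) (decay l x).
  by apply: is_derive_eq; rewrite /decay /GRing.scale /=; ring.
have cF : continuous (fun t => - expR (- (t * l))).
  by move=> x; apply: differentiable_continuous; apply/derivable1_diffP; case: (dF x).
have cdecay : continuous (decay l).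
  move=> x; apply: differentiable_continuous; apply/derivable1_diffP.
  rewrite /decay.
  have D : is_derive x 1 (fun t => l * expR (- (t * l))) (- l * l * expR (- (x * l))).
    by apply: is_derive_eq; rewrite /GRing.scale /=; ring.
  by case: D.
rewrite integral_itv_obnd_cbnd; last first.
  by apply/measurable_EFinP; exact: measurable_decay.
rewrite (@ge0_continuous_FTC2y _ (decay l) (fun t => - expR (- (t * l))) a 0).
- by rewrite -EFinB sub0r opprK.
- by move=> x _; exact: decay_ge0.
- exact: continuous_subspaceT.
- rewrite -[X in _ --> X]oppr0; apply: cvgN.
  apply: (@cvg_comp _ _ _ (fun t => t * l) (fun x => expR (- x)) _ +oo%R).
    exact: gt0_cvgMly.
  exact: cvgr_expR.
- by move=> x _; case: (dF x).
- by apply: cvg_at_right_filter; exact: cF.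
- by move=> x _; rewrite derive1E; case: (dF x).
Qed.

Lemma integrable_decay_ray l a : 0 < l ->
  leb.-integrable `]a, +oo[ (EFin \o decay l).
Proof.
move=> l0; apply/integrableP; split.
  by apply/measurable_EFinP; exact: measurable_decay.
under eq_integral do rewrite /= ger0_norm ?decay_ge0//.
by rewrite integral_decay_ray// ltry.
Qed.

Lemma measurable_ray (i : interval R) : measurable ([set` i] : set (measurableTypeR R)).
Proof. exact: measurable_itv. Qed.

Lemma integrable_scale_decay_ray (c : R) l a : 0 < l ->
  leb.-integrable `]a, +oo[ (EFin \o (fun t => c * decay l t)).
Proof.
move=> l0; have := integrableZl (measurable_ray `]a, +oo[) c (integrable_decay_ray a l0).
by apply: eq_integrable => //; exact: measurable_ray.
Qed.

Lemma Rintegral_decay_ray l a : 0 < l ->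
  \int[leb]_(t in `]a, +oo[) decay l t = expR (- (a * l)).
Proof. by move=> l0; rewrite /Rintegral integral_decay_ray. Qed.

Lemma ray_split a b : a <= b -> `]a, +oo[%classic = `]a, b]%classic `|` `]b, +oo[%classic :> set R.
Proof.
move=> ab; apply/seteqP; split => t /=; rewrite !in_itv/= !andbT.
  by move=> at_; have [tb|bt] := lerP t b; [left; rewrite at_|right].
by move=> [/andP[]//|]; exact: le_lt_trans.
Qed.

Lemma itv_split a b c : a <= b -> b <= c ->
  `]a, c]%classic = `]a, b]%classic `|` `]b, c]%classic :> set R.
Proof.
move=> ab bc; apply/seteqP; split => t /=; rewrite !in_itv/=.
  by move=> /andP[at_ tc]; have [tb|bt] := lerP t b; [left; rewrite at_|right].
by move=> [/andP[-> tb]|/andP[bt ->]]; rewrite ?(le_trans tb bc)// (le_lt_trans ab bt).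
Qed.

Lemma disj_ray a b : [disjoint `]a, b]%classic & `]b, +oo[%classic : set R].
Proof.
apply/disj_setPS => t /=; rewrite !in_itv/= andbT => -[/andP[_ tb] bt].
by move: (le_lt_trans tb bt); rewrite ltxx.
Qed.

Lemma disj_itv a b c : [disjoint `]a, b]%classic & `]b, c]%classic : set R].
Proof.
apply/disj_setPS => t /=; rewrite !in_itv/= => -[/andP[_ tb] /andP[bt _]].
by move: (le_lt_trans tb bt); rewrite ltxx.
Qed.

Lemma cintegral_setU (A B : set (measurableTypeR R)) (F : R -> R[i]) :
  measurable A -> measurable B -> cintegrable leb (A `|` B) F -> [disjoint A & B] ->
  cintegral leb (A `|` B) F = cintegral leb A F + cintegral leb B F.
Proof.
move=> mA mB IF dAB; have mAB : measurable (A `|` B) by exact: measurableU.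
have I1 := cintegrable_Re mAB IF; have I2 := cintegrable_Im mAB IF.
by rewrite /cintegral; apply: complex_ext => /=; rewrite Rintegral_setU.
Qed.

Lemma cintegrable_subset (A B : set (measurableTypeR R)) (F : R -> R[i]) :
  measurable A -> measurable B -> A `<=` B -> cintegrable leb B F -> cintegrable leb A F.
Proof.
move=> mA mB AB [[F1 F2] IF]; split.
  by split; [exact: measurable_funS F1|exact: measurable_funS F2].
exact: integrableS IF.
Qed.

Variable M : R -> R[i].
Hypothesis HM : bounded_borel_on_pos M.
Local Notation K := (sup_norm M).

Lemma integrable_cst_itv a b (c : R) : leb.-integrable `]a, b] (EFin \o cst c).
Proof.
apply: integrable_cst; first exact: measurable_ray.
rewrite /= lebesgue_measure_itv/=.
by case: ifPn => _; rewrite ?ltry// -EFinB ltry.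
Qed.

Lemma le_sup_norm t : 0 < t -> normc (M t) <= K.
Proof.
move=> t0; apply: ub_le_sup; first exact: HM.2.
by exists t => //=; rewrite in_itv/= t0.
Qed.

Lemma sup_norm_ge0 : 0 <= K.
Proof. exact: le_trans (normc_ge0 _) (le_sup_norm ltr01). Qed.

Definition interval_mean (a b : R) : R[i] := ((b - a)^-1)%:C * cintegral leb `]a, b] M.

Lemma cmeasurable_M_itv a b : 0 <= a -> cmeasurable_fun `]a, b]%classic M.
Proof.
move=> a0; have [[m1 m2] _] := HM.
have sub : `]a, b]%classic `<=` `]0, +oo[%classic.
  by move=> t /=; rewrite !in_itv/= andbT => /andP[/(le_lt_trans a0)].
by split; [exact: measurable_funS m1|exact: measurable_funS m2].
Qed.

Lemma cintegrable_M_itv a b : 0 <= a -> cintegrable leb `]a, b]%classic M.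
Proof.
move=> a0; apply: (cintegrable_le (h := fun=> K)) => //.
- exact: cmeasurable_M_itv.
- exact: integrable_cst_itv.
- move=> t /=; rewrite in_itv/= => /andP[at_ _]; apply: le_sup_norm.
  exact: le_lt_trans at_.
Qed.

Lemma normc_interval_mean a b : 0 <= a -> a < b -> normc (interval_mean a b) <= K.
Proof.
move=> a0 ab; have ba : 0 < b - a by rewrite subr_gt0.
rewrite normc_scale gtr0_norm ?invr_gt0// mulrC ler_pdivrMr//.
have IM := cintegrable_M_itv b a0.
apply: (le_trans (le_normc_cintegral _ IM)) => //.
apply: (@le_trans _ _ (\int[leb]_(t in `]a, b]) cst K t)).
  apply: le_Rintegral => //; [by case: IM|exact: integrable_cst_itv|].
  move=> t /=; rewrite in_itv/= => /andP[at_ _]; apply: le_sup_norm.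
  exact: le_lt_trans at_.
rewrite Rintegral_cst//= lebesgue_measure_itv/= lte_fin ab.
by rewrite -EFinB /= lexx.
Qed.

(** Both the decay function on ]a, b] and its mean lie between l exp(- b l)
    and l exp(- a l). *)
Lemma decay_mean_bound l a b t : 0 < l -> a < t -> t <= b ->
  `|decay l t - (expR (- (a * l)) - expR (- (b * l))) / (b - a)|
    <= l * (expR (- (a * l)) - expR (- (b * l))).
Proof.
move=> l0 at_ tb; have ab := lt_le_trans at_ tb; have ba : 0 < b - a by rewrite subr_gt0.
set A := expR (- (a * l)); set B := expR (- (b * l)).
have AB : A = B * expR ((b - a) * l) by rewrite /A /B -expRD; congr expR; ring.
have BA : B = A * expR (- ((b - a) * l)) by rewrite /A /B -expRD; congr expR; ring.
have h1 := expR_ge1Dx ((b - a) * l).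
have h2 := expR_ge1Dx (- ((b - a) * l)).
have A0 : 0 < A by exact: expR_gt0.
have B0 : 0 < B by exact: expR_gt0.
have u1 : B * l <= (A - B) / (b - a).
  rewrite ler_pdivlMr// AB; have := ler_wpM2l (ltW B0) h1; lra.
have u2 : (A - B) / (b - a) <= A * l.
  rewrite ler_pdivrMr// BA; have := ler_wpM2l (ltW A0) h2; lra.
have v1 : l * B <= decay l t by rewrite /decay ler_pM2l// ler_expR lerN2 ler_pM2r.
have v2 : decay l t <= l * A by rewrite /decay ler_pM2l// ler_expR lerN2 ler_pM2r// ltW.
rewrite ler_norml; lra.
Qed.

Lemma cintegrable_M_decay (D : set (measurableTypeR R)) l : 0 < l -> measurable D ->
  D `<=` `]0, +oo[%classic -> cintegrable leb D (fun t => M t * (decay l t)%:C).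
Proof.
move=> l0 mD D0.
apply: (@cintegrable_subset _ `]0, +oo[%classic) => //.
refine (@cintegrable_le _ (measurableTypeR R) R leb _ _ (fun t => K * decay l t) _ _ _ _) => //.
- apply: cmeasurable_mul; first exact: HM.1.
  by apply: cmeasurable_real; exact: measurable_decay.
- exact: integrable_scale_decay_ray.
- move=> t /=; rewrite in_itv/= andbT => t0.
  rewrite normcM normc_real ger0_norm ?decay_ge0// ler_wpM2r ?decay_ge0//.
  exact: le_sup_norm.
Qed.

Lemma itv_pos a b : 0 <= a -> `]a, b]%classic `<=` (`]0, +oo[%classic : set R).
Proof. by move=> a0 t /=; rewrite !in_itv/= andbT => /andP[/(le_lt_trans a0)]. Qed.

Lemma ray_pos a : 0 <= a -> `]a, +oo[%classic `<=` (`]0, +oo[%classic : set R).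
Proof. by move=> a0 t /=; rewrite !in_itv/= !andbT => /(le_lt_trans a0). Qed.

(** Only the oscillation of the decay function matters, so M may be replaced by
    its mean over the cell. The errors telescope when they are summed over
    consecutive cells. *)
Lemma cell_error l a b : 0 < l -> 0 <= a -> a < b ->
  normc (cintegral leb `]a, b] (fun t => M t * (decay l t)%:C)
         - interval_mean a b * (expR (- (a * l)) - expR (- (b * l)))%:C)
  <= K * (b - a) * l * (expR (- (a * l)) - expR (- (b * l))).
Proof.
move=> l0 a0 ab; set D := expR (- (a * l)) - expR (- (b * l)).
have ba : 0 < b - a by rewrite subr_gt0.
have IM := cintegrable_M_itv b a0.
have ID := cintegrable_M_decay l0 (measurable_ray `]a, b]) (@itv_pos a b a0).
have D0 : 0 <= D.
  by rewrite subr_ge0 ler_expR lerN2 ler_pM2r// ltW.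
pose k t := decay l t - D / (b - a).
have kD t : a < t -> t <= b -> `|k t| <= l * D by exact: decay_mean_bound.
have mk : measurable_fun `]a, b]%classic (k : measurableTypeR R -> R).
  by apply: measurable_funB; [exact: measurable_decay|exact: measurable_cst].
have IKD := integrable_cst_itv a b (K * (l * D)).
have bnd t : `]a, b]%classic t -> normc (M t * (k t)%:C) <= K * (l * D).
  rewrite /= in_itv/= => /andP[at_ tb]; rewrite normcM normc_real.
  apply: ler_pM => //; [exact: normc_ge0| |exact: kD].
  by apply: le_sup_norm; exact: le_lt_trans at_.
have Ik : cintegrable leb `]a, b]%classic (fun t => M t * (k t)%:C).
  apply: (cintegrable_le (h := cst (K * (l * D)))) => //.
  by apply: cmeasurable_mul; [exact: cmeasurable_M_itv|exact: cmeasurable_real].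
have -> : cintegral leb `]a, b] (fun t => M t * (decay l t)%:C) - interval_mean a b * D%:C =
    cintegral leb `]a, b] (fun t => M t * (k t)%:C).
  rewrite (_ : (fun t => M t * (decay l t)%:C) = (fun t => M t * (k t)%:C + (D / (b - a))%:C * M t)).
    rewrite cintegral_add ?cintegral_scale//; last exact: cintegrable_scale.
    by rewrite /interval_mean rmorphM; ring.
  apply/funext => t; rewrite /k rmorphB; ring.
apply: (le_trans (le_normc_cintegral _ Ik)) => //.
apply: (@le_trans _ _ (\int[leb]_(t in `]a, b]) cst (K * (l * D)) t)).
  by apply: le_Rintegral => //; case: Ik.
rewrite Rintegral_cst//= lebesgue_measure_itv/= lte_fin ab -EFinB /=.
by apply: ler_of_eq; ring.
Qed.

Definition step_symbol (h : R) (N : nat) l : R[i] :=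
  \sum_(j <- iota 0 N) interval_mean (j%:R * h) (j.+1%:R * h)
     * (exp_symbol (j.+1%:R * h) l - exp_symbol (j%:R * h) l).

Lemma exp_symbol_pos l t : 0 < l -> exp_symbol t l = (expR (- (t * l)))%:C.
Proof. by move=> l0; rewrite /exp_symbol max_l// ltW. Qed.

Lemma exp_symbol_neg l t : l <= 0 -> exp_symbol t l = 1.
Proof. by move=> l0; rewrite /exp_symbol max_r// mulr0 oppr0 expR0. Qed.

Lemma laplace_decay l : 0 < l -> laplace_multiplier M l =
  - cintegral leb `]0, +oo[ (fun t => M t * (decay l t)%:C).
Proof.
move=> l0; rewrite /laplace_multiplier l0; congr (- _).
have li : l%:C != 0 :> R[i] by rewrite eq_complex /= gt_eqF.
have ID := cintegrable_M_decay l0 (measurable_ray `]0, +oo[) (@subset_refl _ _).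
have E : (fun t => M t * (expR (- (t * l)))%:C) = (fun t => (l%:C)^-1 * (M t * (decay l t)%:C)).
  by apply/funext => t; rewrite /decay rmorphM; field.
by rewrite E cintegral_scale// mulrA mulfV// mul1r.
Qed.

(** The first term collects the errors of the cells, the second one is the tail
    of the integral beyond N h. *)
Lemma laplace_step_error (h : R) (N : nat) l : 0 < h -> 0 < l ->
  normc (laplace_multiplier M l - step_symbol h N l) <= K * (h * l) + K * expR (- (N%:R * h * l)).
Proof.
move=> h0 l0; pose F t := M t * (decay l t)%:C.
have jh (j : nat) : 0 <= j%:R * h by rewrite mulr_ge0// ltW.
have jS (j : nat) : j%:R * h < j.+1%:R * h by rewrite ltr_pM2r// ltr_nat.
have IF (D : set (measurableTypeR R)) : measurable D -> D `<=` `]0, +oo[%classic -> cintegrable leb D F.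
  by move=> mD D0; exact: cintegrable_M_decay.
have J k : normc (cintegral leb `]0, (k%:R * h)] F + step_symbol h k l)
    <= K * (h * l) * (1 - expR (- (k%:R * h * l))).
  elim: k => [|k IH].
    rewrite mul0r mul0r oppr0 expR0 subrr mulr0 /step_symbol big_nil addr0.
    by rewrite set_itvoc0 /cintegral !Rintegral_set0 normc0.
  rewrite (itv_split (jh k) (ltW (jS k))) cintegral_setU//; last 2 first.
  - rewrite -(itv_split (jh k) (ltW (jS k))); apply: IF; [exact: measurable_ray|exact: itv_pos].
  - exact: disj_itv.
  rewrite /step_symbol big_iotaS.
  rewrite -/(step_symbol h k l) addrACA; apply: (le_trans (le_normc_add _ _)).
  have C := cell_error l0 (jh k) (jS k); rewrite -/F in C.
  rewrite !exp_symbol_pos//.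
  have -> : interval_mean (k%:R * h) (k.+1%:R * h) *
     ((expR (- (k.+1%:R * h * l)))%:C - (expR (- (k%:R * h * l)))%:C) =
     - (interval_mean (k%:R * h) (k.+1%:R * h) *
      (expR (- (k%:R * h * l)) - expR (- (k.+1%:R * h * l)))%:C).
    by rewrite rmorphB; ring.
  have hE : k.+1%:R * h - k%:R * h = h by rewrite -natr1; ring.
  rewrite hE in C; lra.
rewrite laplace_decay// -/F.
rewrite (ray_split (jh N)) cintegral_setU//; last 2 first.
- by rewrite -ray_split//; apply: IF => //; exact: measurable_ray.
- exact: disj_ray.
have J_N := J N.
set A := cintegral leb `]0, _] F in J_N *; set B := cintegral leb `]_, +oo[ F.
rewrite (_ : - (A + B) - step_symbol h N l = - ((A + step_symbol h N l) + B)); last by ring.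
rewrite normc_opp.
apply: (le_trans (le_normc_add _ _)); apply: lerD.
  apply: (le_trans J_N); apply: ler_piMr; last by rewrite gerBl expR_ge0.
  by rewrite mulr_ge0 ?sup_norm_ge0// mulr_ge0// ltW.
have IR := IF _ (measurable_ray `](N%:R * h), +oo[) (ray_pos (jh N)).
apply: (le_trans (le_normc_cintegral _ IR)) => //.
rewrite -Rintegral_decay_ray// -RintegralZl//; last exact: integrable_decay_ray.
apply: le_Rintegral => //; first by case: IR.
  exact: integrable_scale_decay_ray.
move=> t /=; rewrite in_itv/= andbT => t0.
rewrite normcM normc_real ger0_norm ?decay_ge0// ler_wpM2r ?decay_ge0//.
by apply: le_sup_norm; exact: le_lt_trans t0.
Qed.

Lemma normc_laplace_multiplier l : normc (laplace_multiplier M l) <= K.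
Proof.
have [l0|l0] := lerP l 0.
  by rewrite /laplace_multiplier ltNge l0 normc0 sup_norm_ge0.
rewrite laplace_decay// normc_opp.
have ID := cintegrable_M_decay l0 (measurable_ray `]0, +oo[) (@subset_refl _ _).
apply: (le_trans (le_normc_cintegral _ ID)) => //.
apply: (@le_trans _ _ (K * \int[leb]_(t in `]0, +oo[) decay l t)); last first.
  by rewrite Rintegral_decay_ray// mul0r oppr0 expR0 mulr1.
rewrite -RintegralZl//; last exact: integrable_decay_ray.
apply: le_Rintegral => //; first by case: ID.
  exact: integrable_scale_decay_ray.
move=> t /=; rewrite in_itv/= andbT => t0.
rewrite normcM normc_real ger0_norm ?decay_ge0// ler_wpM2r ?decay_ge0//.
exact: le_sup_norm.
Qed.

Lemma normc_step_symbol h N l : 0 < h -> normc (step_symbol h N l) <= K.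
Proof.
move=> h0; have [l0|l0] := lerP l 0.
  rewrite /step_symbol big1 ?normc0 ?sup_norm_ge0// => j _.
  by rewrite !exp_symbol_neg// subrr mulr0.
have jh (j : nat) : 0 <= j%:R * h by rewrite mulr_ge0// ltW.
have jS (j : nat) : j%:R * h < j.+1%:R * h by rewrite ltr_pM2r// ltr_nat.
suff : normc (step_symbol h N l) <= K * (1 - expR (- (N%:R * h * l))).
  move/le_trans; apply; apply: ler_piMr; first exact: sup_norm_ge0.
  by rewrite gerBl expR_ge0.
elim: N => [|k IH].
  by rewrite /step_symbol big_nil normc0 mulr_ge0 ?sup_norm_ge0// !mul0r oppr0 expR0 subrr.
rewrite /step_symbol big_iotaS.
rewrite -/(step_symbol h k l); apply: (le_trans (le_normc_add _ _)).
rewrite !exp_symbol_pos// normcM normc_sub_real.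
have D0 : 0 <= expR (- (k%:R * h * l)) - expR (- (k.+1%:R * h * l)).
  by rewrite subr_ge0 ler_expR lerN2 ler_pM2r// ltW.
rewrite distrC ger0_norm//.
have := ler_wpM2r D0 (normc_interval_mean (jh k) (jS k)).
lra.
Qed.

Lemma cmeasurable_step_symbol h N : cmeasurable_fun [set: measurableTypeR R] (step_symbol h N).
Proof.
apply: cmeasurable_sum => j _; apply: cmeasurable_scale.
by apply: cmeasurable_sub; exact: cmeasurable_exp_symbol.
Qed.

End LaplaceTransform.

(** * The multiplier as a limit of step operators *)

Section StepOperators.
Context {d : measure_display} {X : measurableType d} {R : realType}.
Variable mu : {measure set X -> \bar R}.
Variable T : R -> (X -> R[i]) -> (X -> R[i]).
Hypothesis HT : symmetric_markovian_semigroup mu T.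
Variable E : R -> (X -> R[i]) -> (X -> R[i]).
Hypothesis HA : resolution_of_operator mu E (generator mu T).
Variable M : R -> R[i].
Hypothesis HM : bounded_borel_on_pos M.
Variable Tm : (X -> R[i]) -> (X -> R[i]).
Hypothesis HTm : spectral_operator mu E (laplace_multiplier M) Tm.
Implicit Types f g : X -> R[i].
Local Notation L2 := (cLp mu 2%:E).
Local Notation n2m := (n2 mu).
Local Notation K := (sup_norm M).
Let HE := HA.1.

Lemma spectral_integral_approx phi f u : spectral_integral mu E phi f u ->
  exists nu : {measure set (measurableTypeR R) -> \bar R},
    [/\ spectral_measure mu E f nu, cLp nu 2%:E phi & spectral_approx mu E f nu phi u].
Proof.
move=> [f2 u2 mphi [nu [s [Hf ws c1 c2]]]]; exists nu.
have stepH n : (fun l => phi l - step_fun (s n) l) = (fun l => phi l - halfline_fun (halflines (s n)) l).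
  by apply/funext => l; rewrite halflines_fun.
have stepI n : (fun x => step_integral E (s n) f x - u x) = (fun x => halfline_int E f (halflines (s n)) x - u x).
  by apply/funext => x; rewrite step_integral_halflines.
have hL n := halfline_fun_L2 HE f2 Hf (halflines (s n)).
have phi2 : cLp nu 2%:E phi.
  have : \forall n \near \oo, cLp nu 2%:E (fun l => phi l - step_fun (s n) l).
    apply: L2_near c1 => n; rewrite stepH; apply: cmeasurable_sub => //.
    exact: cmeasurable_halfline_fun.
  move=> [n _ /(_ n (leqnn n))]; rewrite stepH => h.
  by have := L2_add h (hL n); under eq_fun do rewrite subrK.
split => //; exists (fun n => halflines (s n)); split.
  have : n2 nu (fun l => phi l - step_fun (s n) l) @[n --> \oo] --> (0 : R).
    by apply: cvg_n2 c1; apply: nearW => n; rewrite stepH; exact: L2_sub.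
  by under eq_fun do rewrite stepH.
have : n2m (fun x => step_integral E (s n) f x - u x) @[n --> \oo] --> (0 : R).
  apply: cvg_n2 c2; apply: nearW => n; rewrite stepI; apply: L2_sub => //.
  exact: halfline_int_L2.
by under eq_fun do rewrite stepI.
Qed.

Lemma spectral_measure_exists f : L2 f ->
  exists nu : {measure set (measurableTypeR R) -> \bar R}, spectral_measure mu E f nu.
Proof. by move=> /HTm /spectral_integral_approx[nu [? _ _]]; exists nu. Qed.

Definition step_operator (h : R) (N : nat) f (x : X) : R[i] :=
  \sum_(j <- iota 0 N) interval_mean M (j%:R * h) (j.+1%:R * h)
     * (T (j.+1%:R * h) f x - T (j%:R * h) f x).

Lemma step_operator_L2 h N f : 0 < h -> L2 f -> L2 (step_operator h N f).
Proof.
move=> h0 f2; apply: L2_sum => j _; apply: L2_scale.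
have jh (k : nat) : 0 <= k%:R * h by rewrite mulr_ge0// ltW.
by apply: L2_sub; exact: (T_L2 HT).
Qed.

(** The pieces of the step operator are differences of exponentials of the
    generator. *)
Lemma step_operator_approx h N f (nu : {measure set (measurableTypeR R) -> \bar R}) :
  0 < h -> L2 f -> spectral_measure mu E f nu ->
  spectral_approx mu E f nu (step_symbol M h N) (step_operator h N f).
Proof.
move=> h0 f2 Hf; have jh (k : nat) : 0 <= k%:R * h by rewrite mulr_ge0// ltW.
have nufin := spectral_measure_fin HE f2 Hf.
have T2 (k : nat) := T_L2 HT (jh k) f2.
have e2 (k : nat) : cLp nu 2%:E (exp_symbol (k%:R * h)).
  apply: (ae_bounded_L2 nufin (cmeasurable_exp_symbol _) ler01).
  by apply: nearW => l; exact: exp_symbol_le1.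
have ea (k : nat) := exp_spectral_approx HT HA spectral_measure_exists f2 Hf (jh k).
have d2 (k : nat) : cLp nu 2%:E (fun l => exp_symbol (k.+1%:R * h) l - exp_symbol (k%:R * h) l).
  exact: L2_sub.
have da (k : nat) : spectral_approx mu E f nu (fun l => exp_symbol (k.+1%:R * h) l - exp_symbol (k%:R * h) l)
    (fun x => T (k.+1%:R * h) f x - T (k%:R * h) f x).
  exact: (spectral_approx_sub HE f2 Hf (e2 k.+1) (e2 k) (T2 k.+1) (T2 k) (ea k.+1) (ea k)).
elim: N => [|N IH].
  exists (fun _ => [::]); split.
    rewrite (_ : (fun n => _) = cst 0); first exact: cvg_cst.
    apply/funext => n; rewrite -[RHS](n2_0 nu); congr n2; apply/funext => l.
    by rewrite /step_symbol /halfline_fun !big_nil subrr.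
  rewrite (_ : (fun n => _) = cst 0); first exact: cvg_cst.
  apply/funext => n; rewrite -[RHS](n2_0 mu); congr n2; apply/funext => l.
  by rewrite /step_operator /halfline_int !big_nil subrr.
have s2 : cLp nu 2%:E (step_symbol M h N).
  apply: (ae_bounded_L2 nufin (cmeasurable_step_symbol M h N) (sup_norm_ge0 HM)).
  by apply: nearW => l; exact: normc_step_symbol.
have := spectral_approx_comb HE f2 Hf (interval_mean M (N%:R * h) (N.+1%:R * h))
  (d2 N) s2 (L2_sub (T2 N.+1) (T2 N)) (step_operator_L2 N h0 f2) (da N) IH.
have rec (F : nat -> R[i]) : F N + \sum_(j <- iota 0 N) F j = \sum_(j <- iota 0 N.+1) F j.
  by rewrite big_iotaS addrC.
rewrite (_ : (fun l => _ * (exp_symbol _ l - _) + _) = step_symbol M h N.+1); last first.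
  by apply/funext => l; exact: rec.
rewrite (_ : (fun x => _ * (T _ f x - _) + _) = step_operator h N.+1 f)//.
by apply/funext => x; exact: rec.
Qed.

(** By the isometry the error is the L^2 norm of the difference of the symbols
    in the finite spectral measure. These are uniformly bounded, and with mesh
    1 / n and n^2 cells they converge pointwise, so dominated convergence
    applies. *)
Lemma multiplier_step_limit f : L2 f ->
  n2m (fun x => Tm f x - step_operator (n.+1%:R^-1) (n.+1 ^ 2) f x) @[n --> \oo] --> (0 : R).
Proof.
move=> f2; have [nu [Hf m2 ma]] := spectral_integral_approx (HTm f2).
have [_ Tm2 _ _] := HTm f2.
have nufin := spectral_measure_fin HE f2 Hf.
pose h n : R := n.+1%:R^-1; pose N n := (n.+1 ^ 2)%N.
have h0 n : 0 < h n by rewrite invr_gt0.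
have K0 : 0 <= K := sup_norm_ge0 HM.
have s2 n : cLp nu 2%:E (step_symbol M (h n) (N n)).
  apply: (ae_bounded_L2 nufin (cmeasurable_step_symbol M _ _) K0).
  by apply: nearW => l; exact: normc_step_symbol.
have eqn n : n2m (fun x => Tm f x - step_operator (h n) (N n) f x) =
    n2 nu (fun l => laplace_multiplier M l - step_symbol M (h n) (N n) l).
  have S2 := step_operator_L2 (N n) (h0 n) f2.
  have := spectral_approx_sub HE f2 Hf m2 (s2 n) Tm2 S2 ma
    (step_operator_approx (N n) (h0 n) f2 Hf).
  by apply: spectral_approx_isometry => //; exact: L2_sub.
under eq_fun do rewrite eqn.
pose D n l := laplace_multiplier M l - step_symbol M (h n) (N n) l.
have D2K n l : normc (D n l) <= 2 * K.
  rewrite (le_trans (le_normc_add _ _))// normc_opp.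
  have := normc_laplace_multiplier HM l; have := normc_step_symbol HM (N n) l (h0 n); lra.
have Dlim l : normc (D n l) @[n --> \oo] --> (0 : R).
  have [l0|l0] := lerP l 0.
    rewrite (_ : (fun n => _) = cst 0); first exact: cvg_cst.
    apply/funext => n; rewrite /D /laplace_multiplier ltNge l0 sub0r normc_opp.
    rewrite /step_symbol big1 ?normc0// => j _.
    by rewrite !exp_symbol_neg// subrr mulr0.
  have bound n : normc (D n l) <= K * l * (n.+1%:R^-1) + K * (1 / l) * (n.+1%:R^-1).
    apply: (le_trans (laplace_step_error HM (N n) (h0 n) l0)); apply: lerD.
      by rewrite /h -mulrA [n.+1%:R^-1 * l]mulrC.
    rewrite -[leRHS]mulrA ler_wpM2l//.
    have n0 : 0 < n.+1%:R :> R by [].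
    have -> : (N n)%:R * h n = n.+1%:R :> R.
      by rewrite /N /h natrX; field; rewrite gt_eqF.
    have x0 : 0 < n.+1%:R * l by rewrite mulr_gt0.
    have -> : 1 / l / n.+1%:R = (n.+1%:R * l)^-1 by rewrite invfM mul1r mulrC.
    rewrite expRN lef_pV2 ?posrE ?expR_gt0//.
    by apply: le_trans (expR_ge1Dx _); rewrite lerDr.
  have z : (n.+1%:R^-1 : R) @[n --> \oo] --> (0 : R) by exact: cvg_harmonic.
  have z2 : K * (1 / l) * (n.+1%:R^-1) @[n --> \oo] --> (0 : R).
    by rewrite -[X in _ --> X](mulr0 (K * (1 / l))); apply: cvgM => //; exact: cvg_cst.
  by apply: squeeze_cvg0 bound (cvg0_comb _ z z2) => n; exact: normc_ge0.
have D2 n : cLp nu 2%:E (D n) by exact: L2_sub.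
apply: (dominated_cvg_n2 (h := cst ((2 * K) ^+ 2)) D2 _ _ Dlim).
  exact: integrable_cst.
by move=> n l; rewrite ler_pXn2r ?nnegrE ?normc_ge0 ?mulr_ge0.
Qed.

End StepOperators.

(** * Positivity and contractivity *)

Section BoundedIntegrable.
Context {d : measure_display} {X : measurableType d} {R : realType}.
Variable mu : {measure set X -> \bar R}.
Implicit Types (f g : X -> R[i]) (c k : R).
Local Notation L2 := (cLp mu 2%:E).

(** Functions in every L^p, for which all integrals below are finite. *)
Definition bounded_integrable f : Prop :=
  cintegrable mu setT f /\ exists c, {ae mu, forall x, normc (f x) <= c}.

Lemma bounded_integrable_powR f (p : R) : 1 <= p -> bounded_integrable f ->
  mu.-integrable setT (fun x => (normc (f x) `^ p)%:E).
Proof.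
move=> p1 [[mf If] [c fc]].
have mfp : measurable_fun setT (fun x => (normc (f x) `^ p)%:E).
  apply/measurable_EFinP; apply: (@measurableT_comp _ _ _ _ _ _ (@powR R ^~ p)) => //.
  exact: measurable_normc.
apply/integrableP; split => //.
under eq_integral do rewrite gee0_abs ?lee_fin ?powR_ge0//.
have Ic := integrableZl measurableT (`|c| `^ (p - 1)) If.
apply: (@le_lt_trans _ _ (\int[mu]_x ((`|c| `^ (p - 1))%:E * (normc (f x))%:E))%E); last first.
  have := integrable_lty measurableT Ic; rewrite /=.
  by [].
apply: ae_ge0_le_integral => //.
- by move=> x _; rewrite lee_fin powR_ge0.
- by move=> x _; rewrite -EFinM lee_fin mulr_ge0 ?powR_ge0 ?normc_ge0.
- by case/integrableP : Ic.
apply: filterS fc => x fx _; rewrite -EFinM lee_fin.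
rewrite -(mulr_powRB1 (normc_ge0 (f x))) ?(lt_le_trans ltr01)// mulrC ler_wpM2r ?normc_ge0//.
by rewrite ler_powRl ?subr_ge0 ?normc_ge0// (le_trans fx)// ler_norm.
Qed.

Lemma bounded_integrable_L2 f : bounded_integrable f -> L2 f.
Proof.
move=> bf; apply/cLpP => //; split; first by case: bf => [[]].
by apply: bounded_integrable_powR => //; rewrite ler1n.
Qed.

Lemma cLnorm1E f : cLnorm mu 1%:E f = (\int[mu]_x (normc (f x))%:E)%E.
Proof.
rewrite /cLnorm Lnorm1; apply: eq_integral => x _.
by rewrite gee0_abs// lee_fin normc_ge0.
Qed.

Lemma cLp1P f : cLp mu 1%:E f <-> cintegrable mu setT f.
Proof.
rewrite /cLp /= cLnorm1E /cintegrable.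
have absE : (\int[mu]_x `|(normc (f x))%:E| = \int[mu]_x (normc (f x))%:E)%E.
  by apply: eq_integral => x _; rewrite gee0_abs// lee_fin normc_ge0.
split => -[mf If]; split => //.
  apply/integrableP; split; last by rewrite absE.
  exact/measurable_EFinP/measurable_normc.
by rewrite -absE; case/integrableP : If.
Qed.

Lemma cLnormy_le f c : 0 <= c -> {ae mu, forall x, normc (f x) <= c} ->
  (cLnorm mu +oo%E f <= c%:E)%E.
Proof.
move=> c0 fc; rewrite /cLnorm unlock; case: ifPn => _; last by rewrite lee_fin.
apply/ess_supP; apply: filterS fc => x fx.
by rewrite /= lee_fin ger0_norm ?normc_ge0.
Qed.

Lemma cLnormy_ae f c : (cLnorm mu +oo%E f <= c%:E)%E ->
  {ae mu, forall x, normc (f x) <= c}.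
Proof.
rewrite /cLnorm unlock; case: ifPn => [_ /ess_supP|].
  by apply: filterS => x /=; rewrite lee_fin ger0_norm ?normc_ge0.
rewrite -leNgt => mu0 _; exists setT; split => //.
by apply/eqP; rewrite eq_le mu0/=.
Qed.

End BoundedIntegrable.

Section MarkovianProperties.
Context {d : measure_display} {X : measurableType d} {R : realType}.
Variable mu : {measure set X -> \bar R}.
Variable T : R -> (X -> R[i]) -> (X -> R[i]).
Hypothesis HT : symmetric_markovian_semigroup mu T.
Implicit Types (f g : X -> R[i]) (u : X -> R) (t c k : R).
Local Notation L2 := (cLp mu 2%:E).

Lemma T_bounded_ae t f c : 0 <= t -> 0 <= c -> L2 f ->
  {ae mu, forall x, normc (f x) <= c} -> {ae mu, forall x, normc (T t f x) <= c}.
Proof.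
move=> t0 c0 f2 fc; have fle := cLnormy_le c0 fc.
apply: cLnormy_ae; apply: (le_trans _ fle).
apply: (markovian_contraction HT) => //; first exact: leey.
by split; [exact: L2_measurable f2|exact: le_lt_trans fle (ltry _)].
Qed.

Lemma T_integrable t f : 0 <= t -> L2 f -> cintegrable mu setT f ->
  cintegrable mu setT (T t f) /\
  (\int[mu]_x (normc (T t f x))%:E <= \int[mu]_x (normc (f x))%:E)%E.
Proof.
move=> t0 f2 If; have If1 := (cLp1P mu f).2 If.
have le1 : (cLnorm mu 1%:E (T t f) <= cLnorm mu 1%:E f)%E.
  exact: (markovian_contraction HT).
rewrite -!cLnorm1E; split => //; apply/cLp1P; split.
  exact: L2_measurable (T_L2 HT t0 f2).
by apply: le_lt_trans le1 _; case: If1.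
Qed.

Lemma T_bounded_integrable t f : 0 <= t -> bounded_integrable mu f ->
  bounded_integrable mu (T t f).
Proof.
move=> t0 bf; have f2 := bounded_integrable_L2 bf.
case: bf => If [c fc]; split; first by have [] := T_integrable t0 f2 If.
exists (Num.max c 0); apply: T_bounded_ae => //; first by rewrite le_max lexx orbT.
by apply: filterS fc => x fx; rewrite le_max fx.
Qed.

Lemma L2_of_real u (f : X -> R[i]) : L2 f -> measurable_fun setT u ->
  (forall x, `|u x| <= normc (f x)) -> L2 (fun x => (u x)%:C).
Proof.
move=> /L2P[mf If] mu_ uf; apply/L2P; split; first exact: cmeasurable_real.
apply: le_integrable If => //.
  by apply/measurable_EFinP/measurable_funX/measurable_normc/cmeasurable_real.
move=> x _; rewrite !gee0_abs ?lee_fin ?sqr_ge0// normc_real.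
by rewrite ler_pXn2r ?nnegrE ?normc_ge0.
Qed.

(** A real function is a difference of positive ones, so that T maps it to a
    difference of positive functions. The bound of the negative part is kept for
    the preservation of lower bounds. *)
Lemma T_real_split t u : 0 <= t -> L2 (fun x => (u x)%:C) ->
  exists up um : X -> R, [/\ forall x, 0 <= um x, forall x, um x <= Num.max (- u x) 0,
    L2 (fun x => (um x)%:C) &
    {ae mu, forall x, [/\ 0 <= T t (fun x => (up x)%:C) x, 0 <= T t (fun x => (um x)%:C) x &
      T t (fun x => (u x)%:C) x = T t (fun x => (up x)%:C) x - T t (fun x => (um x)%:C) x]}].
Proof.
move=> t0 u2; pose up x := Num.max (u x) 0; pose um x := Num.max (- u x) 0.
have muu : measurable_fun setT u by have [] := L2_measurable u2.
have up2 : L2 (fun x => (up x)%:C).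
  apply: (L2_of_real u2); first by apply: measurable_maxr => //; exact: measurable_cst.
  move=> x; rewrite [normc _](normc_real (u x)) /up ger0_norm ?le_max ?lexx ?orbT//.
  by rewrite ge_max ler_norm normr_ge0.
have um2 : L2 (fun x => (um x)%:C).
  apply: (L2_of_real u2).
    by apply: measurable_maxr; [exact: measurableT_comp|exact: measurable_cst].
  move=> x; rewrite [normc _](normc_real (u x)) /um ger0_norm ?le_max ?lexx ?orbT//.
  by rewrite ge_max normr_ge0 andbT -normrN ler_norm.
exists up, um; split => // [x|]; first by rewrite le_max lexx orbT.
have pos (v : X -> R) : (forall x, 0 <= v x) -> L2 (fun x => (v x)%:C) ->
    {ae mu, forall x, 0 <= T t (fun x => (v x)%:C) x}.
  move=> v0 v2; apply: (markovian_positivity HT t0 v2).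
  by apply: nearW => x; rewrite ler0c.
have p1 := pos up (fun x => ltac:(by rewrite le_max lexx orbT)) up2.
have p2 := pos um (fun x => ltac:(by rewrite le_max lexx orbT)) um2.
have S := T_sub_scale HT 1 t0 um2 up2.
rewrite (_ : (fun y => (up y)%:C - 1 * (um y)%:C) = (fun x => (u x)%:C)) in S; last first.
  apply/funext => x; rewrite mul1r -rmorphB/=; congr (_%:C).
  by rewrite /up /um; case: (lerP 0 (u x)) => u0; case: (lerP 0 (- u x)) => u1; rewrite ?(max_l, max_r); lra.
by apply: filterS3 p1 p2 S => x h1 h2 h3; split => //; rewrite h3 mul1r.
Qed.

Lemma T_real_Im t u : 0 <= t -> L2 (fun x => (u x)%:C) ->
  {ae mu, forall x, complex.Im (T t (fun x => (u x)%:C) x) = 0}.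
Proof.
move=> t0 u2; have [up [um [_ _ _]]] := T_real_split t0 u2.
apply: filterS => x [h1 h2 ->]; rewrite Im_add Im_opp.
by rewrite (ger0_Im h1) (ger0_Im h2) subrr.
Qed.

(** The negative part is bounded by k, and so is its image, T being a
    contraction for the supremum norm. *)
Lemma T_lower_bound t u k : 0 <= t -> 0 <= k -> L2 (fun x => (u x)%:C) ->
  (forall x, - k <= u x) ->
  {ae mu, forall x, - k <= complex.Re (T t (fun x => (u x)%:C) x)}.
Proof.
move=> t0 k0 u2 uk; have [up [um [um0 ummax um2 h]]] := T_real_split t0 u2.
have umk : {ae mu, forall x, normc (T t (fun x => (um x)%:C) x) <= k}.
  apply: T_bounded_ae => //; apply: nearW => x; rewrite normc_real ger0_norm//.
  by rewrite (le_trans (ummax x))// ge_max k0 andbT lerNl.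
apply: filterS2 h umk => x [h1 h2 ->] h3; rewrite Re_sub.
have := le_trans (le_Re_normc _) h3; move: h1; rewrite lecE => /andP[_ /=]; lra.
Qed.

Lemma T_Re t f : 0 <= t -> L2 f ->
  {ae mu, forall x, complex.Re (T t f x) = complex.Re (T t (fun x => (complex.Re (f x))%:C) x)}.
Proof.
move=> t0 f2; have [mf1 mf2] := L2_measurable f2.
have r2 : L2 (fun x => (complex.Re (f x))%:C).
  by apply: (L2_of_real f2 mf1) => x; exact: le_normRe_normc.
have i2 : L2 (fun x => (complex.Im (f x))%:C).
  by apply: (L2_of_real f2 mf2) => x; exact: le_normIm_normc.
have S := T_comb HT (0 +i* 1) t0 i2 r2.
rewrite (_ : (fun y => _ * _ + _) = f) in S; last first.
  apply/funext => x; apply: complex_ext.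
    by rewrite Re_add Re_mul /=; ring.
  by rewrite Im_add Im_mul /=; ring.
apply: filterS2 S (T_real_Im t0 i2) => x -> h.
by rewrite Re_add Re_mul h /=; ring.
Qed.

End MarkovianProperties.

(** * Jensen inequality for the semigroup *)

Section Jensen.
Context {d : measure_display} {X : measurableType d} {R : realType}.
Variable mu : {measure set X -> \bar R}.
Variable T : R -> (X -> R[i]) -> (X -> R[i]).
Hypothesis HT : symmetric_markovian_semigroup mu T.
Variable F : R[i] -> R[i] -> R.
Variable tt : nat -> R[i] * R[i] * R.
Hypothesis tt_le : forall n x y, affine2 (tt n) x y <= F x y.
Hypothesis tt_sup : forall x y e, 0 < e -> exists n, F x y - e <= affine2 (tt n) x y.
Hypothesis F00 : F 0 0 <= 0.
Hypothesis F_ge0 : forall x y, 0 <= F x y.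
Implicit Types (f g : X -> R[i]).
Local Notation L2 := (cLp mu 2%:E).

Lemma measurable_affine2 n f g : cmeasurable_fun setT f -> cmeasurable_fun setT g ->
  measurable_fun setT (fun x => affine2 (tt n) (f x) (g x)).
Proof.
move=> mf mg; have [m1 _] := cmeasurable_scale (tt n).1.1 mf.
have [m2 _] := cmeasurable_scale (tt n).1.2 mg.
apply: measurable_funD; last exact: measurable_cst.
exact: measurable_funD.
Qed.

(** F is a countable supremum of continuous functions. *)
Lemma measurable_convex f g : cmeasurable_fun setT f -> cmeasurable_fun setT g ->
  measurable_fun setT (fun x => F (f x) (g x)).
Proof.
move=> mf mg mT; apply: (measurability _ (RGenOInfty.measurableE R)) => //.
move=> /= _ [_ [a ->] <-].
rewrite (_ : _ `&` _ = \bigcup_n (setT `&` (fun x => affine2 (tt n) (f x) (g x)) @^-1` `]a, +oo[)).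
  apply: bigcupT_measurable => n; apply: measurable_affine2 => //; exact: measurable_itv.
apply/seteqP; split => x /=; rewrite !in_itv/= !andbT.
  move=> [_ aF]; have e0 : 0 < (F (f x) (g x) - a) / 2 by rewrite divr_gt0// subr_gt0.
  have [n hn] := tt_sup (f x) (g x) e0; exists n => //; split => //=.
  by rewrite in_itv/= andbT; lra.
move=> [n _ [_ /=]]; rewrite in_itv/= andbT => h; split => //.
exact: lt_le_trans h (tt_le _ _ _).
Qed.

(** Jensen inequality for a positive contraction: it holds for each of the
    countably many affine minorants, whose constant terms are nonpositive since
    F vanishes at 0. *)
Lemma T_jensen t f g : 0 <= t -> L2 f -> L2 g -> L2 (fun x => (F (f x) (g x))%:C) ->
  {ae mu, forall x, F (T t f x) (T t g x) <= complex.Re (T t (fun y => (F (f y) (g y))%:C) x)}.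
Proof.
move=> t0 f2 g2 F2; pose P := fun x => (F (f x) (g x))%:C.
have k0 n : (tt n).2 <= 0.
  by apply: le_trans F00; have := tt_le n 0 0; rewrite /affine2 !mulr0 !add0r.
have each n : {ae mu, forall x, affine2 (tt n) (T t f x) (T t g x) <= complex.Re (T t P x)}.
  set a := (tt n).1.1; set b := (tt n).1.2; set k := (tt n).2.
  pose w x := a * f x + b * g x.
  have ag2 := L2_scale b g2.
  have w2 : L2 w by apply: L2_add => //; exact: L2_scale.
  pose r x : R := complex.Re (w x).
  have mr : measurable_fun setT r by have [] := L2_measurable w2.
  have r2 : L2 (fun x => (r x)%:C).
    by apply: (L2_of_real w2 mr) => x; exact: le_normRe_normc.
  pose u x := F (f x) (g x) - r x.
  have u2 : L2 (fun x => (u x)%:C).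
    have := L2_sub F2 r2; congr cLp; apply/funext => x.
    by rewrite /u rmorphB.
  have ku x : - (- k) <= u x.
    have := tt_le n (f x) (g x); rewrite opprK /affine2 -/a -/b -/k /u /r /w Re_add; lra.
  have nk0 : 0 <= - k by rewrite oppr_ge0; exact: k0.
  have L := T_lower_bound HT t0 nk0 u2 ku.
  have S := T_sub_scale HT 1 t0 r2 F2.
  rewrite (_ : (fun y => (F _ _)%:C - 1 * (r y)%:C) = (fun x => (u x)%:C)) in S; last first.
    by apply/funext => x; rewrite mul1r -rmorphB.
  have Rw := T_Re HT t0 w2.
  have C1 := T_comb HT a t0 f2 ag2.
  have C2 := T_scale HT b t0 g2.
  have W : {ae mu, forall x, complex.Re (T t w x) = complex.Re (a * T t f x) + complex.Re (b * T t g x)}.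
    by apply: filterS2 C1 C2 => x -> ->; rewrite Re_add.
  have L' : {ae mu, forall x, k <= complex.Re (T t P x) - complex.Re (T t (fun y => (r y)%:C) x)}.
    by apply: filterS2 L S => x h1 h2; move: h1; rewrite h2 mul1r Re_sub opprK.
  apply: filterS3 L' Rw W => x h1 h2 h3.
  by move: h1; rewrite -h2 h3 /affine2 -/a -/b -/k; lra.
have all : {ae mu, forall x, forall n, affine2 (tt n) (T t f x) (T t g x) <= complex.Re (T t P x)}.
  exact/ae_foralln.
apply: filterS all => x h; apply/ler_addgt0Pr => e e0.
have [n hn] := tt_sup (T t f x) (T t g x) e0.
by rewrite -lerBlDr; exact: le_trans hn (h n).
Qed.

Lemma T_integral_convex t f g : 0 <= t -> L2 f -> L2 g ->
  bounded_integrable mu (fun x => (F (f x) (g x))%:C) ->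
  (\int[mu]_x (F (T t f x) (T t g x))%:E <= \int[mu]_x (F (f x) (g x))%:E)%E.
Proof.
move=> t0 f2 g2 bF; have F2 := bounded_integrable_L2 bF.
have [IT le1] := T_integrable HT t0 F2 bF.1.
have Tf2 := T_L2 HT t0 f2; have Tg2 := T_L2 HT t0 g2.
have -> : (\int[mu]_x (F (f x) (g x))%:E = \int[mu]_x (normc (F (f x) (g x))%:C)%:E)%E.
  by apply: eq_integral => x _; rewrite normc_real ger0_norm.
apply: le_trans le1; apply: ae_ge0_le_integral => //.
- by move=> x _; rewrite lee_fin.
- by apply/measurable_EFinP/measurable_convex; [exact: L2_measurable Tf2|exact: L2_measurable Tg2].
- by move=> x _; rewrite lee_fin normc_ge0.
- by apply/measurable_EFinP/measurable_normc; case: IT.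
apply: filterS (T_jensen t0 f2 g2 F2) => x h _; rewrite lee_fin (le_trans h)//.
exact: le_Re_normc.
Qed.

End Jensen.

(** * The variation of scalar products along the semigroup *)

Section Variation.
Context {d : measure_display} {X : measurableType d} {R : realType}.
Variable mu : {measure set X -> \bar R}.
Variable T : R -> (X -> R[i]) -> (X -> R[i]).
Hypothesis HT : symmetric_markovian_semigroup mu T.
Variables p q : R.
Hypotheses (p1 : 1 < p) (p2 : p <= 2) (pq : p^-1 + q^-1 = 1).
Implicit Types (f g : X -> R[i]) (c : R[i]).
Local Notation L2 := (cLp mu 2%:E).
Local Notation K := (2 * expR 2 / (p - 1)).
Local Notation bi := (bounded_integrable mu).

Let q1 : 1 <= q.
Proof. exact: ltW (conjugate_exponent_gt1 p1 pq). Qed.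

Let K0 : 0 <= K.
Proof. by rewrite !mulr_ge0 ?expR_ge0// invr_ge0 subr_ge0 ltW. Qed.

Lemma measurable_bellman c f g : normc c = 1 ->
  cmeasurable_fun setT f -> cmeasurable_fun setT g ->
  measurable_fun setT (fun x => tilted_bellman p c (f x) (g x)).
Proof.
move=> c1 mf mg; have [tt [tt1 tt2]] := tilted_bellman_countable p1 p2 c1.
exact: measurable_convex tt1 tt2 _ _ mf mg.
Qed.

Lemma bi_tilted_bellman c f g : normc c = 1 -> bi f -> bi g ->
  bi (fun x => (tilted_bellman p c (f x) (g x))%:C).
Proof.
move=> c1 bf bg; have f2 := bounded_integrable_L2 bf; have g2 := bounded_integrable_L2 bg.
have Ifp := bounded_integrable_powR (ltW p1) bf.
have Igq := bounded_integrable_powR q1 bg.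
have [_ Ifg] := L2_mul_integrable f2 g2.
have le z w : normc (tilted_bellman p c z w)%:C <= K * normc z `^ p + normc w `^ q + normc z * normc w.
  by rewrite normc_real ger0_norm ?tilted_bellman_ge0//; exact: tilted_bellman_le.
split.
  apply: (cintegrable_le (h := fun x => K * normc (f x) `^ p + normc (g x) `^ q + normc (f x) * normc (g x))) => //.
  - by apply/cmeasurable_real/measurable_bellman => //; [exact: L2_measurable f2|exact: L2_measurable g2].
  - have := integrableD measurableT (integrableD measurableT (integrableZl measurableT K Ifp) Igq) Ifg.
    by apply: eq_integrable => // x _; rewrite /= normcM normc_conj.
case: bf => _ [a fa]; case: bg => _ [b gb].
exists (K * `|a| `^ p + `|b| `^ q + `|a| * `|b|).
have p0 : 0 <= p by rewrite (le_trans _ (ltW p1)).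
have q0 : 0 <= q by rewrite (le_trans _ q1).
apply: filterS2 fa gb => x fx gx; apply: (le_trans (le _ _)).
have fa' := le_trans fx (ler_norm a); have gb' := le_trans gx (ler_norm b).
apply: lerD; first apply: lerD.
- by rewrite ler_wpM2l// ler_powRl// normc_ge0.
- by rewrite ler_powRl// normc_ge0.
- by apply: ler_pM => //; exact: normc_ge0.
Qed.

Definition bellman_energy f g : R := \int[mu]_x bellman p (f x) (g x).

Lemma bellman_tilt c x y : bellman p x y = tilted_bellman p c x y + complex.Re (c * (x * y^*)).
Proof. by rewrite /tilted_bellman -mulrA subrK. Qed.

Lemma integral_tilted c f g : normc c = 1 -> bi f -> bi g ->
  \int[mu]_x tilted_bellman p c (f x) (g x) = bellman_energy f g - complex.Re (c * cdot mu f g).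
Proof.
move=> c1 bf bg; have f2 := bounded_integrable_L2 bf; have g2 := bounded_integrable_L2 bg.
have Ifg := L2_mul_integrable f2 g2.
have Icfg := cintegrable_scale c measurableT Ifg.
have IB := cintegrable_Re measurableT (bi_tilted_bellman c1 bf bg).1.
rewrite /bellman_energy /cdot -cintegral_scale//.
under [in RHS]eq_Rintegral do rewrite (bellman_tilt c).
rewrite RintegralD// ?addrK//.
by have := cintegrable_Re measurableT Icfg.
Qed.

(** Choosing c to rotate the difference of the two scalar products to the
    positive half-line turns the decrease of all tilted energies into a bound
    of its modulus. *)
Lemma energy_step t f g : 0 <= t -> bi f -> bi g ->
  normc (cdot mu f g - cdot mu (T t f) (T t g)) <=
  bellman_energy f g - bellman_energy (T t f) (T t g).
Proof.
move=> t0 bf bg; have f2 := bounded_integrable_L2 bf; have g2 := bounded_integrable_L2 bg.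
have bTf := T_bounded_integrable HT t0 bf; have bTg := T_bounded_integrable HT t0 bg.
have [c [c1 cE]] := unimodular_rotation (cdot mu f g - cdot mu (T t f) (T t g)).
have [tt [tt1 tt2]] := tilted_bellman_countable p1 p2 c1.
have bF := bi_tilted_bellman c1 bf bg; have bTF := bi_tilted_bellman c1 bTf bTg.
have h := T_integral_convex HT tt1 tt2 (tilted_bellman00 c p1 p2)
  (fun x y => tilted_bellman_ge0 x y p1 p2 c1) t0 f2 g2 bF.
have IF := cintegrable_Re measurableT bF.1; have ITF := cintegrable_Re measurableT bTF.1.
have {}h : \int[mu]_x tilted_bellman p c (T t f x) (T t g x) <= \int[mu]_x tilted_bellman p c (f x) (g x).
  by apply: fine_le h; [exact: (integrable_fin_num measurableT ITF)|exact: (integrable_fin_num measurableT IF)].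
rewrite !integral_tilted// in h.
have := congr1 (@complex.Re R) cE; rewrite mulrBr Re_sub /=; lra.
Qed.

Lemma bellman_energy_ge0 f g : 0 <= bellman_energy f g.
Proof. by apply: Rintegral_ge0 => x _; exact: bellman_ge0. Qed.

Lemma bellman_energy_le f g : bi f -> bi g ->
  bellman_energy f g <= K * (\int[mu]_x normc (f x) `^ p) + \int[mu]_x normc (g x) `^ q.
Proof.
move=> bf bg; have f2 := bounded_integrable_L2 bf; have g2 := bounded_integrable_L2 bg.
have Ifp := bounded_integrable_powR (ltW p1) bf.
have Igq := bounded_integrable_powR q1 bg.
have IKf := integrableZl measurableT K Ifp.
rewrite -RintegralZl// -RintegralD//.
apply: le_Rintegral => //.
- have c1 := @normc1 R.
  have IB := cintegrable_Re measurableT (bi_tilted_bellman c1 bf bg).1.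
  have Ifg := cintegrable_Re measurableT (cintegrable_scale 1 measurableT (L2_mul_integrable f2 g2)).
  have := integrableD measurableT IB Ifg; apply: eq_integrable => // x _.
  by rewrite /= -EFinD -(bellman_tilt 1).
- by have := integrableD measurableT IKf Igq; apply: eq_integrable.
- by move=> x _; exact: bellman_le.
Qed.

Lemma bellman_energy_ae f f' g g' : bi f -> bi f' -> bi g -> bi g' ->
  {ae mu, forall x, f x = f' x} -> {ae mu, forall x, g x = g' x} ->
  bellman_energy f g = bellman_energy f' g'.
Proof.
move=> bf bf' bg bg' ff gg; rewrite /bellman_energy /Rintegral; congr fine.
have mb u v : bi u -> bi v -> measurable_fun setT (fun x => (bellman p (u x) (v x))%:E).
  move=> bu bv; have u2 := L2_measurable (bounded_integrable_L2 bu).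
  have v2 := L2_measurable (bounded_integrable_L2 bv).
  apply/measurable_EFinP; under eq_fun do rewrite (bellman_tilt 1).
  apply: measurable_funD; first by apply: measurable_bellman => //; exact: normc1.
  by have [] := cmeasurable_scale 1 (cmeasurable_mul u2 (cmeasurable_conj v2)).
apply: ae_eq_integral => //; try exact: mb.
by apply: filterS2 ff gg => x -> -> _.
Qed.

(** Each term is at most the decrease of the energy over one step; these
    decreases telescope, and the energy is nonnegative. *)
Lemma variation_bound h (N : nat) f g : 0 < h -> bi f -> bi g ->
  \sum_(j <- iota 0 N) normc (cdot mu (T (j%:R * h) f) (T (j%:R * h) g)
     - cdot mu (T (j.+1%:R * h) f) (T (j.+1%:R * h) g))
  <= K * (\int[mu]_x normc (f x) `^ p) + \int[mu]_x normc (g x) `^ q.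
Proof.
move=> h0 bf bg; apply: le_trans (bellman_energy_le bf bg).
have hh := ltW h0; have jh (k : nat) : 0 <= k%:R * h by rewrite mulr_ge0.
have bT u (k : nat) : bi u -> bi (T (k%:R * h) u) by exact: T_bounded_integrable.
have next u (k : nat) : bi u -> {ae mu, forall x, T (k.+1%:R * h) u x = T h (T (k%:R * h) u) x}.
  move=> bu; have -> : k.+1%:R * h = h + k%:R * h by rewrite -natr1; ring.
  exact: (semigroupD (markovian_semigroup HT) hh (jh k) (bounded_integrable_L2 bu)).
have zero u : bi u -> {ae mu, forall x, T (0%:R * h) u x = u x}.
  by move=> bu; rewrite mul0r; exact: (semigroup0 (markovian_semigroup HT) (bounded_integrable_L2 bu)).
suff : \sum_(j <- iota 0 N) normc (cdot mu (T (j%:R * h) f) (T (j%:R * h) g)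
     - cdot mu (T (j.+1%:R * h) f) (T (j.+1%:R * h) g)) <=
   bellman_energy f g - bellman_energy (T (N%:R * h) f) (T (N%:R * h) g).
  by move/le_trans; apply; rewrite gerBl; exact: bellman_energy_ge0.
elim: N => [|N IH].
  rewrite big_nil (bellman_energy_ae (bT _ 0%N bf) bf (bT _ 0%N bg) bg (zero _ bf) (zero _ bg)).
  by rewrite subrr.
rewrite big_iotaS.
have bTf := bT f N bf; have bTg := bT g N bg.
have bhf := T_bounded_integrable HT hh bTf; have bhg := T_bounded_integrable HT hh bTg.
have step := energy_step hh bTf bTg.
rewrite (bellman_energy_ae (bT _ N.+1 bf) bhf (bT _ N.+1 bg) bhg (next _ _ bf) (next _ _ bg)).
rewrite (@cdot_ae _ _ _ mu (T (N.+1%:R * h) f) (T h (T (N%:R * h) f)) (T (N.+1%:R * h) g) (T h (T (N%:R * h) g))).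
- lra.
- exact: bounded_integrable_L2 (bT _ _ bf).
- exact: bounded_integrable_L2.
- exact: bounded_integrable_L2 (bT _ _ bg).
- exact: bounded_integrable_L2.
- exact: next.
- exact: next.
Qed.

End Variation.

(** * Truncation and duality *)

Section Truncation.
Context {d : measure_display} {X : measurableType d} {R : realType}.
Variable mu : {measure set X -> \bar R}.
Implicit Types (f g u : X -> R[i]) (p q : R).
Local Notation L2 := (cLp mu 2%:E).
Local Notation n2m := (n2 mu).
Local Notation bi := (bounded_integrable mu).

Definition level_set n f : set X :=
  [set x | n.+1%:R^-1 <= normc (f x) <= n.+1%:R].

(** Cutting off small values as well as large ones makes a square-integrable
    function integrable. *)
Definition truncation n f x : R[i] := if x \in level_set n f then f x else 0.

Lemma measurable_level_set n f : cmeasurable_fun setT f -> measurable (level_set n f).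
Proof.
move=> mf; rewrite (_ : level_set n f = setT `&` (fun x => normc (f x)) @^-1` `[n.+1%:R^-1, n.+1%:R]).
  by apply: measurable_normc.
apply/seteqP; split => x; rewrite /level_set /= in_itv/=; first by split.
by case.
Qed.

Lemma cmeasurable_truncation n f : cmeasurable_fun setT f ->
  cmeasurable_fun setT (truncation n f).
Proof. by move=> mf; exact: (cmeasurable_restrict (measurable_level_set n mf) mf). Qed.

Lemma truncation_le n f x : normc (truncation n f x) <= normc (f x).
Proof. by rewrite /truncation; case: ifPn => // _; rewrite normc0 normc_ge0. Qed.

Lemma truncation_bound n f x : normc (truncation n f x) <= n.+1%:R.
Proof.
rewrite /truncation; case: ifPn => [|_]; last by rewrite normc0.
by rewrite inE => /andP[].
Qed.

Lemma truncation_ge n f x : truncation n f x != 0 ->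
  truncation n f x = f x /\ n.+1%:R^-1 <= normc (f x).
Proof.
by rewrite /truncation; case: ifPn => [|_]; [rewrite inE => /andP[]|rewrite eqxx].
Qed.

Lemma truncation_mono m n f x : (m <= n)%N ->
  normc (truncation m f x) <= normc (truncation n f x).
Proof.
move=> mn; rewrite /truncation; case: ifPn => [|_]; last by rewrite normc0 normc_ge0.
rewrite inE => /andP[h1 h2]; rewrite ifT// inE; apply/andP; split.
  by apply: le_trans h1; rewrite lef_pV2 ?posrE// ler_nat.
by apply: (le_trans h2); rewrite ler_nat.
Qed.

Lemma truncation_near f x : \forall n \near \oo, truncation n f x = f x.
Proof.
have [fx0|fx0] := eqVneq (f x) 0.
  by apply: nearW => n; rewrite /truncation fx0 if_same.
have f0 : 0 < normc (f x) by rewrite lt_neqAle normc_ge0 eq_sym normc_eq0P fx0.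
near=> n; rewrite /truncation ifT// inE; apply/andP; split.
  by apply: ltW; near: n; exact: near_infty_natSinv_lt (PosNum f0).
apply: (@le_trans _ _ n%:R); last by rewrite ler_nat.
by near: n; exact: nbhs_infty_ger.
Unshelve. all: by end_near. Qed.

Lemma bounded_integrable_sqr f g (c c' : R) : L2 f -> cmeasurable_fun setT g ->
  (forall x, normc (g x) <= c * normc (f x) ^+ 2) -> (forall x, normc (g x) <= c') -> bi g.
Proof.
move=> /L2P[mf If] mg gf gc; split; last by exists c'; exact: nearW.
apply: (cintegrable_le (h := fun x => c * normc (f x) ^+ 2)) => //.
by have := integrableZl measurableT c If; apply: eq_integrable.
Qed.

Lemma level_ge1 n (r : R) : n.+1%:R^-1 <= r -> 1 <= n.+1%:R ^+ 2 * r ^+ 2.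
Proof.
move=> h; rewrite -exprMn exprn_ege1//.
by rewrite -(@ler_pM2l _ n.+1%:R)// mulfV ?pnatr_eq0// in h.
Qed.

Lemma bi_truncation n f : L2 f -> bi (truncation n f).
Proof.
move=> f2; apply: (@bounded_integrable_sqr f _ (n.+1%:R ^+ 3) n.+1%:R f2).
- exact: cmeasurable_truncation (L2_measurable f2).
- move=> x; have [->|t0] := eqVneq (truncation n f x) 0.
    by rewrite normc0 mulr_ge0 ?sqr_ge0// exprn_ge0.
  have [_ /level_ge1 h1] := truncation_ge t0.
  rewrite (le_trans (truncation_bound n f x))// exprS -mulrA ler_peMr//.
- exact: truncation_bound.
Qed.

Lemma truncation_cvg f : L2 f -> n2m (fun x => f x - truncation n f x) @[n --> \oo] --> (0 : R).
Proof.
move=> f2; have [mf If] := (L2P mu f).1 f2.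
have t2 n := bounded_integrable_L2 (bi_truncation n f2).
pose D n x := f x - truncation n f x.
have D2 n : L2 (D n) by exact: L2_sub.
apply: (dominated_cvg_n2 D2 If) => [n x|x].
  rewrite ler_pXn2r ?nnegrE ?normc_ge0// /D /truncation; case: ifPn => _.
    by rewrite subrr normc0 normc_ge0.
  by rewrite subr0.
apply: cvg_near_cst.
by near=> n; rewrite /D (near (truncation_near f x) n)// subrr normc0.
Unshelve. all: by end_near. Qed.

(** The classical extremal test function |v|^(p-2) v, v a truncation of u, is
    multiplied by a factor s that balances the two terms of the bound. *)
Lemma Lp_bound_by_duality p q u (A C : R) : 1 < p -> p^-1 + q^-1 = 1 ->
  0 <= A -> 0 <= C -> L2 u ->
  (forall g, bi g -> normc (cdot mu u g) <= C * (A + \int[mu]_x normc (g x) `^ q)) ->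
  (\int[mu]_x (normc (u x) `^ p)%:E <= (A * (2 * C) `^ p)%:E)%E.
Proof.
move=> p1 pq A0 C0 u2 H; have p0 : 0 < p by rewrite (lt_trans _ p1).
have q0 : 0 < q by rewrite (lt_trans _ (conjugate_exponent_gt1 p1 pq)).
have pqE : (p - 1) * q = p.
  by rewrite (conjugate_exponent p1 pq); field; rewrite subr_eq0 gt_eqF.
have mu_ := L2_measurable u2.
pose v n := truncation n u; pose g n x := (normc (v n x) `^ (p - 2))%:C * v n x.
have mv n : cmeasurable_fun setT (v n) by exact: cmeasurable_truncation.
have bv n : bi (v n) by exact: bi_truncation.
have gE n x : normc (g n x) = normc (v n x) `^ (p - 1).
  rewrite /g normc_scale ger0_norm ?powR_ge0//.
  have := normc_ge0 (v n x); rewrite le_eqVlt => /orP[/eqP <-|v0].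
    by rewrite mulr0 powR0// subr_eq0 gt_eqF.
  rewrite -{2}(powRr1 (ltW v0)) gt0_powRD//; congr (_ `^ _); ring.
have mg n : cmeasurable_fun setT (g n).
  apply: cmeasurable_mul => //; apply: cmeasurable_real.
  apply: (@measurableT_comp _ _ _ _ _ _ (@powR R ^~ (p - 2))) => //.
  exact: measurable_normc.
have p10 : 0 <= p - 1 by rewrite subr_ge0 ltW.
have gb n x : normc (g n x) <= n.+1%:R `^ (p - 1).
  by rewrite gE ler_powRl ?normc_ge0// truncation_bound.
have bg n : bi (g n).
  apply: (@bounded_integrable_sqr u _ (n.+1%:R `^ (p - 1) * n.+1%:R ^+ 2) (n.+1%:R `^ (p - 1)) u2) => // x.
  have [v0|v0] := eqVneq (v n x) 0.
    rewrite /g v0 mulr0 normc0 mulr_ge0 ?sqr_ge0// mulr_ge0 ?powR_ge0 ?sqr_ge0//.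
  have [_ /level_ge1 h1] := truncation_ge v0.
  by rewrite (le_trans (gb n x))// -mulrA ler_peMr// powR_ge0.
pose I n := \int[mu]_x normc (v n x) `^ p.
have Iv n := bounded_integrable_powR (ltW p1) (bv n).
have I0 n : 0 <= I n by apply: Rintegral_ge0 => x _; exact: powR_ge0.
have cdE n : cdot mu u (g n) = (I n)%:C.
  rewrite -cintegral_real /cdot; congr cintegral; apply/funext => x.
  have [v0|v0] := eqVneq (v n x) 0.
    rewrite /g v0 mulr0 conj_conjc conjc0 mulr0 normc0 powR0//; exact: lt0r_neq0.
  have [vu _] := truncation_ge v0; rewrite /g /v vu.
  rewrite conjc_mul [X in _ * (X * _)]conj_conjc conjc_real mulrCA mulc_conj -rmorphM/=.
  congr (_%:C); have u0 : 0 < normc (u x).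
    by rewrite lt_neqAle normc_ge0 andbT eq_sym normc_eq0P -vu.
  rewrite -powR_mulrn ?normc_ge0// gt0_powRD//; congr (_ `^ _); ring.
have Gq n (s : R) : 0 <= s -> \int[mu]_x normc (s%:C * g n x) `^ q = s `^ q * I n.
  move=> s0; rewrite /I -RintegralZl//; last exact: Iv.
  apply: eq_Rintegral => x _.
  rewrite normc_scale ger0_norm// gE powRM ?powR_ge0//; congr (_ * _).
  by rewrite -powRrM pqE.
have main n (s : R) : 0 < s -> s * I n <= C * (A + s `^ q * I n).
  move=> s0; have bsg : bi (fun x => s%:C * g n x).
    case: (bg n) => Ig [c gc]; split; first exact: cintegrable_scale.
    exists (s * c); apply: filterS gc => x hx.
    by rewrite normc_scale gtr0_norm// ler_pM2l.
  have := H _ bsg; rewrite cdotZr//; last exact: bounded_integrable_L2.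
  rewrite cdE conj_conjc conjc_real -rmorphM normc_real ger0_norm ?mulr_ge0 ?(ltW s0)//.
  by rewrite Gq// ltW.
have bound n : I n <= A * (2 * C) `^ p.
  move: C0; rewrite le_eqVlt => /orP[/eqP C0|C0].
    have := main n 1 ltr01; rewrite -C0 mul0r mul1r => /le_trans; apply.
    by rewrite mulr_ge0 ?powR_ge0.
  have C2 : 0 < 2 * C by rewrite mulr_gt0.
  pose s := (2 * C) `^ (- (p - 1)).
  have s0 : 0 < s by exact: powR_gt0.
  have sq : s `^ q = s / (2 * C).
    rewrite /s -powRrM mulNr pqE -[X in _ / X](powRr1 (ltW C2)) -powRN gt0_powRD//.
    by congr (_ `^ _); ring.
  have sE : s * (2 * C) `^ p = 2 * C.
    rewrite /s gt0_powRD// -[RHS](powRr1 (ltW C2)); congr (_ `^ _); ring.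
  have := main n s s0; rewrite sq.
  have -> : C * (A + s / (2 * C) * I n) = C * A + s * I n / 2 by field; rewrite gt_eqF.
  move=> h; rewrite -(ler_pM2l s0).
  have -> : s * (A * (2 * C) `^ p) = A * (2 * C) by rewrite mulrCA sE.
  lra.
have mvp n : measurable_fun setT (fun x => (normc (v n x) `^ p)%:E).
  by case/integrableP : (Iv n).
have lim : (\int[mu]_x (normc (v n x) `^ p)%:E)%E @[n --> \oo] -->
    (\int[mu]_x limn (fun n => (normc (v n x) `^ p)%:E))%E.
  apply: cvg_monotone_convergence => //.
  - by move=> n x _; rewrite lee_fin powR_ge0.
  - move=> x _ m n mn; rewrite lee_fin ler_powRl ?normc_ge0 ?(ltW p0)//.
    exact: truncation_mono.
have limE : (\int[mu]_x limn (fun n => (normc (v n x) `^ p)%:E) = \int[mu]_x (normc (u x) `^ p)%:E)%E.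
  apply: eq_integral => x _; apply/cvg_lim => //; apply: cvg_near_cst.
  by near=> n; rewrite /v (near (truncation_near u x) n).
rewrite -limE -(cvg_lim _ lim)//; apply: lime_le; first exact: cvgP lim.
apply: nearW => n; rewrite -[leLHS]fineK ?(integrable_fin_num _ (Iv n))//.
by rewrite lee_fin; exact: bound.
Unshelve. all: by end_near. Qed.

End Truncation.

(** * The multiplier bound *)

Section MultiplierBound.
Context {d : measure_display} {X : measurableType d} {R : realType}.
Variable mu : {measure set X -> \bar R}.
Variable T : R -> (X -> R[i]) -> (X -> R[i]).
Hypothesis HT : symmetric_markovian_semigroup mu T.
Variable E : R -> (X -> R[i]) -> (X -> R[i]).
Hypothesis HA : resolution_of_operator mu E (generator mu T).
Variable M : R -> R[i].
Hypothesis HM : bounded_borel_on_pos M.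
Variable Tm : (X -> R[i]) -> (X -> R[i]).
Hypothesis HTm : spectral_operator mu E (laplace_multiplier M) Tm.
Implicit Types (f g : X -> R[i]) (p q : R).
Local Notation L2 := (cLp mu 2%:E).
Local Notation n2m := (n2 mu).
Local Notation bi := (bounded_integrable mu).
Local Notation K := (sup_norm M).
Local Notation S := (step_operator T M).

(** The maximum covers the exponents above 2, which are reached by exchanging
    the two functions: then 1 / (q - 1) = p - 1. *)
Definition weak_constant p : R := 2 * expR 2 * Num.max (p - 1) (1 / (p - 1)).

Lemma cdot_double h (k : nat) f g : 0 < h -> L2 f -> L2 g ->
  cdot mu (T (k%:R * (2 * h)) f) g = cdot mu (T (k%:R * h) f) (T (k%:R * h) g).
Proof.
move=> h0 f2 g2; have kh : 0 <= k%:R * h by rewrite mulr_ge0// ltW.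
have Tf2 := T_L2 HT kh f2; have Tg2 := T_L2 HT kh g2.
rewrite -(markovian_symmetry HT kh Tf2 g2).
have k2h : 0 <= k%:R * (2 * h) by rewrite mulr_ge0// mulr_ge0// ltW.
apply: (cdot_ae (T_L2 HT k2h f2) (T_L2 HT kh Tf2) g2 g2); last exact: nearW.
have -> : k%:R * (2 * h) = k%:R * h + k%:R * h by ring.
exact: (semigroupD (markovian_semigroup HT) kh kh f2).
Qed.

(** Symmetry splits the time evenly between f and g: the increments of T at
    mesh 2 h become differences of scalar products at mesh h. *)
Lemma step_operator_pairing h N f g (V : R) : 0 < h -> bi f -> bi g ->
  \sum_(j <- iota 0 N) normc (cdot mu (T (j%:R * h) f) (T (j%:R * h) g)
     - cdot mu (T (j.+1%:R * h) f) (T (j.+1%:R * h) g)) <= V ->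
  normc (cdot mu (S (2 * h) N f) g) <= K * V.
Proof.
move=> h0 bf bg VP; have f2 := bounded_integrable_L2 bf; have g2 := bounded_integrable_L2 bg.
have h20 : 0 < 2 * h by rewrite mulr_gt0.
have jh (k : nat) : 0 <= k%:R * (2 * h) by rewrite mulr_ge0// ltW.
have T2 (k : nat) := T_L2 HT (jh k) f2.
rewrite /step_operator cdot_suml//; last first.
  by move=> j _; apply: L2_scale; exact: L2_sub.
have K0 := sup_norm_ge0 HM.
apply: le_trans (ler_wpM2l K0 VP); rewrite big_distrr/=.
elim: (iota 0 N) => [|j s IH]; first by rewrite !big_nil normc0.
rewrite !big_cons; apply: (le_trans (le_normc_add _ _)); apply: lerD => //.
rewrite cdotZl ?cdotBl//; last exact: L2_sub.
rewrite !cdot_double// normcM normc_distC ler_wpM2r ?normc_ge0//.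
by apply: normc_interval_mean => //; rewrite ltr_pM2r// ltr_nat.
Qed.

Lemma step_operator_weak_bound p q h N f g : 1 < p -> p^-1 + q^-1 = 1 -> 0 < h ->
  bi f -> bi g ->
  normc (cdot mu (S h N f) g) <=
  K * (weak_constant p * (\int[mu]_x normc (f x) `^ p + \int[mu]_x normc (g x) `^ q)).
Proof.
move=> p1 pq h0 bf bg.
have p0 : 0 < p by rewrite (lt_trans _ p1).
have -> : h = 2 * (h / 2) by field.
have h20 : 0 < h / 2 by rewrite divr_gt0.
apply: step_operator_pairing => //.
have If : 0 <= \int[mu]_x normc (f x) `^ p by apply: Rintegral_ge0 => x _; exact: powR_ge0.
have Ig : 0 <= \int[mu]_x normc (g x) `^ q by apply: Rintegral_ge0 => x _; exact: powR_ge0.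
have p10 : 0 < p - 1 by rewrite subr_gt0.
have e1 : 1 <= 2 * expR 2 :> R by have := expR_ge1Dx (2 : R); lra.
have max1 : 1 <= Num.max (p - 1) (1 / (p - 1)).
  rewrite le_max; have [h1|h1] := lerP 1 (p - 1) => //=.
  by rewrite ler_pdivlMr// mul1r ltW.
have W1 : 1 <= weak_constant p by rewrite /weak_constant -[leLHS]mulr1 ler_pM.
have [p2|p2] := lerP p 2.
  apply: (le_trans (variation_bound HT p1 p2 pq N h20 bf bg)).
  rewrite mulrDr; apply: lerD; last by rewrite ler_peMl.
  rewrite ler_wpM2r// /weak_constant ler_pM2l ?mulr_gt0 ?expR_gt0//.
  by rewrite le_max div1r lexx orbT.
have qE := conjugate_exponent p1 pq; have q1 := conjugate_exponent_gt1 p1 pq.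
have q2 : q <= 2 by rewrite qE ler_pdivrMr//; lra.
have qp : q^-1 + p^-1 = 1 by rewrite addrC.
have := variation_bound HT q1 q2 qp N h20 bg bf.
have sym (k : nat) : cdot mu (T (k%:R * (h / 2)) g) (T (k%:R * (h / 2)) f) =
    (cdot mu (T (k%:R * (h / 2)) f) (T (k%:R * (h / 2)) g))^*.
  have kh : 0 <= k%:R * (h / 2) by rewrite mulr_ge0// ltW.
  by apply: cdotC; apply: (T_L2 HT kh); exact: bounded_integrable_L2.
under eq_bigr do rewrite !sym -conjc_sub normc_conj.
move/le_trans; apply; rewrite addrC mulrDr; apply: lerD; first by rewrite ler_peMl.
rewrite ler_wpM2r// /weak_constant ler_pM2l ?mulr_gt0 ?expR_gt0//.
have -> : (q - 1)^-1 = p - 1 by rewrite qE; field; rewrite !gt_eqF//; lra.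
by rewrite le_max lexx.
Qed.

(** The bound passes to f in L^2 and L^p by truncation, which decreases the
    integral of |f|^p, and then from the step operators to their limit. *)
Lemma multiplier_weak_bound p q f g : 1 < p -> p^-1 + q^-1 = 1 ->
  L2 f -> cLp mu p%:E f -> bi g ->
  normc (cdot mu (Tm f) g) <=
  K * (weak_constant p * (\int[mu]_x normc (f x) `^ p + \int[mu]_x normc (g x) `^ q)).
Proof.
move=> p1 pq f2 fp bg; have g2 := bounded_integrable_L2 bg.
have p0 : 0 < p by rewrite (lt_trans _ p1).
set B := K * _.
have Wp : 0 <= weak_constant p.
  rewrite /weak_constant mulr_ge0 ?mulr_ge0 ?expR_ge0// le_max subr_ge0 ltW//.
have K0 := sup_norm_ge0 HM.
have [_ Ifp] := (cLpP mu f p0).1 fp.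
pose fn n := truncation n f.
have bfn n : bi (fn n) by exact: bi_truncation.
have fn2 n := bounded_integrable_L2 (bfn n).
have Bn n h N : 0 < h -> normc (cdot mu (S h N (fn n)) g) <= B.
  move=> h0; apply: (le_trans (step_operator_weak_bound N p1 pq h0 (bfn n) bg)).
  rewrite ler_wpM2l// ler_wpM2l// lerD2r; apply: le_Rintegral => //.
    exact: bounded_integrable_powR (ltW p1) (bfn n).
  move=> x _; rewrite ler_powRl ?normc_ge0 ?(ltW p0)//; exact: truncation_le.
have Bf h N : 0 < h -> normc (cdot mu (S h N f) g) <= B.
  move=> h0; have jh (k : nat) : 0 <= k%:R * h by rewrite mulr_ge0// ltW.
  pose Sg x := \sum_(j <- iota 0 N) (interval_mean M (j%:R * h) (j.+1%:R * h))^*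
     * (T (j.+1%:R * h) g x - T (j%:R * h) g x).
  have Tg2 (k : nat) := T_L2 HT (jh k) g2.
  have Sg2 : L2 Sg by apply: L2_sum => j _; apply: L2_scale; exact: L2_sub.
  have adj u : L2 u -> cdot mu (S h N u) g = cdot mu u Sg.
    move=> u2; have Tu2 (k : nat) := T_L2 HT (jh k) u2.
    rewrite [RHS]cdotC// /Sg !cdot_suml//; last 2 first.
    - by move=> j _; apply: L2_scale; exact: L2_sub.
    - by move=> j _; apply: L2_scale; exact: L2_sub.
    rewrite rmorph_sum/=; apply: eq_bigr => j _.
    rewrite !cdotZl ?cdotBl//; try exact: L2_sub.
    rewrite conjc_mul conjc_conj conjc_sub -!cdotC//.
    by rewrite !(markovian_symmetry HT).
  rewrite adj//.
  have lim : n2m (fun x => f x - fn n x) * n2m Sg + B @[n --> \oo] --> B.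
    rewrite -[X in _ --> X]add0r; apply: cvgD; last exact: cvg_cst.
    rewrite -[X in _ --> X](mul0r (n2m Sg)); apply: cvgM; last exact: cvg_cst.
    exact: truncation_cvg.
  rewrite -(cvg_lim _ lim)//; apply: limr_ge; first exact: cvgP lim.
  apply: nearW => n.
  have -> : cdot mu f Sg = cdot mu (fun x => f x - fn n x) Sg + cdot mu (fn n) Sg.
    by rewrite cdotBl// subrK.
  apply: (le_trans (le_normc_add _ _)); apply: lerD.
    by apply: cauchy_schwarz => //; exact: L2_sub.
  by rewrite -adj//; exact: Bn.
have [_ Tm2 _ _] := HTm f2.
pose Sn n := S n.+1%:R^-1 (n.+1 ^ 2) f.
have S2 n : L2 (Sn n) by apply: step_operator_L2 => //; rewrite invr_gt0.
have lim : n2m (fun x => Tm f x - Sn n x) * n2m g + B @[n --> \oo] --> B.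
  rewrite -[X in _ --> X]add0r; apply: cvgD; last exact: cvg_cst.
  rewrite -[X in _ --> X](mul0r (n2m g)); apply: cvgM; last exact: cvg_cst.
  exact: (multiplier_step_limit HT HA HM HTm f2).
rewrite -(cvg_lim _ lim)//; apply: limr_ge; first exact: cvgP lim.
apply: nearW => n.
have -> : cdot mu (Tm f) g = cdot mu (fun x => Tm f x - Sn n x) g + cdot mu (Sn n) g.
  by rewrite cdotBl// subrK.
apply: (le_trans (le_normc_add _ _)); apply: lerD.
  by apply: cauchy_schwarz => //; exact: L2_sub.
by apply: Bf; rewrite invr_gt0.
Qed.

Lemma multiplier_Lp_bound p f : 1 < p -> L2 f -> cLp mu p%:E f ->
  (cLnorm mu p%:E (Tm f) <= (2 * weak_constant p * K)%:E * cLnorm mu p%:E f)%E.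
Proof.
move=> p1 f2 fp; have p0 : 0 < p by rewrite (lt_trans _ p1).
have pq := conjugate_exponent_exists p.
have [_ Ifp] := (cLpP mu f p0).1 fp.
have [_ Tm2 _ _] := HTm f2.
have Wp : 0 <= weak_constant p.
  by rewrite /weak_constant mulr_ge0 ?mulr_ge0 ?expR_ge0// le_max subr_ge0 ltW.
have K0 := sup_norm_ge0 HM.
pose A := \int[mu]_x normc (f x) `^ p.
have A0 : 0 <= A by apply: Rintegral_ge0 => x _; exact: powR_ge0.
have C0 : 0 <= K * weak_constant p by rewrite mulr_ge0.
have bound := Lp_bound_by_duality p1 pq A0 C0 Tm2
  (fun g bg => ltac:(rewrite -mulrA; exact: multiplier_weak_bound p1 pq f2 fp bg)).
rewrite !cLnorm_powE//.
have AE : (\int[mu]_x (normc (f x) `^ p)%:E = A%:E)%E.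
  by rewrite /A /Rintegral fineK// integrable_fin_num.
rewrite AE poweR_EFin -EFinM.
apply: (@le_trans _ _ ((A * (2 * (K * weak_constant p)) `^ p)%:E `^ p^-1)%E).
  apply: gt0_ler_poweR => //.
  - by rewrite invr_ge0 ltW.
  - by rewrite in_itv/= leey andbT; apply: integral_ge0 => x _; rewrite lee_fin powR_ge0.
  - by rewrite in_itv/= leey andbT lee_fin (mulr_ge0 A0)// powR_ge0.
rewrite poweR_EFin lee_fin (powRM p^-1 A0 (powR_ge0 _ _)) -powRrM divff ?gt_eqF//.
rewrite powRr1; last exact: mulr_ge0 (ler0n _ 2) C0.
by apply: ler_of_eq; ring.
Qed.

Lemma step_operator_comb h N (a : R[i]) f g u : 0 < h -> L2 f -> L2 g -> L2 u ->
  {ae mu, forall x, u x = a * f x + g x} ->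
  {ae mu, forall x, S h N u x = a * S h N f x + S h N g x}.
Proof.
move=> h0 f2 g2 u2 ufg; have jh (k : nat) : 0 <= k%:R * h by rewrite mulr_ge0// ltW.
have fg2 : L2 (fun y => a * f y + g y) by apply: L2_add => //; exact: L2_scale.
have all : {ae mu, forall x, forall k : nat,
    T (k%:R * h) u x = a * T (k%:R * h) f x + T (k%:R * h) g x}.
  apply/ae_foralln => k.
  by apply: filterS2 (T_ae HT (jh k) u2 fg2 ufg) (T_comb HT a (jh k) f2 g2) => x -> ->.
apply: filterS all => x TE; rewrite /step_operator big_distrr/= -big_split/=.
by apply: eq_bigr => j _; rewrite !TE; ring.
Qed.

(** Linearity and compatibility with almost everywhere equality are both
    instances of this property of the step operators, which passes to the
    limit. *)
Lemma multiplier_comb (a : R[i]) f g u : L2 f -> L2 g -> L2 u ->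
  {ae mu, forall x, u x = a * f x + g x} ->
  {ae mu, forall x, Tm u x = a * Tm f x + Tm g x}.
Proof.
move=> f2 g2 u2 ufg.
have [_ Tf2 _ _] := HTm f2; have [_ Tg2 _ _] := HTm g2; have [_ Tu2 _ _] := HTm u2.
have af2 := L2_scale a Tf2.
apply: n2_sub_eq0_ae => //; first exact: L2_add.
apply/eqP; rewrite eq_le n2_ge0 andbT.
have l1 := multiplier_step_limit HT HA HM HTm f2.
have l2 := multiplier_step_limit HT HA HM HTm g2.
have l3 := multiplier_step_limit HT HA HM HTm u2.
have l := cvg0_comb 1 l3 (cvg0_comb (normc a) l1 l2).
rewrite -(cvg_lim _ l)//; apply: limr_ge; first exact: cvgP l.
apply: nearW => n; rewrite mul1r.
have h0 : 0 < n.+1%:R^-1 :> R by rewrite invr_gt0.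
have Sf2 := step_operator_L2 HT M (n.+1 ^ 2) h0 f2.
have Sg2 := step_operator_L2 HT M (n.+1 ^ 2) h0 g2.
have Su2 := step_operator_L2 HT M (n.+1 ^ 2) h0 u2.
apply: (le_trans (n2_triangle Tu2 (L2_add af2 Tg2) Su2)); rewrite lerD2l.
rewrite -n2_scale; last exact: L2_sub.
apply: le_trans (n2D (L2_scale a (L2_sub Tf2 Sf2)) (L2_sub Tg2 Sg2)).
rewrite n2_distC; apply: ler_of_eq; apply: n2_ae.
- by apply: L2_sub => //; exact: L2_add.
- by apply: L2_add; [apply: L2_scale|]; exact: L2_sub.
by apply: filterS (step_operator_comb (n.+1 ^ 2) h0 f2 g2 u2 ufg) => x ->; ring.
Qed.

End MultiplierBound.

Theorem theorem1 (R : realType) :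
  exists C : R -> R,
    (C : R -> R^o) =O_ (1^'+) (fun p : R => (p - 1)^-1 : R^o) /\
    forall p : R, 1 < p ->
    forall (d : measure_display) (X : measurableType d)
           (mu : {sigma_finite_measure set X -> \bar R})
           (T : R -> (X -> R[i]) -> (X -> R[i])),
      symmetric_markovian_semigroup mu T ->
    forall E : R -> (X -> R[i]) -> (X -> R[i]),
      resolution_of_operator mu E (generator mu T) ->
    forall M : R -> R[i],
      bounded_borel_on_pos M ->
    forall Tm : (X -> R[i]) -> (X -> R[i]),
      spectral_operator mu E (laplace_multiplier M) Tm ->
      linear_operator_on mu (cLp mu 2%:E `&` cLp mu p%:E) Tm /\
      forall f, cLp mu 2%:E f -> cLp mu p%:E f ->
        (cLnorm mu p%:E (Tm f) <= (C p * sup_norm M)%:E * cLnorm mu p%:E f)%E.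
Proof.
exists (fun p => 2 * weak_constant p); split.
  apply/eqOP; exists (4 * expR 2); split; first exact: num_real.
  move=> k hk; near=> p.
  have p1 : 1 < p by near: p; exact: nbhs_right_gt.
  have p2 : p <= 2.
    by near: p; apply: nbhs_right_le; lra.
  have p10 : 0 < p - 1 by rewrite subr_gt0.
  have ip : 1 <= (p - 1)^-1 by rewrite invf_ge1//; lra.
  rewrite /weak_constant max_r ?div1r; last by lra.
  rewrite /= !normrM (ger0_norm (expR_ge0 _)) !ger0_norm ?invr_ge0 ?(ltW p10)//.
  rewrite !mulrA ler_wpM2r ?invr_ge0 ?(ltW p10)//; lra.
move=> p p1 d X mu T HT E HA M HM Tm HTm.
have bound f : cLp mu 2%:E f -> cLp mu p%:E f ->
    (cLnorm mu p%:E (Tm f) <= (2 * weak_constant p * sup_norm M)%:E * cLnorm mu p%:E f)%E.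
  by move=> f2 fp; exact: (multiplier_Lp_bound HT HA HM HTm p1 f2 fp).
split => //; split => [f [f2 fp]|f g [f2 _] [g2 _] fg|a f g [f2 _] [g2 _]].
- have [_ Tf2 _ _] := HTm f f2; split => //; split; first exact: L2_measurable Tf2.
  apply: (le_lt_trans (bound f f2 fp)).
  case: fp => _ fp; have f0 : (0 <= cLnorm mu p%:E f)%E by exact: Lnorm_ge0.
  rewrite -(fineK (x := cLnorm mu p%:E f)) ?ge0_fin_numE//.
  by rewrite -EFinM ltry.
- have fg' : {ae mu, forall x, f x = 0 * g x + g x}.
    by apply: filterS fg => x ->; rewrite mul0r add0r.
  apply: filterS (multiplier_comb HT HA HM HTm g2 g2 f2 fg') => x ->.
  by rewrite mul0r add0r.
- apply: (multiplier_comb HT HA HM HTm f2 g2); last exact: nearW.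
  by apply: L2_add => //; exact: L2_scale.
Unshelve. all: by end_near. Qed.
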